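(* Let $0<\beta<1$ and let $b$ be a locally integrable function on $\mathbb{Q}_p^n$. Then the following statements are equivalent: (C.1) $b\in\Lambda_\beta(\mathbb{Q}_p^n)$. (C.2) The commutator $\mathcal{M}_b^p$ is bounded from $L^{r(\cdot)}(\mathbb{Q}_p^n)$ to $L^{q(\cdot)}(\mathbb{Q}_p^n)$ for all $r(\cdot),q(\cdot)\in\mathscr{C}^{\log}(\mathbb{Q}_p^n)$ with $r(\cdot)\in\mathscr{P}(\mathbb{Q}_p^n)$, $r_+<\frac{n}{\beta}$ and $1/q(\cdot)=1/r(\cdot)-\beta/n$. (C.3) The commutator $\mathcal{M}_b^p$ is bounded from $L^{r(\cdot)}(\mathbb{Q}_p^n)$ to $L^{q(\cdot)}(\mathbb{Q}_p^n)$ for some $r(\cdot),q(\cdot)\in\mathscr{C}^{\log}(\mathbb{Q}_p^n)$ with $r(\cdot)\in\mathscr{P}(\mathbb{Q}_p^n)$, $r_+<\frac{n}{\beta}$ and $1/q(\cdot)=1/r(\cdot)-\beta/n$. (C.4) There exist some $r(\cdot),q(\cdot)\in\mathscr{C}^{\log}(\mathbb{Q}_p^n)$ with $r(\cdot)\in\mathscr{P}(\mathbb{Q}_p^n)$, $r_+<\frac{n}{\beta}$ and $1/q(\cdot)=1/r(\cdot)-\beta/n$ such that $$\sup_{\gamma\in\mathbb{Z},\,x\in\mathbb{Q}_p^n}\frac{1}{|B_\gamma(x)|_h^{\beta/n}}\,\frac{\big\|\big(b-b_{B_\gamma(x)}\big)\chi_{B_\gamma(x)}\big\|_{L^{q(\cdot)}(\mathbb{Q}_p^n)}}{\|\chi_{B_\gamma(x)}\|_{L^{q(\cdot)}(\mathbb{Q}_p^n)}}<\infty.$$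 (C.5) For all $r(\cdot),q(\cdot)\in\mathscr{C}^{\log}(\mathbb{Q}_p^n)$ with $r(\cdot)\in\mathscr{P}(\mathbb{Q}_p^n)$, $r_+<\frac{n}{\beta}$ and $1/q(\cdot)=1/r(\cdot)-\beta/n$, the displayed supremum in (C.4) is finite.
   Context: Let $p$ be a prime, $n\ge1$, $\mathbb{Q}_p$ the field of $p$-adic numbers with $p$-adic absolute value $|\cdot|_p$, and $\mathbb{Q}_p^n$ equipped with $|x|_p=\max_{1\le j\le n}|x_j|_p$. For $\gamma\in\mathbb{Z}$ and $a\in\mathbb{Q}_p^n$, $B_\gamma(a)=\{x\in\mathbb{Q}_p^n:|x-a|_p\le p^\gamma\}$. Haar measure on $\mathbb{Q}_p^n$ is normalized by $|B_0(0)|_h=1$, so $|B_\gamma(a)|_h=p^{n\gamma}$; $|E|_h$ is the Haar measure of $E$, $dx$ denotes integration against it, and $\chi_E$ is the characteristic function of $E$. For a locally integrable $b$, $b_{B_\gamma(x)}=|B_\gamma(x)|_h^{-1}\int_{B_\gamma(x)}b(y)\,dy$. Functions are real-valued, and as usual functions equal almost everywhere are identified in function spaces. Maximal commutator: $\mathcal{M}_b^p(f)(x)=\sup_{\gamma\in\mathbb{Z}}|B_\gamma(x)|_h^{-1}\int_{B_\gamma(x)}|b(x)-b(y)|\,|f(y)|\,dy$. An operator $T$ is bounded from a normed function space $X$ to $Y$ if there is a constant $C$ with $\|Tf\|_Y\le C\|f\|_X$ for all $f\in X$. Lipschitz space ($0<\beta<1$): $\Lambda_\beta(\mathbb{Q}_p^n)$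 is the set of measurable $f$ with $\|f\|_{\Lambda_\beta(\mathbb{Q}_p^n)}=\sup_{x\ne y}\frac{|f(x)-f(y)|}{|x-y|_p^\beta}<\infty$. Variable exponents: for measurable $q(\cdot)$ on $\mathbb{Q}_p^n$ put $q_-=\operatorname{ess\,inf}_{x\in\mathbb{Q}_p^n}q(x)$, $q_+=\operatorname{ess\,sup}_{x\in\mathbb{Q}_p^n}q(x)$, and $q_\pm(B)$ for the corresponding quantities over a ball $B$. $\mathscr{P}(\mathbb{Q}_p^n)$ is the set of measurable $q(\cdot):\mathbb{Q}_p^n\to(1,\infty)$ with $1<q_-\le q(x)\le q_+<\infty$. $L^{q(\cdot)}(\mathbb{Q}_p^n)$ is the space of measurable $f$ with $\int_{\mathbb{Q}_p^n}(|f(x)|/\eta)^{q(x)}dx<\infty$ for some $\eta>0$, with norm $\|f\|_{L^{q(\cdot)}(\mathbb{Q}_p^n)}=\inf\{\eta>0:\int_{\mathbb{Q}_p^n}(|f(x)|/\eta)^{q(x)}dx\le1\}$. $\mathscr{C}^{\log}(\mathbb{Q}_p^n)$ is the set of $q(\cdot)\in\mathscr{P}(\mathbb{Q}_p^n)$ for which there is a constant $C>0$ such that (i) $\gamma\,(q_-(B_\gamma(x))-q_+(B_\gamma(x)))\le C$ for all $\gamma\in\mathbb{Z}$, $x\in\mathbb{Q}_p^n$, and (ii) $|q(x)-q(y)|\le\frac{C}{\log_p(p+\min\{|x|_p,|y|_p\})}$ for all $x,y\in\mathbb{Q}_p^n$. *)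

(* Defs.v *)
From HB Require Import structures.
From mathcomp Require Import all_boot all_order all_algebra.
From mathcomp Require Import all_classical all_reals all_analysis.
From mathcomp Require Import measurable_realfun ess_sup_inf ring_quotient ring lra zify.

Set Implicit Arguments.
Unset Strict Implicit.
Unset Printing Implicit Defensive.

Import Order.TTheory GRing.Theory Num.Theory.
Import numFieldNormedType.Exports.

Local Open Scope classical_set_scope.
Local Open Scope ring_scope.

Definition padic_val (p : nat) (x : rat) : int :=
  (logn p `|numq x|)%:Z - (logn p `|denq x|)%:Z.

(* For p not prime, logn p is constantly 0 and this is the trivial absolute
   value, so the construction below gives a field for every p; the statement
   assumes p prime. *)
Definition padic_abs (p : nat) (x : rat) : rat :=
  if x == 0 then 0 else p%:R ^ (- padic_val p x).

Section PadicAbs.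
Context (p : nat).
Local Notation abs := (padic_abs p).

Lemma padic_val_frac (a b : int) : a != 0 -> b != 0 ->
  padic_val p (a%:~R / b%:~R) = (logn p `|a|)%:Z - (logn p `|b|)%:Z.
Proof.
move=> a0 b0; set x : rat := a%:~R / b%:~R.
have x0 : x != 0 by rewrite mulf_neq0 ?invr_eq0 ?intr_eq0.
have /eqP : numq x * b = a * denq x.
  apply: (@intr_inj rat); rewrite !rmorphM /=.
  have -> : (numq x)%:~R = x * (denq x)%:~R by rewrite numqE.
  by rewrite mulrAC divfK// intr_eq0.
move=> /eqP /(congr1 (fun z => logn p `|z|%N)).
rewrite !abszM !lognM ?absz_gt0 ?numq_eq0 ?denq_neq0// => h.
rewrite /padic_val; lia.
Qed.

Lemma padic_abs0 : abs 0 = 0. Proof. by rewrite /padic_abs eqxx. Qed.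

Lemma padic_abs1 : abs 1 = 1.
Proof. by rewrite /padic_abs oner_eq0 /padic_val /= logn1 subrr oppr0 expr0z. Qed.

Lemma padic_absN x : abs (- x) = abs x.
Proof. by rewrite /padic_abs oppr_eq0 /padic_val numqN denqN abszN. Qed.

Lemma padic_val_nprime x : ~~ prime p -> padic_val p x = 0.
Proof. by move=> np; rewrite /padic_val /logn (negbTE np). Qed.

Lemma padic_abs_gt0 x : x != 0 -> 0 < abs x.
Proof.
move=> x0; rewrite /padic_abs (negbTE x0).
have [pp|np] := boolP (prime p); last by rewrite padic_val_nprime// oppr0 expr0z.
by rewrite exprz_gt0// ltr0n prime_gt0.
Qed.

Lemma padic_abs_ge0 x : 0 <= abs x.
Proof. by have [->|/padic_abs_gt0/ltW//] := eqVneq x 0; rewrite padic_abs0. Qed.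

Lemma padic_absM x y : abs (x * y) = abs x * abs y.
Proof.
have [->|x0] := eqVneq x 0; first by rewrite mul0r padic_abs0 mul0r.
have [->|y0] := eqVneq y 0; first by rewrite mulr0 padic_abs0 mulr0.
rewrite /padic_abs (negbTE x0) (negbTE y0) mulf_eq0 (negbTE x0) (negbTE y0) /=.
have [pp|np] := boolP (prime p); last first.
  by rewrite !padic_val_nprime// oppr0 !expr0z mulr1.
rewrite -expfzDr ?pnatr_eq0 -?lt0n ?prime_gt0//; congr (_ ^ _).
have xyE : x * y = (numq x * numq y)%:~R / (denq x * denq y)%:~R.
  by rewrite !rmorphM /= -mulf_div !divq_num_den.
rewrite {1}xyE padic_val_frac ?mulf_neq0 ?numq_eq0 ?denq_neq0//.
rewrite !abszM !lognM ?absz_gt0 ?numq_eq0 ?denq_neq0// /padic_val; lia.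
Qed.

Lemma padic_absV x : abs x^-1 = (abs x)^-1.
Proof.
have [->|x0] := eqVneq x 0; first by rewrite padic_abs0 !GRing.invr0 padic_abs0.
apply: (mulfI (lt0r_neq0 (padic_abs_gt0 x0))).
by rewrite -padic_absM divff// padic_abs1 divff// lt0r_neq0// padic_abs_gt0.
Qed.

Lemma padic_abs_int_le1 (a : int) : abs a%:~R <= 1.
Proof.
have [->|a0] := eqVneq a 0; first by rewrite padic_abs0 ler01.
rewrite /padic_abs intr_eq0 (negbTE a0).
have [pp|np] := boolP (prime p); last first.
  by rewrite padic_val_nprime// oppr0 expr0z.
rewrite -[a%:~R]divr1 -[1](rmorph1 (intr : int -> rat)) padic_val_frac//.
by rewrite logn1 subr0 -invr_expz invf_le1 ?exprn_ege1 ?exprn_gt0 ?ler1n ?ltr0n ?prime_gt0.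
Qed.

Lemma padic_absD1 z : abs z <= 1 -> abs (z + 1) <= 1.
Proof.
have [->|z0] := eqVneq z 0; first by rewrite add0r padic_abs1.
have [->|z1] := eqVneq (z + 1) 0; first by rewrite padic_abs0.
rewrite /padic_abs (negbTE z0) (negbTE z1).
have [pp|np] := boolP (prime p); last by rewrite !padic_val_nprime// oppr0 expr0z.
have p1 : (1 < p%:R :> rat) by rewrite ltr1n prime_gt1.
have expz_le1 (m : int) : (p%:R ^ m <= 1 :> rat) = (m <= 0).
  by rewrite -(expr0z (p%:R : rat)) ler_eXz2l.
rewrite !expz_le1 !oppr_le0 => vz.
have d0 : logn p `|denq z| = 0%N.
  apply/eqP; rewrite -leqn0 leqNgt; apply/negP => ld.
  have ln : (0 < logn p `|numq z|)%N by move: vz; rewrite /padic_val; lia.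
  have := coprime_num_den z; rewrite /coprime => /eqP g1.
  have : (p %| gcdn `|numq z| `|denq z|)%N.
    by move: ln ld; rewrite !logn_gt0 dvdn_gcd !mem_primes => /and3P[_ _ ->] /and3P[_ _ ->].
  by rewrite g1 dvdn1 => /eqP p_1; rewrite p_1 in pp.
have zE : z + 1 = (numq z + denq z)%:~R / (denq z)%:~R.
  by rewrite rmorphD /= mulrDl divff ?intr_eq0 ?denq_neq0// divq_num_den.
rewrite zE padic_val_frac ?denq_neq0// ?d0 ?subr0//.
by apply: contraNneq z1 => nd0; rewrite zE nd0 mul0r.
Qed.

Lemma padic_absD x y : abs (x + y) <= Num.max (abs x) (abs y).
Proof.
wlog xy : x y / abs x <= abs y.
  by move=> H; case: (leP (abs x) (abs y)) => [xy|/ltW yx];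
    [have := H _ _ xy|have := H _ _ yx; rewrite addrC]; rewrite max_r.
rewrite max_r//.
have [y0|y0] := eqVneq y 0; first by rewrite y0 addr0 -y0.
have -> : x + y = y * (x / y + 1) by rewrite mulrDr mulr1 mulrCA divff// mulr1.
rewrite padic_absM ler_piMr ?padic_abs_ge0// padic_absD1//.
by rewrite padic_absM padic_absV ler_pdivrMr ?mul1r// padic_abs_gt0.
Qed.

Lemma padic_absB_lt x y e : abs x < e -> abs y < e -> abs (x - y) < e.
Proof.
move=> xe ye; apply: le_lt_trans (padic_absD _ _) _.
by rewrite gt_max xe padic_absN.
Qed.

Lemma padic_absD_lt x y e : abs x < e -> abs y < e -> abs (x + y) < e.
Proof. by move=> xe ye; rewrite -[y]opprK padic_absB_lt// padic_absN. Qed.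

End PadicAbs.

Definition padic_cauchy (p : nat) : {pred nat -> rat} :=
  fun u => `[< forall e : rat, 0 < e ->
    exists N, forall i j, (N <= i)%N -> (N <= j)%N ->
      padic_abs p (u i - u j) < e >].

Section PadicCauchy.
Context (p : nat).
Local Notation abs := (padic_abs p).

Lemma padic_cauchy_bounded u : u \in padic_cauchy p ->
  exists2 M : rat, 0 < M & exists N, forall i, (N <= i)%N -> abs (u i) < M.
Proof.
move=> /asboolP /(_ 1 ltr01) [N uN]; exists (abs (u N) + 1).
  by rewrite ltr_wpDl ?padic_abs_ge0.
exists N => i Ni; rewrite -[u i](subrK (u N)) padic_absD_lt//.
  by apply: lt_le_trans (uN _ _ Ni (leqnn _)) _; rewrite lerDr padic_abs_ge0.
by rewrite ltrDl.
Qed.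

Lemma padic_cauchy_subring_closed : subring_closed (padic_cauchy p).
Proof.
split=> [|u v /asboolP uC /asboolP vC|u v uC vC]; apply/asboolP => e e0.
- by exists 0%N => i j _ _; rewrite /= subrr padic_abs0.
- have [[N uN] [M vM]] := (uC _ e0, vC _ e0).
  exists (maxn N M) => i j; rewrite !geq_max => /andP[Ni Mi] /andP[Nj Mj].
  have -> : (u - v) i - (u - v) j = (u i - u j) - (v i - v j).
    by rewrite /= !fctE; ring.
  by rewrite padic_absB_lt ?uN ?vM.
have [A A0 [N1 uA]] := padic_cauchy_bounded uC.
have [B B0 [N2 vB]] := padic_cauchy_bounded vC.
move/asboolP : uC => /(_ _ (divr_gt0 e0 B0)) [N3 uN].
move/asboolP : vC => /(_ _ (divr_gt0 e0 A0)) [N4 vN].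
exists (maxn (maxn N1 N2) (maxn N3 N4)) => i j.
rewrite !geq_max => /andP[/andP[i1 i2] /andP[i3 i4]] /andP[/andP[j1 j2] /andP[j3 j4]].
have -> : (u * v) i - (u * v) j = u i * (v i - v j) + (u i - u j) * v j.
  by rewrite /= !fctE; ring.
rewrite padic_absD_lt// padic_absM.
  by rewrite -(divfK (lt0r_neq0 A0) e) mulrC ltr_pM ?padic_abs_ge0 ?uA ?vN.
by rewrite -(divfK (lt0r_neq0 B0) e) ltr_pM ?padic_abs_ge0 ?vB ?uN.
Qed.

HB.instance Definition _ := GRing.isSubringClosed.Build (nat -> rat)
  (padic_cauchy p) padic_cauchy_subring_closed.

End PadicCauchy.

Record padic_seq (p : nat) := PadicSeq {
  padic_seq_fun :> nat -> rat ;
  padic_seqP : padic_seq_fun \in padic_cauchy p }.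

HB.instance Definition _ p := [isSub for @padic_seq_fun p].
HB.instance Definition _ p := [Choice of padic_seq p by <:].
HB.instance Definition _ p :=
  [SubChoice_isSubComNzRing of padic_seq p by <:].

Definition padic_null (p : nat) : {pred padic_seq p} :=
  fun u => `[< forall e : rat, 0 < e ->
    exists N, forall i, (N <= i)%N -> padic_abs p (u i) < e >].
Arguments padic_null : clear implicits.

Section PadicField.
Context (p : nat).
Local Notation abs := (padic_abs p).

Lemma padic_null_idealr_closed : idealr_closed (padic_null p).
Proof.
split=> [||a u v uN vN].
- by apply/asboolP => e e0; exists 0%N => i _; rewrite /= padic_abs0.
- apply/negP => /asboolP /(_ 1 ltr01) [N /(_ N (leqnn _))].
  by rewrite /= padic_abs1 ltxx.
apply/asboolP => e e0.
have [A A0 [N1 aA]] := padic_cauchy_bounded (padic_seqP a).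
move/asboolP : uN => /(_ _ (divr_gt0 e0 A0)) [N2 uN].
move/asboolP : vN => /(_ _ e0) [N3 vN].
exists (maxn N1 (maxn N2 N3)) => i; rewrite !geq_max => /and3P[i1 i2 i3].
rewrite (_ : (a * u + v) i = a i * u i + v i)// padic_absD_lt ?vN//.
by rewrite padic_absM -(divfK (lt0r_neq0 A0) e) mulrC ltr_pM ?padic_abs_ge0 ?aA ?uN.
Qed.

HB.instance Definition _ := isIdealr.Build (padic_seq p) (padic_null p)
  padic_null_idealr_closed.

Lemma padic_null_inv (u : padic_seq p) : u \notin padic_null p ->
  exists v : padic_seq p, v * u - 1 \in padic_null p.
Proof.
move=> /asboolPn /existsNP [e /not_implyP[e0 /forallNP uN]].
have [N uC] := asboolP _ (padic_seqP u) e e0.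
have {uN} [M NM uM] : exists2 M, (N <= M)%N & e <= abs (u M).
  have /existsNP [M /not_implyP[NM /negP]] := uN N.
  by rewrite -leNgt => uM; exists M.
have ue i : (N <= i)%N -> e <= abs (u i).
  move=> Ni; rewrite leNgt; apply/negP => ui.
  have := padic_absD_lt (uC _ _ NM Ni) ui.
  by rewrite subrK ltNge uM.
have u0 i : (N <= i)%N -> u i != 0.
  move=> /ue; apply: contraTneq => ->; by rewrite padic_abs0 -ltNge.
have vC : (fun i => (u i)^-1) \in padic_cauchy p.
  apply/asboolP => d d0.
  have [K uK] := asboolP _ (padic_seqP u) (d * (e * e)) (mulr_gt0 d0 (mulr_gt0 e0 e0)).
  exists (maxn N K) => i j; rewrite !geq_max => /andP[Ni Ki] /andP[Nj Kj].
  have -> : (u i)^-1 - (u j)^-1 = (u j - u i) / (u i * u j).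
    by field; rewrite !u0.
  rewrite padic_absM padic_absV ltr_pdivrMr ?padic_abs_gt0 ?mulf_neq0 ?u0//.
  apply: (lt_le_trans (uK _ _ Kj Ki)).
  by rewrite padic_absM ler_pM2l// ler_pM ?ue// ltW.
exists (PadicSeq vC); apply/asboolP => d d0; exists N => i Ni.
rewrite (_ : (_ - 1 : padic_seq p) i = (u i)^-1 * u i - 1)//.
by rewrite mulVf ?u0// subrr padic_abs0.
Qed.

End PadicField.

(* The completion of the rationals for |.|_p: Cauchy sequences modulo null
   sequences. *)
Definition Qp (p : nat) : Type := {ideal_quot padic_null p}.

HB.instance Definition _ p := GRing.ComNzRing.on (Qp p).

Section QpField.
Context (p : nat).
Local Open Scope quotient_scope.

Definition Qp_inv (x : Qp p) : Qp p := xget 0 [set y | y * x = 1].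

Lemma Qp_mulVf (x : Qp p) : x != 0 -> Qp_inv x * x = 1.
Proof.
move=> x0; apply: (@xgetPex _ 0 [set y : Qp p | y * x = 1]).
have : repr x \notin padic_null p.
  apply: contra x0; rewrite -[X in X \in _]subr0 Quotient.idealrBE reprK.
  by move=> /eqP ->; rewrite rmorph0.
move=> /padic_null_inv[v]; rewrite Quotient.idealrBE => /eqP vx1.
exists (\pi_{ideal_quot padic_null p} v) => /=.
have : \pi_{ideal_quot padic_null p} v *
       \pi_{ideal_quot padic_null p} (repr x) = 1.
  by rewrite -rmorphM /= vx1 rmorph1.
by rewrite reprK.
Qed.

Lemma Qp_inv0 : Qp_inv 0 = 0.
Proof.
apply: xgetPN => y /=; rewrite mulr0 => /eqP.
by rewrite eq_sym oner_eq0.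
Qed.

HB.instance Definition _ := GRing.ComNzRing_isField.Build (Qp p) Qp_mulVf Qp_inv0.

End QpField.

HB.instance Definition _ p := isPointed.Build (Qp p) 0.

(* |x|_p, the limit of |u_k|_p along any Cauchy sequence u of rationals
   representing x; the limit exists because | |u_i| - |u_j| | <= |u_i - u_j|. *)
Definition Qp_abs (R : realType) (p : nat) (x : Qp p) : R :=
  lim ((ratr (padic_abs p ((repr x : padic_seq p) k)) : R) @[k --> \oo]).

Definition Qpn_norm (R : realType) (p n : nat) (x : 'rV[Qp p]_n) : R :=
  \big[Num.max/0]_(j < n) Qp_abs R (x 0 j).

Definition Qpn_ball (R : realType) (p n : nat) (g : int) (a : 'rV[Qp p]_n) :
    set 'rV[Qp p]_n :=
  [set x | Qpn_norm R (x - a) <= p%:R ^ g].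
Arguments Qpn_ball R {p n} g a.

Definition Qpn_open (R : realType) (p n : nat) : set (set 'rV[Qp p]_n) :=
  [set U | forall x, U x -> exists g, Qpn_ball R g x `<=` U].

(* Q_p^n with its Borel sigma-algebra. *)
Definition Qpn (R : realType) (p n : nat) : measurableType _ :=
  g_sigma_algebraType (@Qpn_open R p n).

(* mu is the Haar measure of Q_p^n normalized by |B_0(0)|_h = 1; these
   conditions determine mu on the Borel sets. *)
Definition is_haar (R : realType) (p n : nat)
    (mu : {measure set (Qpn R p n) -> \bar R}) : Prop :=
  (forall (a : 'rV[Qp p]_n) (A : set (Qpn R p n)), measurable A ->
     mu [set (x : 'rV[Qp p]_n) + a | x in A] = mu A) /\
  mu (Qpn_ball R 0 0) = 1%E.

Section Spaces.
Context {R : realType} {p n : nat}.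
Variable mu : {measure set (Qpn R p n) -> \bar R}.
Local Notation V := 'rV[Qp p]_n.
Local Notation B := (@Qpn_ball R p n).

(* Measurability with respect to the Haar-completion of the Borel
   sigma-algebra. For such a nonnegative f, the library integral (a supremum
   over Borel simple functions below f) is the integral for the completed
   measure. *)
Definition haar_measurable d (U : measurableType d) (f : V -> U) : Prop :=
  exists2 g : Qpn R p n -> U, measurable_fun [set: Qpn R p n] g &
    {ae mu, forall x, f x = g x}.

(* Every compact subset of Q_p^n lies in a ball, and balls are compact. *)
Definition loc_integrable (b : V -> R) : Prop :=
  haar_measurable b /\
  forall (g : int) (a : V), (\int[mu]_(y in B g a) `|b y|%:E < +oo)%E.

Definition ball_avg (b : V -> R) (g : int) (x : V) : R :=
  (fine (mu (B g x)))^-1 * \int[mu]_(y in B g x) b y.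

Definition max_commutator (b f : V -> R) (x : V) : \bar R :=
  ereal_sup (range (fun g : int =>
    (mu (B g x))^-1 *
      \int[mu]_(y in B g x) (`|b x - b y| * `|f y|)%:E))%E.

Definition lip_norm (beta : R) (f : V -> R) : \bar R :=
  ereal_sup [set r | exists x y : V, x != y /\
    r = (`|f x - f y| / Qpn_norm R (x - y) `^ beta)%:E].

Definition lip_space (beta : R) (f : V -> R) : Prop :=
  haar_measurable f /\ (lip_norm beta f < +oo)%E.

(* The library's ess_sup and ess_inf, relative to a set. *)
Definition ess_sup_on (A : set V) (q : V -> R) : \bar R :=
  ereal_inf [set y | {ae mu, forall x, A x -> ((q x)%:E <= y)%E}].

Definition ess_inf_on (A : set V) (q : V -> R) : \bar R :=
  ereal_sup [set y | {ae mu, forall x, A x -> (y <= (q x)%:E)%E}].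

Definition exponent (q : V -> R) : Prop :=
  [/\ haar_measurable q,
      (1 < ess_inf mu (EFin \o q))%E,
      forall x, 1 < q x /\
        (ess_inf mu (EFin \o q) <= (q x)%:E <= ess_sup mu (EFin \o q))%E
    & (ess_sup mu (EFin \o q) < +oo)%E].

Definition log_exponent (q : V -> R) : Prop :=
  exponent q /\ exists C : R,
    [/\ 0 < C,
        forall (g : int) (x : V),
          ((g%:~R)%:E * (ess_inf_on (B g x) q - ess_sup_on (B g x) q)
             <= C%:E)%E
      & forall x y : V, `|q x - q y| <=
          C / (ln (p%:R + Num.min (Qpn_norm R x) (Qpn_norm R y)) / ln p%:R)].

(* The spaces L^q(.) are set up for extended real functions, so that they
   apply to the maximal commutator, which may be +oo on a null set. *)
Definition modular (q : V -> R) (f : V -> \bar R) (eta : R) : \bar R :=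
  (\int[mu]_x ((`|f x| * (eta^-1)%:E) `^ q x))%E.

Definition var_Lebesgue (q : V -> R) (f : V -> \bar R) : Prop :=
  haar_measurable f /\
  exists2 eta : R, 0 < eta & (modular q f eta < +oo)%E.

Definition var_norm (q : V -> R) (f : V -> \bar R) : \bar R :=
  ereal_inf [set eta%:E | eta in
    [set eta : R | 0 < eta /\ (modular q f eta <= 1)%E]].

Definition bounded_operator (T : (V -> R) -> V -> \bar R) (r q : V -> R) :
    Prop :=
  exists C : R, forall f : V -> R, var_Lebesgue r (EFin \o f) ->
    var_Lebesgue q (T f) /\
    (var_norm q (T f) <= C%:E * var_norm r (EFin \o f))%E.

Definition admissible (beta : R) (r q : V -> R) : Prop :=
  [/\ log_exponent r, log_exponent q, exponent r,
      (ess_sup mu (EFin \o r) < (n%:R / beta)%:E)%E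
    & forall x, (q x)^-1 = (r x)^-1 - beta / n%:R].

Definition osc_sup (beta : R) (b q : V -> R) : \bar R :=
  ereal_sup (range (fun gx : int * V =>
    let A := B gx.1 gx.2 in
    (mu A `^ (beta / n%:R))^-1 *
    (var_norm q (fun y => ((b y - ball_avg b gx.1 gx.2) * \1_A y)%:E) /
     var_norm q (fun y => (\1_A y)%:E))))%E.

End Spaces.

(* Main.v *)
Require Import Defs.
From mathcomp Require Import all_boot all_order all_algebra.
From mathcomp Require Import all_classical all_reals all_analysis.
From mathcomp Require Import measurable_realfun ess_sup_inf ring_quotient ring lra zify.

(** Write alpha = beta / n, so that the ball B_k(x) has measure v with
    v^alpha = p^(k beta), and let M_alpha f be the fractional maximal function,
    the supremum over k of v^alpha times the average of f over B_k(x). The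
    exponents of an admissible pair satisfy q = r / (1 - alpha r), and M_alpha
    is bounded from L^r(.) to L^q(.); this is the analytic core, and the rest
    is a comparison of averages.

    A beta-Lipschitz symbol b with constant L varies by at most L p^(k beta) on
    B_k(x). Hence the commutator is at most L M_alpha f (commutator_le), which
    gives its boundedness (lipschitz_bounded), and b differs from its average
    on the ball by at most L p^(k beta), which bounds the oscillations
    (lipschitz_deviation). Conversely, the commutator of the indicator of a
    ball B dominates |b - b_B| on B, and the norms of this indicator satisfy
    |chi_B|_r <= 2 |B|^alpha |chi_B|_q by Young's inequality, so that a bounded
    commutator has bounded oscillations (bounded_osc). Finally, bounded
    oscillations make b Lipschitz (osc_lipschitz): the maximal theorem with
    alpha = 0 turns an L^q(.) oscillation into a mean oscillation of size
    A p^(k beta) (mean_oscillation), and Campanato's argument applies. The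
    averages of b over the balls around x converge at a geometric rate, the
    limit is Lipschitz because two points at distance p^k have the same ball of
    radius p^k, and it equals b almost everywhere. The passage between
    statements for some pair and for all pairs only needs one pair to exist:
    constant exponents between 1 and n / beta form one, since beta < 1 <= n.

    For the maximal theorem, the balls of radius p^k partition the space, so
    the averages at decreasing radii form a martingale and Doob's inequality
    bounds the maximal function on L^s for a constant s > 1 (maximal_bound).
    For a variable exponent r, let the modular of f be at most 1 and split f
    where it crosses the value 1 (fractional_maximal_modular).
    - Where f >= 1, lowering the exponent lowers the power. Averages over balls
      of measure at least 1 are at most 1, and the constant exponent inf r
      suffices (large_ball_bound). On a small ball r is constant up to O(1/|k|),
      which changes powers of the measure by a bounded factor, so Jensen's
      inequality applies with an exponent that is below r on the ball
      (small_ball_bound).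
    - Where f < 1, r may be replaced by its limit at infinity, with an error
      that is a power of 1/|x|. The error is integrable because it is dominated
      by the square of the maximal function of the unit ball (decay_powR,
      decay_weight, decaying_part).
    Hedberg's inequality (hedberg_powR) reduces M_alpha to ordinary averages in
    all cases.

    The symbol and the exponents are Borel functions only up to null sets.
    Integrals of nonnegative functions are monotone along almost everywhere
    inequalities without any measurability (ge0_le_integral_ae), so the
    estimates are made on Borel representatives and carried back. *)

Set Implicit Arguments.
Unset Strict Implicit.
Unset Printing Implicit Defensive.

Import Order.TTheory GRing.Theory Num.Theory.
Import numFieldNormedType.Exports.

Local Open Scope classical_set_scope.
Local Open Scope ring_scope.

(** * The absolute value on the p-adic numbers *)

Section QpAbs.
Context (R : realType) (p : nat).
Local Notation abs := (padic_abs p).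
Local Notation Rabs c := (ratr (abs c) : R).
Local Open Scope quotient_scope.

Lemma padic_abs_isosceles x y : abs (x - y) < abs x -> abs y = abs x.
Proof.
move=> xy; apply/eqP; rewrite eq_le; apply/andP; split.
  rewrite -[y](subKr x); apply: le_trans (padic_absD _ _ _) _.
  by rewrite padic_absN ge_max lexx (ltW xy).
rewrite leNgt; apply/negP => yx.
have := padic_absD_lt xy yx.
by rewrite subrK ltxx.
Qed.

Lemma padic_null_cvg (u : padic_seq p) : u \in padic_null p ->
  (Rabs (u k)) @[k --> \oo] --> (0 : R).
Proof.
move=> /asboolP uN; apply/cvgrPdist_le => e e0.
have [c] := rat_in_itvoo e0; rewrite in_itv/= ltr0q => /andP[c0' ce].
have [N Nu] := uN _ c0'; exists N => // k /= Nk.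
rewrite sub0r normrN ger0_norm ?ler0q ?padic_abs_ge0//.
by rewrite (le_trans _ (ltW ce))// ler_rat ltW// Nu.
Qed.

(** The ultrametric inequality freezes absolute values: along a Cauchy sequence
    which is not null they are eventually constant, and a null perturbation
    does not change the constant. So Qp_abs takes its values among those of
    padic_abs. *)
Lemma padic_nonnull_abs (u v : padic_seq p) : u \notin padic_null p ->
  u - v \in padic_null p -> exists2 c : rat, c != 0 &
  exists N, forall k, (N <= k)%N -> abs (u k) = abs c /\ abs (v k) = abs c.
Proof.
move=> /asboolPn /existsNP [e /not_implyP[e0 /forallNP uN]] /asboolP uv.
have [N uC] := asboolP _ (padic_seqP u) e e0.
have [M vM] := uv e e0.
have /existsNP [K /not_implyP[NK /negP]] := uN N.
rewrite -leNgt => uK; exists (u K).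
  by apply: contraTneq uK => ->; rewrite padic_abs0 -ltNge.
exists (maxn N M) => k; rewrite geq_max => /andP[Nk Mk].
have uk : abs (u k) = abs (u K).
  by apply: padic_abs_isosceles; apply: lt_le_trans uK; exact: uC.
split=> //; rewrite -uk; apply: padic_abs_isosceles.
by rewrite uk; apply: lt_le_trans uK; exact: vM.
Qed.

(** Qp_abs is defined with a chosen representative; here any Cauchy sequence in
    the class computes it. *)
Lemma Qp_abs_cvg (u : padic_seq p) :
  (Rabs (u k)) @[k --> \oo] --> Qp_abs R (\pi_{ideal_quot padic_null p} u).
Proof.
set x := \pi _.
have xu : repr x - u \in padic_null p.
  by rewrite Quotient.idealrBE reprK.
have [xN|xN] := boolP ((repr x : padic_seq p) \in padic_null p).
  have uN : u \in padic_null p by rewrite -[u](subKr (repr x)) rpredB.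
  by rewrite /Qp_abs (cvg_lim _ (padic_null_cvg xN))//; exact: padic_null_cvg.
have [c c0 [N cN]] := padic_nonnull_abs xN xu.
have xc : (Rabs ((repr x : padic_seq p) k)) @[k --> \oo] --> (Rabs c : R).
  by apply: cvg_near_cst; exists N => // k /= /cN[->].
rewrite /Qp_abs (cvg_lim _ xc)//.
by apply: cvg_near_cst; exists N => // k /= /cN[_ ->].
Qed.

Lemma Qp_abs_le (u : padic_seq p) (e : R) N :
  (forall k, (N <= k)%N -> Rabs (u k) <= e) ->
  Qp_abs R (\pi_{ideal_quot padic_null p} u) <= e.
Proof.
move=> H; rewrite -(cvg_lim _ (@Qp_abs_cvg u))//.
apply: limr_le; first by apply/cvg_ex; eexists; exact: Qp_abs_cvg.
by exists N.
Qed.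

Lemma Qp_abs_ge0 (x : Qp p) : 0 <= Qp_abs R x.
Proof.
rewrite -[x]reprK -(cvg_lim _ (@Qp_abs_cvg (repr x)))//.
apply: limr_ge; first by apply/cvg_ex; eexists; exact: Qp_abs_cvg.
by apply: nearW => k; rewrite ler0q padic_abs_ge0.
Qed.

Lemma Qp_absN (x : Qp p) : Qp_abs R (- x) = Qp_abs R x.
Proof.
rewrite -[x]reprK; set u := repr x.
have -> : - \pi_{ideal_quot padic_null p} u = \pi_{ideal_quot padic_null p} (- u).
  by rewrite rmorphN.
have E : (fun k => Rabs ((- u : padic_seq p) k)) = (fun k => Rabs (u k)).
  by apply/funext => k; rewrite (_ : (- u : padic_seq p) k = - u k)// padic_absN.
have := @Qp_abs_cvg (- u); rewrite E => h.
exact: (cvg_unique (@norm_hausdorff _ _) h (@Qp_abs_cvg u)).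
Qed.

Lemma Qp_absD (x y : Qp p) :
  Qp_abs R (x + y) <= Num.max (Qp_abs R x) (Qp_abs R y).
Proof.
apply/ler_addgt0Pr => e e0.
rewrite -[x]reprK -[y]reprK; set u := repr x; set v := repr y.
have -> : \pi_{ideal_quot padic_null p} u + \pi_{ideal_quot padic_null p} v =
  \pi_{ideal_quot padic_null p} (u + v) by rewrite rmorphD.
set E := Num.max _ _.
have [N _ Nu] : \forall k \near \oo, Rabs (u k) <= E + e.
  apply: (cvgr_le _ (@Qp_abs_cvg u)).
  by rewrite (le_lt_trans (_ : _ <= E)) ?ltrDl// /E le_max lexx.
have [M _ Mv] : \forall k \near \oo, Rabs (v k) <= E + e.
  apply: (cvgr_le _ (@Qp_abs_cvg v)).
  by rewrite (le_lt_trans (_ : _ <= E)) ?ltrDl// /E le_max lexx orbT.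
apply: (@Qp_abs_le _ _ (maxn N M)) => k; rewrite geq_max => /andP[Nk Mk].
rewrite (_ : (u + v : padic_seq p) k = u k + v k)//.
have := padic_absD p (u k) (v k); rewrite le_max => /orP[] h.
  by rewrite (le_trans _ (Nu k Nk))// ler_rat.
by rewrite (le_trans _ (Mv k Mk))// ler_rat.
Qed.

Lemma padic_cst_cauchy (c : rat) : (fun=> c) \in padic_cauchy p.
Proof.
by apply/asboolP => e e0; exists 0%N => i j _ _; rewrite subrr padic_abs0.
Qed.

Definition Qp_of_rat (c : rat) : Qp p :=
  \pi_{ideal_quot padic_null p} (PadicSeq (padic_cst_cauchy c)).

Lemma Qp_of_ratB c d : Qp_of_rat c - Qp_of_rat d = Qp_of_rat (c - d).
Proof. by rewrite /Qp_of_rat -rmorphB; congr (\pi _); exact: val_inj. Qed.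

Lemma Qp_of_rat0 : Qp_of_rat 0 = 0.
Proof. by rewrite -[0 in LHS](subrr 0) -Qp_of_ratB subrr. Qed.

Lemma Qp_abs_rat c : Qp_abs R (Qp_of_rat c) = Rabs c.
Proof.
apply: (cvg_unique (@norm_hausdorff _ _) (@Qp_abs_cvg _)) => //=.
exact: cvg_cst.
Qed.

Lemma Qp_abs0 : Qp_abs R (0 : Qp p) = 0.
Proof. by rewrite -Qp_of_rat0 Qp_abs_rat padic_abs0 rmorph0. Qed.

Lemma Qp_abs_eq0 (x : Qp p) : Qp_abs R x = 0 -> x = 0.
Proof.
rewrite -[x]reprK; set u : padic_seq p := repr x => u0.
have [uN|uN] := boolP (u \in padic_null p).
  have : u - 0 \in padic_null p by rewrite subr0.
  by rewrite Quotient.idealrBE => /eqP ->; rewrite rmorph0.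
have uu : u - u \in padic_null p by rewrite subrr rpred0.
have [c c0 [N cN]] := padic_nonnull_abs uN uu.
have : Qp_abs R (\pi_{ideal_quot padic_null p} u) = Rabs c.
  apply: (cvg_unique (@norm_hausdorff _ _) (@Qp_abs_cvg _)) => //=.
  by apply: cvg_near_cst; exists N => // k /= /cN[->].
move/eqP; rewrite u0 eq_sym fmorph_eq0 => /eqP ac0.
by have := padic_abs_gt0 p c0; rewrite ac0 ltxx.
Qed.

Lemma Qp_dense (x : Qp p) (e : R) : 0 < e ->
  exists c : rat, Qp_abs R (x - Qp_of_rat c) <= e.
Proof.
move=> e0; have [c] := rat_in_itvoo e0; rewrite in_itv/= ltr0q => /andP[c0 ce].
have [N uC] := asboolP _ (padic_seqP (repr x)) c c0.
exists ((repr x : padic_seq p) N).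
rewrite -{1}[x]reprK /Qp_of_rat -rmorphB.
apply: (@Qp_abs_le _ _ N) => k Nk.
by rewrite (le_trans _ (ltW ce))// ler_rat ltW// uC.
Qed.

End QpAbs.
Section PadicDigits.
Context (p : nat) (p_prime : prime p).
Local Notation abs := (padic_abs p).

Let p1 : 1 < p%:R :> rat. Proof. by rewrite ltr1n prime_gt1. Qed.
Let p0 : 0 < p%:R :> rat. Proof. by rewrite ltr0n prime_gt0. Qed.

Lemma padic_abs_p : abs p%:R = (p%:R)^-1.
Proof.
have pz : p%:Z != 0 by rewrite eqz_nat -lt0n prime_gt0.
rewrite pmulrn /padic_abs intr_eq0 (negbTE pz) -[p%:~R]divr1.
rewrite -[X in _ / X](rmorph1 (intr : int -> rat)) padic_val_frac// logn1 subr0.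
by rewrite divr1 /= -[X in logn p X]expn1 pfactorK.
Qed.

Lemma padic_abs_pX (k : int) : abs (p%:R ^ k) = p%:R ^ (- k).
Proof.
have H m : abs (p%:R ^+ m) = p%:R ^- m.
  elim: m => [|m IH]; first by rewrite expr0 padic_abs1 invr1.
  by rewrite exprS padic_absM IH padic_abs_p invfM.
case: k => k; first by rewrite -exprnP H exprnN.
by rewrite NegzE -exprnN padic_absV H invrK opprK.
Qed.

Lemma padic_abs_dvd (a : int) : (p %| a)%Z -> abs a%:~R <= p%:R^-1.
Proof.
move=> /dvdzP[c ->]; rewrite rmorphM/= padic_absM -pmulrn padic_abs_p.
by apply: ler_piMl; [rewrite invr_ge0 ltW|exact: padic_abs_int_le1].
Qed.

Lemma padic_abs_ndvd (a : int) : ~~ (p %| a)%Z -> abs a%:~R = 1.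
Proof.
move=> pa; have a0 : a != 0 by apply: contraNneq pa => ->.
rewrite /padic_abs intr_eq0 (negbTE a0).
rewrite -[a%:~R]divr1 -[1](rmorph1 (intr : int -> rat)) padic_val_frac//.
rewrite logn1 subr0 (_ : logn p `|a| = 0%N) ?expr0z//.
by apply/eqP; rewrite -leqn0 leqNgt logn_gt0 mem_primes p_prime absz_gt0 a0 /=.
Qed.

(** If |c| <= 1 then p does not divide the denominator of c, and a Bezout
    relation u p + v denq c = 1 makes v numq c an integer congruent to c
    modulo p. *)
Lemma padic_int_approx (c : rat) : abs c <= 1 ->
  exists d : 'I_p, abs (c - (d : nat)%:R) <= p%:R^-1.
Proof.
move=> c1.
have pd : coprimez p (denq c).
  rewrite coprimezE/= prime_coprime//; apply/negP => pd.
  have pn : ~~ (p %| numq c)%Z.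
    apply/negP => pn; have := coprime_num_den c; rewrite /coprime => /eqP g1.
    have : (p %| gcdn `|numq c| `|denq c|)%N by rewrite dvdn_gcd pd andbT.
    by rewrite g1 dvdn1 => /eqP p_1; move: (p_prime); rewrite p_1.
  move: c1; rewrite -[c]divq_num_den padic_absM padic_abs_ndvd// mul1r.
  rewrite padic_absV invf_le1 ?padic_abs_gt0 ?intr_eq0 ?denq_neq0//.
  apply/negP; rewrite -ltNge (le_lt_trans (padic_abs_dvd _))//.
  by rewrite invf_lt1.
have /coprimezP[[u v] /= uv] := pd.
pose m := (v * numq c)%R.
have mE : abs (c - m%:~R) <= p%:R^-1.
  have -> : c - m%:~R = c * (u%:~R * p%:R).
    have : (u * p + v * denq c)%:~R = 1 :> rat by rewrite uv.
    rewrite rmorphD !rmorphM/= => uv1.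
    have up : u%:~R * p%:R = 1 - v%:~R * (denq c)%:~R :> rat.
      by apply/esym/eqP; rewrite subr_eq pmulrn; apply/eqP/esym.
    by rewrite /m numqE up; ring.
  rewrite !padic_absM padic_abs_p mulrA.
  apply: ler_piMl; first by rewrite invr_ge0 ltW.
  by rewrite mulr_ile1 ?padic_abs_ge0 ?padic_abs_int_le1.
have mp0 : 0 <= (m %% p)%Z by rewrite modz_ge0// eqz_nat -lt0n prime_gt0.
have mp : (`|(m %% p)%Z| < p)%N.
  by rewrite -ltz_nat gez0_abs// ltz_mod// eqz_nat -lt0n prime_gt0.
exists (Ordinal mp) => /=.
rewrite -[c](subrK m%:~R) -addrA.
apply: le_trans (padic_absD _ _ _) _; rewrite ge_max mE/=.
have -> : m%:~R - `|(m %% p)%Z|%N%:R = (m - (m %% p)%Z)%:~R :> rat.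
  by rewrite rmorphB/= -[in RHS](gez0_abs mp0) -pmulrn.
apply: padic_abs_dvd; apply/dvdzP; exists (m %/ p)%Z.
by rewrite {1}(divz_eq m p) addrK.
Qed.

(** The leading digit of c at level k: rescaling by a power of p reduces to the
    residue modulo p of a p-adic integer. *)
Lemma padic_digit (c : rat) (k : int) : abs c <= p%:R ^ (k + 1) ->
  exists d : 'I_p, abs (c - (d : nat)%:R * p%:R ^ (- (k + 1))) <= p%:R ^ k.
Proof.
move=> ck; have pk0 : 0 < p%:R ^ (k + 1) :> rat by rewrite exprz_gt0.
have : abs (c * p%:R ^ (k + 1)) <= 1.
  by rewrite padic_absM padic_abs_pX -invr_expz ler_pdivrMr// mul1r.
move=> /padic_int_approx[d Hd]; exists d.
have -> : c - (d : nat)%:R * p%:R ^ (- (k + 1)) =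
    (c * p%:R ^ (k + 1) - (d : nat)%:R) * p%:R ^ (- (k + 1)).
  by rewrite mulrBl -mulrA -invr_expz divff ?mulr1// gt_eqF.
rewrite padic_absM padic_abs_pX opprK.
have -> : p%:R ^ k = p%:R^-1 * p%:R ^ (k + 1) :> rat.
  by rewrite expfzDr ?gt_eqF// expr1z mulrCA mulVf ?mulr1// gt_eqF.
by rewrite ler_pM2r.
Qed.

Lemma padic_digit_uniq (d d' : 'I_p) (k : int) :
  abs ((d : nat)%:R * p%:R ^ (- (k + 1)) - (d' : nat)%:R * p%:R ^ (- (k + 1)))
    <= p%:R ^ k -> d = d'.
Proof.
apply: contraPeq => dd'; apply/negP; rewrite -ltNge -mulrBl padic_absM padic_abs_pX.
have -> : (d : nat)%:R - (d' : nat)%:R = ((d : nat)%:Z - (d' : nat)%:Z)%:~R :> rat.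
  by rewrite rmorphB/=.
rewrite padic_abs_ndvd; last first.
  have mz (e : 'I_p) : ((e : nat)%:Z %% p)%Z = (e : nat)%:Z.
    by rewrite modz_small//= ltz_nat ltn_ord.
  apply/negP; rewrite -eqz_mod_dvd => /eqP; rewrite !mz => -[] /val_inj /eqP.
  exact/negP.
by rewrite mul1r opprK ltr_eXz2l//; lia.
Qed.

Lemma padic_digit_le (d : 'I_p) (k : int) :
  abs ((d : nat)%:R * p%:R ^ (- (k + 1))) <= p%:R ^ (k + 1).
Proof.
rewrite padic_absM padic_abs_pX opprK; apply: ler_piMl; first exact/exprz_ge0/ltW.
by rewrite pmulrn; exact: padic_abs_int_le1.
Qed.

End PadicDigits.

(** * Balls and their Haar measure *)

Section Balls.
Context (R : realType) (p n : nat) (p_prime : prime p).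
Local Notation V := 'rV[Qp p]_n.
Local Notation norm := (@Qpn_norm R p n).
Local Notation B := (@Qpn_ball R p n).
Implicit Types (x y z a : V) (g h : int).

Lemma p_gt1 : 1 < p%:R :> R. Proof. by rewrite ltr1n prime_gt1. Qed.
Lemma p_gt0 : 0 < p%:R :> R. Proof. by rewrite ltr0n prime_gt0. Qed.
Lemma pX_gt0 g : 0 < p%:R ^ g :> R. Proof. by rewrite exprz_gt0// p_gt0. Qed.
Lemma pX_ge0 g : 0 <= p%:R ^ g :> R. Proof. exact/ltW/pX_gt0. Qed.
Lemma ler_pX g h : (p%:R ^ g <= p%:R ^ h :> R) = (g <= h).
Proof. by rewrite ler_eXz2l// p_gt1. Qed.

Lemma Qpn_normP x (e : R) : 0 <= e ->
  reflect (forall j, Qp_abs R (x 0 j) <= e) (norm x <= e).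
Proof.
move=> e0; apply: (iffP idP) => [xe j|xe].
  apply: le_trans xe; rewrite /Qpn_norm.
  exact: (@le_bigmax_cond _ _ _ _ _ xpredT (fun j => Qp_abs R (x 0 j))).
by apply: bigmax_le.
Qed.

Lemma Qpn_norm_ge0 x : 0 <= norm x.
Proof. exact: bigmax_ge_id. Qed.

Lemma Qpn_norm0 : norm 0 = 0.
Proof.
apply/eqP; rewrite eq_le Qpn_norm_ge0 andbT; apply/Qpn_normP => // j.
by rewrite mxE Qp_abs0.
Qed.

Lemma Qpn_norm_eq0 x : norm x = 0 -> x = 0.
Proof.
move=> x0; have /Qpn_normP xj : norm x <= 0 by rewrite x0.
apply/rowP => j; rewrite mxE; apply: (@Qp_abs_eq0 R); apply/eqP.
by rewrite eq_le Qp_abs_ge0 xj.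
Qed.

Lemma Qpn_normN x : norm (- x) = norm x.
Proof. by apply: eq_bigr => j _; rewrite mxE Qp_absN. Qed.

Lemma Qpn_normB x y : norm (x - y) = norm (y - x).
Proof. by rewrite -Qpn_normN opprB. Qed.

Lemma Qpn_normD x y : norm (x + y) <= Num.max (norm x) (norm y).
Proof.
apply/Qpn_normP => [|j]; first by rewrite le_max Qpn_norm_ge0.
rewrite mxE; apply: le_trans (Qp_absD _ _ _) _.
have coord z : Qp_abs R (z 0 j) <= norm z.
  by apply/Qpn_normP => //; exact: Qpn_norm_ge0.
by rewrite ge_max !le_max !coord orbT.
Qed.

Lemma Qpn_normD_le x y (e : R) : norm x <= e -> norm y <= e -> norm (x + y) <= e.
Proof.
by move=> xe ye; apply: le_trans (Qpn_normD _ _) _; rewrite ge_max xe.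
Qed.

Lemma Qpn_norm_ultra x y z (e : R) :
  norm (x - y) <= e -> norm (y - z) <= e -> norm (x - z) <= e.
Proof.
move=> xy yz; have -> : x - z = (x - y) + (y - z) by rewrite addrA subrK.
exact: Qpn_normD_le.
Qed.

Lemma QballE g a x : B g a x = (norm (x - a) <= p%:R ^ g) :> Prop.
Proof. by []. Qed.

Lemma Qball_sym g a x : B g a x -> B g x a.
Proof. by rewrite /Qpn_ball/= Qpn_normB. Qed.

Lemma Qball_trans g a x y : B g a x -> B g x y -> B g a y.
Proof.
by move=> ax xy; exact: Qpn_norm_ultra xy ax.
Qed.

Lemma Qball_eq g a x : B g a x -> B g x = B g a.
Proof.
move=> ax; apply/seteqP; split => y; first exact: Qball_trans.
by apply: Qball_trans; exact: Qball_sym.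
Qed.

Lemma Qball_le g h a : g <= h -> B g a `<=` B h a.
Proof.
by move=> gh x; rewrite /Qpn_ball/= => /le_trans; apply; rewrite ler_pX.
Qed.

Lemma Qball_translate g a : B g a = [set x + a | x in B g 0].
Proof.
apply/seteqP; split=> [x ax|_ [x x0 <-]].
  by exists (x - a); [rewrite /Qpn_ball/= subr0|rewrite subrK].
by move: x0; rewrite /Qpn_ball/= subr0 addrK.
Qed.

Lemma pX_archi (e : R) : exists k : nat, e <= p%:R ^ (k%:Z).
Proof.
exists (Num.bound e); have [e0|e0] := leP 0 e; last first.
  by rewrite ltW// (lt_trans e0)// pX_gt0.
rewrite ltW// (lt_le_trans (archi_boundP e0))//.
by rewrite -exprnP -natrX ler_nat ltnW// ltn_expl// prime_gt1.
Qed.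

Lemma Qball_cover x y : exists k : nat, B k%:Z x y.
Proof. by have [k] := pX_archi (norm (y - x)); exists k. Qed.

(** Every nonzero vector lies in a ball and outside the next smaller concentric
    one. The radius is found as the first one in an increasing enumeration
    that starts below the norm. *)
Lemma Qpn_norm_bracket x : x != 0 ->
  exists g : int, p%:R ^ (g - 1) < norm x <= p%:R ^ g.
Proof.
move=> x0; have nx : 0 < norm x.
  rewrite lt_neqAle Qpn_norm_ge0 andbT eq_sym.
  by apply: contra_neq x0; exact: Qpn_norm_eq0.
have [l xl] := pX_archi (norm x)^-1.
have [k xk] := pX_archi (norm x).
have xl1 : p%:R ^ (- l%:Z) <= norm x.
  rewrite -invr_expz -[leRHS]invrK lef_pV2// ?posrE ?pX_gt0//.
  by rewrite invr_gt0.
have Pex : exists m : nat, norm x <= p%:R ^ (m%:Z - l%:Z).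
  by exists (k + l)%N; rewrite PoszD addrK.
case: (ex_minnP Pex) => -[|m] mP mmin.
  exists (- l%:Z); rewrite sub0r in mP; rewrite mP andbT.
  by rewrite (lt_le_trans _ xl1)// ltr_eXz2l ?p_gt1//; lia.
exists (m.+1%:Z - l%:Z); rewrite mP andbT ltNge; apply/negP => xm.
have := mmin m; rewrite (_ : m%:Z - l%:Z = m.+1%:Z - l%:Z - 1); last lia.
by move=> /(_ xm); rewrite ltnn.
Qed.

Definition rat_vec (c : 'rV[rat]_n) : V := \row_j Qp_of_rat p (c 0 j).

Lemma rat_vec_dense g x : exists c : 'rV[rat]_n, B g x (rat_vec c).
Proof.
have H j := Qp_dense (x 0 j) (pX_gt0 g).
exists (\row_j projT1 (cid (H j))); apply/Qpn_normP; first exact: pX_ge0.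
by move=> j; rewrite !mxE -Qp_absN opprB; case: cid.
Qed.

Definition digit_vec g (d : 'rV['I_p]_n) : V :=
  rat_vec (\row_j ((d 0 j : nat)%:R * p%:R ^ (- (g + 1)))).

(** A ball of radius p^(g+1) is cut into p^n balls of radius p^g, one for each
    vector of leading digits. Points are first approximated by rational
    vectors, whose digits are computed in the rational numbers. *)
Lemma Qball_digits g : B (g + 1) 0 = \bigcup_d B g (digit_vec g d).
Proof.
have pr m : p%:R ^ m = ratr (p%:R ^ m) :> R by rewrite fmorphXz rmorph_nat.
apply/seteqP; split=> [x|x [d _]]; rewrite /Qpn_ball/=.
  rewrite subr0 => xg.
  have [c xc] := rat_vec_dense g x.
  have cg j : padic_abs p (c 0 j) <= p%:R ^ (g + 1).
    rewrite -(ler_rat R) -pr -Qp_abs_rat.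
    suff /Qpn_normP : norm (rat_vec c) <= p%:R ^ (g + 1).
      by move=> /(_ (pX_ge0 _) j); rewrite mxE.
    have -> : rat_vec c = (rat_vec c - x) + x by rewrite subrK.
    apply: Qpn_normD_le xg.
    by apply: (le_trans xc); rewrite ler_pX; lia.
  have H j := padic_digit p_prime (cg j).
  exists (\row_j projT1 (cid (H j))); first by [].
  apply: (Qpn_norm_ultra (Qball_sym xc)).
  apply/Qpn_normP; first exact: pX_ge0.
  move=> j; rewrite !mxE Qp_of_ratB Qp_abs_rat pr ler_rat.
  by case: cid.
move=> xd; apply: (@Qpn_norm_ultra _ (digit_vec g d)).
  by apply: (le_trans xd); rewrite ler_pX; lia.
rewrite subr0.
apply/Qpn_normP; first exact: pX_ge0.
by move=> j; rewrite !mxE Qp_abs_rat pr ler_rat padic_digit_le.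
Qed.

Lemma digit_vec_disj g d d' x :
  B g (digit_vec g d) x -> B g (digit_vec g d') x -> d = d'.
Proof.
move=> dx /Qball_sym/(Qball_trans dx)/Qball_sym.
move=> /Qpn_normP - /(_ (pX_ge0 _)) H; apply/rowP => j.
apply: (@padic_digit_uniq _ p_prime _ _ g).
rewrite -(ler_rat R) fmorphXz rmorph_nat -Qp_abs_rat.
by have := H j; rewrite !mxE Qp_of_ratB.
Qed.

Lemma measurable_Qball g a : measurable (B g a : set (Qpn R p n)).
Proof.
apply: sub_sigma_algebra => x ax; exists g.
by rewrite (Qball_eq ax).
Qed.

End Balls.

Section HaarBalls.
Context (R : realType) (p n : nat) (p_prime : prime p).
Variable mu : {measure set (Qpn R p n) -> \bar R}.
Hypothesis mu_haar : is_haar mu.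
Local Notation B := (@Qpn_ball R p n).

Lemma haar_ball_translate g a : mu (B g a) = mu (B g 0).
Proof.
rewrite Qball_translate; apply: mu_haar.1.
exact: measurable_Qball.
Qed.

Lemma haar_ball_succ g : (mu (B (g + 1) 0) = ((p%:R ^+ n)%:E * mu (B g 0)))%E.
Proof.
rewrite Qball_digits// (@measure_fin_bigcup _ _ _ mu _ [set: 'rV['I_p]_n]).
- have setTE : [set: 'rV['I_p]_n] = [set` enum {: 'rV['I_p]_n}].
    by apply/seteqP; split=> d //= _; rewrite mem_enum.
  rewrite (eq_fsbigr (fun=> mu (B g 0))); last by move=> d _; exact: haar_ball_translate.
  rewrite setTE -fsbig_seq ?enum_uniq//.
  have -> : \sum_(d <- enum {: 'rV['I_p]_n}) mu (B g 0) =
      (mu (B g 0) *+ size (enum {: 'rV['I_p]_n}))%E.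
    by elim: (enum _) => [|d s IH]; rewrite ?big_nil// big_cons IH muleS.
  by rewrite -cardE card_mx card_ord mul1n -mule_natl natrX.
- exact: finite_finset.
- move=> d d' _ _ [x [dx d'x]]; exact: (digit_vec_disj p_prime dx d'x).
- by move=> d _; exact: measurable_Qball.
Qed.

(** The normalization gives the unit ball, and cutting a ball into p^n
    translates of the next smaller one gives all radii, in both directions. *)
Lemma haar_ball g a : mu (B g a) = ((p%:R ^ g) ^+ n)%:E.
Proof.
rewrite haar_ball_translate.
have pn0 : p%:R ^+ n != 0 :> R by rewrite expf_neq0// gt_eqF// p_gt0.
have p0 : p%:R != 0 :> R by rewrite gt_eqF// p_gt0.
case: g => [m|m].
  elim: m => [|m IH]; first by rewrite mu_haar.2 expr0z expr1n.
  rewrite (_ : Posz m.+1 = m%:Z + 1); last by lia.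
  by rewrite haar_ball_succ IH -EFinM -exprMn expfzDr// expr1z mulrC.
rewrite NegzE; elim: m.+1 => {m}[|m IH]; first by rewrite oppr0 mu_haar.2 expr0z expr1n.
have := haar_ball_succ (- m.+1%:Z); rewrite (_ : - m.+1%:Z + 1 = - m%:Z); last by lia.
rewrite IH => E.
have : ((p%:R ^+ n)^-1%:E * ((p%:R ^ (- m%:Z)) ^+ n)%:E =
        (p%:R ^+ n)^-1%:E * ((p%:R ^+ n)%:E * mu (B (- m.+1%:Z) 0)))%E.
  by rewrite -E.
rewrite muleA -!EFinM mulVf// mul1e => <-.
by rewrite -exprVn -exprMn -!exprnN -invfM -exprS.
Qed.

Lemma haar_ball_gt0 g a : (0 < mu (B g a))%E.
Proof. by rewrite haar_ball lte_fin exprn_gt0// pX_gt0. Qed.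

End HaarBalls.

(** * Integrals of nonnegative functions *)

Section IntegralMonotone.
Local Open Scope ereal_scope.
Context d (T : measurableType d) (R : realType).
Variable mu : {measure set T -> \bar R}.
Import HBNNSimple.

(** The integral of any nonnegative function is a supremum over simple functions
    below it. Setting such a simple function to 0 on a measurable null set
    leaves its integral unchanged and brings it below g. *)
Lemma ge0_le_integral_ae (D : set T) (f g : T -> \bar R) :
  (forall x, D x -> 0 <= f x) -> (forall x, D x -> 0 <= g x) ->
  {ae mu, forall x, D x -> f x <= g x} ->
  \int[mu]_(x in D) f x <= \int[mu]_(x in D) g x.
Proof.
move=> f0 g0 [N [mN N0 Nfg]]; rewrite !ge0_integralE//.
apply: ge_ereal_sup => _ [h /= hf] <-.
apply: le_ereal_sup_tmp; exists (sintegral mu (proj_nnsfun h (measurableC mN))).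
  exists (proj_nnsfun h (measurableC mN)) => //= x.
  rewrite /= mindicE; have [xN|xN] := boolP (x \in ~` N); last first.
    rewrite mulr0; rewrite /patch; case: ifPn => // /set_mem; exact: g0.
  rewrite mulr1; apply: le_trans (hf x) _.
  rewrite /patch; case: ifPn => // /set_mem Dx.
  apply: contrapT => /negP fg; apply: (set_mem xN); apply: Nfg => /= /(_ Dx).
  exact/negP.
rewrite -!integralT_nnsfun le_eqVlt; apply/orP; left; apply/eqP.
apply: ge0_ae_eq_integral => //.
- exact/measurable_EFinP.
- exact/measurable_EFinP.
- by move=> x _; rewrite lee_fin.
- by move=> x _; rewrite lee_fin.
exists N; split => // x /= /not_implyP[_ hx]; apply: contrapT => xN; apply: hx.
by rewrite /= mindicE mem_set// mulr1.
Qed.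

Lemma ge0_eq_integral_ae (D : set T) (f g : T -> \bar R) :
  (forall x, D x -> 0 <= f x) -> (forall x, D x -> 0 <= g x) ->
  {ae mu, forall x, D x -> f x = g x} ->
  \int[mu]_(x in D) f x = \int[mu]_(x in D) g x.
Proof.
move=> f0 g0 fg; apply/eqP; rewrite eq_le !ge0_le_integral_ae//.
  by apply: filterS fg => x + Dx => ->.
by apply: filterS fg => x + Dx => ->.
Qed.

Lemma ge0_le_integral_all (D : set T) (f g : T -> \bar R) :
  (forall x, D x -> 0 <= f x) -> (forall x, D x -> f x <= g x) ->
  \int[mu]_(x in D) f x <= \int[mu]_(x in D) g x.
Proof.
move=> f0 fg; apply: ge0_le_integral_ae => //.
  by move=> x Dx; apply: le_trans (fg x Dx); exact: f0.
exact: aeW.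
Qed.

End IntegralMonotone.

Section IntegralScale.
Local Open Scope ereal_scope.
Context d (T : measurableType d) (R : realType).
Variable mu : {measure set T -> \bar R}.
Import HBNNSimple.

(** The integral of any nonnegative function is a supremum over simple functions
    below it, and these can be rescaled. *)
Lemma ge0_integralZl_le (c : R) (f : T -> \bar R) : (0 < c)%R ->
  (forall x, 0 <= f x) -> \int[mu]_x (c%:E * f x) <= c%:E * \int[mu]_x f x.
Proof.
move=> c0 f0; rewrite ge0_integralTE; last first.
  by move=> x; rewrite mule_ge0// lee_fin ltW.
apply: ge_ereal_sup => _ [h /= hf] <-.
have ci0 : (0 <= c^-1)%R by rewrite invr_ge0 ltW.
have hE : sintegral mu h = c%:E * sintegral mu (scale_nnsfun h ci0).
  rewrite -sintegralrM; apply: eq_sintegral => x /=.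
  by rewrite mulrA divff ?mul1r// gt_eqF.
rewrite hE; apply: lee_wpmul2l; first by rewrite lee_fin ltW.
rewrite ge0_integralTE//; apply: ereal_sup_ubound.
exists (scale_nnsfun h ci0) => //= x.
by rewrite EFinM lee_pdivrMl//; exact: hf.
Qed.

End IntegralScale.

Section AlmostEverywhere.
Context d (T : measurableType d) (R : realType).
Variable mu : {measure set T -> \bar R}.
Implicit Types P Q S : T -> Prop.

Lemma ae_imp P Q : {ae mu, forall x, P x} -> (forall x, P x -> Q x) ->
  {ae mu, forall x, Q x}.
Proof. by move=> aeP PQ; apply: filterS aeP. Qed.

Lemma ae_imp2 P Q S : {ae mu, forall x, P x} -> {ae mu, forall x, Q x} ->
  (forall x, P x -> Q x -> S x) -> {ae mu, forall x, S x}.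
Proof. by move=> aeP aeQ PQS; apply: filterS2 aeP aeQ. Qed.

Lemma ae_countable (I : countType) (P : I -> T -> Prop) :
  (forall i, {ae mu, forall x, P i x}) -> {ae mu, forall x, forall i, P i x}.
Proof.
move=> aeP.
pose N i := if unpickle i is Some j then [set x | ~ P j x] else set0.
have : mu.-negligible (\bigcup_i N i).
  apply: negligible_bigcup => i; rewrite /N.
  case: unpickle => [j|]; [exact: aeP|exact: negligible_set0].
apply: negligibleS => x /= /existsNP[j Pj].
by exists (pickle j) => //; rewrite /N pickleK.
Qed.

End AlmostEverywhere.

Section IntegralReal.
Context d (T : measurableType d) (R : realType).
Variable mu : {measure set T -> \bar R}.
Implicit Types f g h : T -> R.

Lemma ge0_integralD_real f g : (forall x, 0 <= f x) -> (forall x, 0 <= g x) ->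
  measurable_fun [set: T] f -> measurable_fun [set: T] g ->
  (\int[mu]_x (f x + g x)%:E = \int[mu]_x (f x)%:E + \int[mu]_x (g x)%:E)%E.
Proof.
move=> f0 g0 mf mg; under eq_integral do rewrite EFinD.
rewrite ge0_integralD//.
- by move=> x _; rewrite lee_fin.
- exact/measurable_EFinP.
- by move=> x _; rewrite lee_fin.
- exact/measurable_EFinP.
Qed.

Lemma ge0_integralZl_real (c : R) f : 0 <= c -> (forall x, 0 <= f x) ->
  measurable_fun [set: T] f ->
  (\int[mu]_x (c * f x)%:E = c%:E * \int[mu]_x (f x)%:E)%E.
Proof.
move=> c0 f0 mf; under eq_integral do rewrite EFinM.
rewrite ge0_integralZl_EFin//; first by move=> x _; rewrite lee_fin.
exact/measurable_EFinP.
Qed.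

Lemma le_integral_real f g : (forall x, 0 <= f x) -> (forall x, f x <= g x) ->
  (\int[mu]_x (f x)%:E <= \int[mu]_x (g x)%:E)%E.
Proof.
by move=> f0 fg; apply: ge0_le_integral_all => x _; rewrite lee_fin.
Qed.

Lemma le_integral_add (f1 f2 g1 g2 : T -> R) :
  [/\ forall x, 0 <= f1 x, forall x, 0 <= f2 x, forall x, 0 <= g1 x &
      forall x, 0 <= g2 x] ->
  [/\ measurable_fun [set: T] f1, measurable_fun [set: T] f2,
      measurable_fun [set: T] g1 & measurable_fun [set: T] g2] ->
  (forall x, f1 x + f2 x <= g1 x + g2 x) ->
  (\int[mu]_x (f1 x)%:E + \int[mu]_x (f2 x)%:E <=
   \int[mu]_x (g1 x)%:E + \int[mu]_x (g2 x)%:E)%E.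
Proof.
move=> [f10 f20 g10 g20] [mf1 mf2 mg1 mg2] fg.
rewrite -!ge0_integralD_real//; apply: le_integral_real => // x.
exact: addr_ge0.
Qed.

End IntegralReal.

(** * Inequalities for real powers *)

Section PowerInequalities.
Context {R : realType}.
Implicit Types (u v s a b : R).

Lemma powR_succ u s : 0 <= u -> 1 < s -> u `^ s = u * u `^ (s - 1).
Proof. by move=> u0 s1; rewrite mulr_powRB1//; lra. Qed.

(** Young's inequality with exponents s and s / (s - 1), cleared of
    denominators. *)
Lemma young_powR u v s : 0 <= u -> 0 <= v -> 1 < s ->
  s * (v * u `^ (s - 1)) <= v `^ s + (s - 1) * u `^ s.
Proof.
move=> u0 v0 s1; have s0 : 0 < s by lra.
have s10 : s - 1 != 0 by lra.
have q0 : 0 < s / (s - 1) by rewrite divr_gt0//; lra.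
have E : s^-1 + (s / (s - 1))^-1 = 1 by field; rewrite s10 gt_eqF.
have := conjugate_powR v0 (powR_ge0 u (s - 1)) s0 q0 E.
rewrite invf_div -powRrM [(s - 1) * _]mulrC divfK// => H.
have -> : v `^ s + (s - 1) * u `^ s = s * (v `^ s / s + u `^ s * ((s - 1) / s)).
  by field; rewrite gt_eqF.
by rewrite ler_pM2l.
Qed.

(** Used to absorb a power of u into the left-hand side of an estimate: either u
    is at most 2 c v, and the product is controlled by v, or c v is at most
    u / 2. *)
Lemma absorb_powR c u v s : 0 <= c -> 0 <= u -> 0 <= v -> 1 < s ->
  c * v * u `^ (s - 1) <= (2 * c) `^ s * v `^ s + 2^-1 * u `^ s.
Proof.
move=> c0 u0 v0 s1.
have [uv|uv] := leP u (2 * c * v); last first.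
  rewrite -[leLHS]add0r lerD ?mulr_ge0 ?powR_ge0//.
  rewrite (powR_succ u0 s1) mulrA ler_wpM2r ?powR_ge0//.
  lra.
rewrite -[leLHS]addr0 lerD ?mulr_ge0 ?powR_ge0// -powRM//; last by lra.
have cv0 : 0 <= 2 * c * v by rewrite !mulr_ge0.
rewrite (powR_succ cv0 s1) ler_pM ?mulr_ge0 ?powR_ge0//.
  by rewrite -mulrA; apply: ler_peMl; [rewrite mulr_ge0|lra].
by apply: ge0_ler_powR => //; rewrite ?nnegrE//; lra.
Qed.

Lemma powR_le1 a s : 0 <= a <= 1 -> 0 <= s -> a `^ s <= 1.
Proof.
move=> /andP[a0 a1] s0; rewrite (_ : 1 = 1 `^ s); last by rewrite powR1.
by apply: ge0_ler_powR => //; rewrite nnegrE.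
Qed.

Lemma powR_ge1 a s : 1 <= a -> 0 <= s -> 1 <= a `^ s.
Proof.
move=> a1 s0; rewrite (_ : 1 = 1 `^ s); last by rewrite powR1.
by apply: ge0_ler_powR => //; rewrite nnegrE//; lra.
Qed.

Lemma powR_mono a b s : 0 <= a -> a <= b -> 0 <= s -> a `^ s <= b `^ s.
Proof. by move=> a0 ab s0; apply: ge0_ler_powR => //; rewrite nnegrE//; lra. Qed.

Lemma powR_addl a b s : 0 <= a -> 0 <= b -> 0 <= s ->
  (a + b) `^ s <= 2 `^ s * (a `^ s + b `^ s).
Proof.
move=> a0 b0 s0.
have H u v : 0 <= u -> u <= v -> (u + v) `^ s <= 2 `^ s * (u `^ s + v `^ s).
  move=> u0 uv; have v0 : 0 <= v by lra.
  apply: (@le_trans _ _ ((2 * v) `^ s)).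
    by apply: powR_mono => //; [rewrite addr_ge0|lra].
  by rewrite powRM// ler_wpM2l ?powR_ge0// lerDr powR_ge0.
have [ab|/ltW ba] := leP a b; first exact: H.
by rewrite addrC [a `^ s + _]addrC; exact: H.
Qed.

Lemma powR_anti a s t : 0 <= a <= 1 -> 0 < s -> s <= t -> a `^ t <= a `^ s.
Proof.
move=> /andP[a0 a1] s0 st; have [->|an0] := eqVneq a 0.
  by rewrite !powR0//; lra.
by apply: ger_powR => //; rewrite lt_neqAle eq_sym an0 a0.
Qed.

End PowerInequalities.

Section ExponentInequalities.
Context {R : realType}.
Implicit Types (a v s t alpha I : R).

(** Hedberg's inequality. Here v and a are the measure of a ball and an average
    over it. With t = s / (1 - alpha s), v^alpha a raised to t splits as (v
    a^s)^(alpha t) a^s, because t = s alpha t + s. *)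
Lemma hedberg_powR a v s alpha I : 0 < v -> 0 <= a -> 0 < s -> 0 <= alpha ->
  alpha * s < 1 -> v * a `^ s <= I ->
  (v `^ alpha * a) `^ (s / (1 - alpha * s)) <=
  I `^ (alpha * (s / (1 - alpha * s))) * a `^ s.
Proof.
move=> v0 a0 s0 al0 als vaI.
set t := s / (1 - alpha * s); have d0 : 0 < 1 - alpha * s by lra.
have t0 : 0 < t by rewrite divr_gt0.
have tE : t = s * (alpha * t) + s by rewrite /t; field; lra.
have alt0 : 0 <= alpha * t by rewrite mulr_ge0// ltW.
rewrite powRM ?powR_ge0// -powRrM {2}tE powRD; last first.
  have st0 : 0 <= s * (alpha * t) by rewrite mulr_ge0// ltW.
  by rewrite gt_eqF//; lra.
rewrite mulrA ler_wpM2r ?powR_ge0// [a `^ (s * _)]powRrM -powRM ?powR_ge0 ?(ltW v0)//.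
by apply: powR_mono => //; rewrite mulr_ge0 ?powR_ge0// ltW.
Qed.

(** The exponents s and t are close to each other relative to ln L. If g is
    below L^(-m), then so is g^t; otherwise g^(t - s) is at most L^(m |s -
    t|), which is bounded. In the application L is p + |x|. *)
Lemma decay_powR (g s t m L D : R) : 0 <= g <= 1 -> 0 < s -> 1 <= t -> 0 <= m ->
  1 <= L -> `|s - t| * ln L <= D ->
  g `^ t <= expR (m * D) * g `^ s + L `^ (- m).
Proof.
move=> /andP[g0 g1] s0 t1 m0 L1 H.
have L0 : 0 < L by lra.
have Lm0 : 0 < L `^ (- m) by rewrite powR_gt0.
have [gL|gL] := leP (L `^ (- m)) g; last first.
  rewrite -[leLHS]add0r lerD ?mulr_ge0 ?expR_ge0 ?powR_ge0//.
  apply: le_trans (ltW gL); have [->|gn0] := eqVneq g 0; first by rewrite powR0//; lra.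
  by apply: ge1r_powR => //; rewrite lt_neqAle eq_sym gn0 g0.
have gp : 0 < g by lra.
rewrite -[leLHS]addr0 lerD ?(ltW Lm0)//.
have -> : t = (t - s) + s by ring.
rewrite powRD; last by rewrite (gt_eqF gp) implybT.
rewrite ler_wpM2r ?powR_ge0// /powR (gt_eqF gp) ler_expR.
have lng : - (m * ln L) <= ln g.
  by rewrite -mulNr -ln_powR ler_ln// posrE.
have lng0 : ln g <= 0 by rewrite ln_le0.
apply: (@le_trans _ _ (m * (`|s - t| * ln L))); last by rewrite ler_wpM2l.
apply: (@le_trans _ _ (`|s - t| * - ln g)).
  apply: (@le_trans _ _ `|(t - s) * ln g|); first exact: ler_norm.
  by rewrite normrM distrC (ler0_norm lng0).
by rewrite mulrCA ler_wpM2l// lerNl.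
Qed.

Lemma sobolev_exponent_mono alpha s t : 0 <= alpha -> 0 < s -> s <= t -> alpha * t < 1 ->
  s / (1 - alpha * s) <= t / (1 - alpha * t).
Proof.
move=> al0 s0 st alt.
have als : alpha * s <= alpha * t by rewrite ler_wpM2l.
rewrite ler_pdivrMr; last by lra.
rewrite mulrAC ler_pdivlMr; last by lra.
lra.
Qed.

Lemma sobolev_exponent_dist alpha s t u : 0 <= alpha -> s <= u -> t <= u ->
  alpha * u < 1 ->
  `|s / (1 - alpha * s) - t / (1 - alpha * t)| <= `|s - t| / (1 - alpha * u) ^+ 2.
Proof.
move=> al0 su tu alu.
have als : alpha * s <= alpha * u by rewrite ler_wpM2l.
have alt : alpha * t <= alpha * u by rewrite ler_wpM2l.
have d0 : 0 < 1 - alpha * u by lra.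
have -> : s / (1 - alpha * s) - t / (1 - alpha * t) =
  (s - t) / ((1 - alpha * s) * (1 - alpha * t)) by field; lra.
rewrite normrM normfV ler_wpM2l// lef_pV2.
- rewrite ger0_norm; last by rewrite mulr_ge0//; lra.
  by rewrite expr2 ler_pM//; lra.
- by rewrite posrE normr_gt0 mulf_neq0//; lra.
- by rewrite posrE exprn_gt0.
Qed.

End ExponentInequalities.

Section MeasurablePowers.
Context d (T : measurableType d) (R : realType).

Lemma measurable_fun_powR (f : T -> R) (s : R) : measurable_fun [set: T] f ->
  measurable_fun [set: T] (fun x => f x `^ s).
Proof. exact: (measurableT_comp (@measurable_powR R s)). Qed.

Lemma measurable_fun_powR2 (f r : T -> R) : (forall x, r x != 0) ->
  measurable_fun [set: T] f -> measurable_fun [set: T] r ->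
  measurable_fun [set: T] (fun x => f x `^ r x).
Proof.
move=> r0 mf mr.
rewrite (_ : (fun _ => _) =
    (fun x => if f x == 0 then 0 else expR (r x * ln (f x)))); last first.
  by apply/funext => x; rewrite /powR; case: eqVneq => //; rewrite (negbTE (r0 x)).
apply: measurable_fun_ifT => //.
  by apply: measurable_fun_eqr.
apply: measurableT_comp; first exact: measurable_expR.
by apply: measurable_funM => //; apply: measurableT_comp mf; exact: measurable_ln.
Qed.

End MeasurablePowers.

#[local] Opaque Qpn_ball Qpn_norm Qp_abs.

(** * Averages over balls *)

Section Averages.
Context (R : realType) (p n : nat) (p_prime : prime p).
Variable mu : {measure set (Qpn R p n) -> \bar R}.
Hypothesis mu_haar : is_haar mu.
Local Notation V := 'rV[Qp p]_n.
Local Notation B := (@Qpn_ball R p n).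
Local Notation T := (Qpn R p n).
Implicit Types (f g h : V -> R) (k : int) (x y : V) (a b s : R).

Definition vol k : R := (p%:R ^ k) ^+ n.

Lemma vol_gt0 k : 0 < vol k. Proof. by rewrite exprn_gt0// pX_gt0. Qed.

Lemma vol_ge0 k : 0 <= vol k. Proof. exact/ltW/vol_gt0. Qed.

Lemma vol_pred k : vol k = p%:R ^+ n * vol (k - 1).
Proof.
have -> : vol k = vol (1 + (k - 1)) by rewrite addrC subrK.
by rewrite /vol expfzDr ?(gt_eqF (p_gt0 R p_prime))// expr1z exprMn.
Qed.

Lemma mu_ball k x : mu (B k x) = (vol k)%:E. Proof. exact: haar_ball. Qed.

Definition ball_fun k (U : Type) (h : V -> U) := forall x y, B k x y -> h y = h x.

Lemma ball_fun_le k l (U : Type) (h : V -> U) : l <= k -> ball_fun k h -> ball_fun l h.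
Proof. by move=> lk hk x y /(Qball_le p_prime lk); exact: hk. Qed.

Lemma ball_fun_measurable k d (U : measurableType d) (h : V -> U) :
  ball_fun k h -> measurable_fun [set: T] (h : T -> U).
Proof.
move=> hk _ Y mY; rewrite setTI; apply: sub_sigma_algebra => x hx.
by exists k => y /hk hyx; rewrite /preimage/= hyx.
Qed.

(** Rational vectors are dense, so the balls of radius p^k around these points
    cover the space for every k. *)
Definition rat_center (i : nat) : V := rat_vec p (odflt 0 (unpickle i)).

Lemma rat_center_cover k : \bigcup_i B k (rat_center i) = setT.
Proof.
apply/seteqP; split => // x _; have [c xc] := rat_vec_dense R p_prime k x.
exists (pickle c); first by [].
by rewrite /rat_center pickleK/=; exact: Qball_sym.
Qed.

(** The enumeration of balls repeats each ball many times; removing repetitions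
    turns it into a countable partition into balls and empty sets. *)
Definition cell k (i : nat) : set T := seqDU (fun i => B k (rat_center i)) i.

Lemma measurable_cell k i : measurable (cell k i).
Proof.
apply: measurableD; first exact: measurable_Qball.
by apply: bigsetU_measurable => j _; exact: measurable_Qball.
Qed.

Lemma cell_cover k : \bigcup_i cell k i = setT.
Proof. by rewrite -seqDU_bigcup_eq rat_center_cover. Qed.

Lemma cell_triv k : trivIset setT (cell k).
Proof. exact: trivIset_seqDU. Qed.

Lemma cellP k i : cell k i = set0 \/ cell k i = B k (rat_center i).
Proof.
have [->|/set0P[x [ix xi]]] := eqVneq (cell k i) set0; [by left|right].
apply/seteqP; split=> y; first by case.
move=> iy; split; first exact: iy.
move=> h; apply: xi; move: h => /=.
rewrite -!(@bigcup_mkord T i (fun j => B k (rat_center j))) => -[j ji jy]; exists j; first by [].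
have E : B k (rat_center j) = B k (rat_center i) by rewrite -(Qball_eq jy) (Qball_eq iy).
by rewrite E.
Qed.

Lemma integral_cells k (f : V -> \bar R) : measurable_fun [set: T] (f : T -> \bar R) ->
  (forall x, (0 <= f x)%E) ->
  (\int[mu]_x f x = \sum_(i <oo) \int[mu]_(x in cell k i) f x)%E.
Proof.
move=> mf f0; rewrite -(cell_cover k) ge0_integral_bigcup//.
- by move=> i; exact: measurable_cell.
- by rewrite cell_cover.
- exact: cell_triv.
Qed.

Definition avg f k x : R := (vol k)^-1 * fine (\int[mu]_(y in B k x) (f y)%:E)%E.

Definition ball_integrable f := [/\ measurable_fun [set: T] (f : T -> R),
  forall x, 0 <= f x & forall k x, (\int[mu]_(y in B k x) (f y)%:E < +oo)%E].

Lemma avg_ball_fun f k : ball_fun k (avg f k).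
Proof. by move=> x y xy; rewrite /avg (Qball_eq xy). Qed.

Lemma measurable_avg f k : measurable_fun [set: T] (avg f k : T -> R).
Proof. by apply: (@ball_fun_measurable k); exact: avg_ball_fun. Qed.

Lemma avg_ge0 f k x : (forall y, 0 <= f y) -> 0 <= avg f k x.
Proof.
move=> f0; rewrite mulr_ge0 ?invr_ge0 ?vol_ge0// fine_ge0// integral_ge0// => y _.
by rewrite lee_fin.
Qed.

Lemma avgE f k x : ball_integrable f ->
  (\int[mu]_(y in B k x) (f y)%:E)%E = (vol k * avg f k x)%:E.
Proof.
move=> [_ f0 fi]; rewrite mulrA divff ?gt_eqF ?vol_gt0// mul1r fineK//.
by rewrite ge0_fin_numE// integral_ge0// => y _; rewrite lee_fin.
Qed.

Lemma avg_le f g k x : (forall y, 0 <= f y) -> ball_integrable g ->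
  {ae mu, forall y, B k x y -> f y <= g y} -> avg f k x <= avg g k x.
Proof.
move=> f0 gi fg; rewrite ler_wpM2l ?invr_ge0 ?vol_ge0//.
have g0 : forall y, 0 <= g y by case: gi.
have le : (\int[mu]_(y in B k x) (f y)%:E <= \int[mu]_(y in B k x) (g y)%:E)%E.
  by apply: ge0_le_integral_ae => [y _|y _|]; rewrite ?lee_fin.
have gfin : (\int[mu]_(y in B k x) (g y)%:E)%E \is a fin_num by rewrite avgE.
rewrite fine_le// ge0_fin_numE ?integral_ge0// => [|y _]; last by rewrite lee_fin.
by apply: le_lt_trans le _; rewrite ltey_eq gfin.
Qed.

Lemma ball_integrable_le f g : measurable_fun [set: T] (f : T -> R) ->
  (forall x, 0 <= f x <= g x) -> ball_integrable g -> ball_integrable f.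
Proof.
move=> mf fg [_ _ gi]; split=> // [x|k x]; first by have /andP[] := fg x.
apply: le_lt_trans (gi k x); apply: ge0_le_integral_all => y _; rewrite lee_fin;
  by have /andP[] := fg y.
Qed.

Lemma integral_ball_affine a b f k x : 0 <= a -> 0 <= b ->
  measurable_fun [set: T] (f : T -> R) -> (forall y, 0 <= f y) ->
  (\int[mu]_(y in B k x) (a * f y + b)%:E =
     a%:E * \int[mu]_(y in B k x) (f y)%:E + (b * vol k)%:E)%E.
Proof.
move=> a0 b0 mf f0; under eq_integral do rewrite EFinD EFinM.
have mB : measurable (B k x : set T) := measurable_Qball k x.
have mfB : measurable_fun (B k x : set T) (EFin \o (f : T -> R)).
  by apply/measurable_funTS/measurable_EFinP.
rewrite ge0_integralD//.
- rewrite ge0_integralZl//; last by move=> y _; rewrite lee_fin.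
  by rewrite integral_cst// mu_ball.
- by move=> y _; rewrite -EFinM lee_fin mulr_ge0.
- exact: measurable_funeM.
Qed.

Lemma ball_integrable_affine a b f : 0 <= a -> 0 <= b -> ball_integrable f ->
  ball_integrable (fun y => a * f y + b).
Proof.
move=> a0 b0 fi; have [mf f0 _] := fi; split=> [|x|k x].
- by apply: measurable_funD => //; exact: measurable_funM.
- by rewrite addr_ge0// mulr_ge0.
- by rewrite integral_ball_affine// avgE// -EFinM -EFinD ltry.
Qed.

Lemma avg_affine a b f k x : 0 <= a -> 0 <= b -> ball_integrable f ->
  avg (fun y => a * f y + b) k x = a * avg f k x + b.
Proof.
move=> a0 b0 fi; have [mf f0 _] := fi.
rewrite {1}/avg integral_ball_affine// avgE// -EFinM -EFinD/=.
by field; rewrite gt_eqF// vol_gt0.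
Qed.

Lemma avg_add f g k x : ball_integrable f -> ball_integrable g ->
  avg (fun y => f y + g y) k x = avg f k x + avg g k x.
Proof.
move=> fi gi; have [mf f0 _] := fi; have [mg g0 _] := gi.
rewrite {1}/avg; under eq_integral do rewrite EFinD.
rewrite ge0_integralD.
- by rewrite !avgE// -EFinD/=; field; rewrite gt_eqF// vol_gt0.
- exact: measurable_Qball.
- by move=> y _; rewrite lee_fin.
- by apply/measurable_funTS/measurable_EFinP.
- by move=> y _; rewrite lee_fin.
- by apply/measurable_funTS/measurable_EFinP.
Qed.

Lemma ball_integrable_add f g : ball_integrable f -> ball_integrable g ->
  ball_integrable (fun y => f y + g y).
Proof.
move=> fi gi; have [mf f0 _] := fi; have [mg g0 _] := gi; split=> [|x|k x].
- exact: measurable_funD.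
- exact: addr_ge0.
under eq_integral do rewrite EFinD.
rewrite ge0_integralD.
- by rewrite !avgE// -EFinD ltry.
- exact: measurable_Qball.
- by move=> y _; rewrite lee_fin.
- by apply/measurable_funTS/measurable_EFinP.
- by move=> y _; rewrite lee_fin.
- by apply/measurable_funTS/measurable_EFinP.
Qed.

(** Jensen's inequality, from the tangent line to the convex function t -> t^s
    at the average, which is Young's inequality. *)
Lemma avg_jensen_ae f h k x s : 1 <= s -> ball_integrable f -> ball_integrable h ->
  {ae mu, forall y, B k x y -> f y `^ s <= h y} -> avg f k x `^ s <= avg h k x.
Proof.
rewrite le_eqVlt => /predU1P[<-|s1] fi hi fh; have [_ f0 _] := fi.
  rewrite powRr1 ?avg_ge0//; apply: avg_le => //.
  by apply: ae_imp fh _ => y + xy => /(_ xy); rewrite powRr1.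
set u := avg f k x; have u0 : 0 <= u by exact: avg_ge0.
have c0 : 0 <= s * u `^ (s - 1) by rewrite mulr_ge0 ?powR_ge0//; lra.
have d0 : 0 <= (s - 1) * u `^ s by rewrite mulr_ge0 ?powR_ge0//; lra.
have : avg (fun y => s * u `^ (s - 1) * f y + 0) k x <=
       avg (fun y => 1 * h y + (s - 1) * u `^ s) k x.
  apply: avg_le => [y|//|].
  - by rewrite addr0 mulr_ge0.
  - exact: ball_integrable_affine.
  - apply: ae_imp fh _ => y + xy => /(_ xy) fhy.
    rewrite addr0 mul1r -mulrA [u `^ _ * _]mulrC.
    by apply: le_trans (young_powR u0 (f0 y) s1) _; rewrite lerD2r.
rewrite !avg_affine// -/u addr0 mul1r -mulrA [u `^ _ * _]mulrC -powR_succ//.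
lra.
Qed.

Lemma avg_jensen f k x s : 1 <= s -> ball_integrable f ->
  ball_integrable (fun y => f y `^ s) ->
  avg f k x `^ s <= avg (fun y => f y `^ s) k x.
Proof. by move=> s1 fi fsi; apply: avg_jensen_ae => //; exact: aeW. Qed.

(** Averaging at level k is the conditional expectation on the partition into
    balls of radius p^k: it can be moved past functions that are constant on
    these balls. *)
Lemma avg_selfadj f h k : ball_integrable f -> ball_fun k h ->
  (forall x, 0 <= h x) ->
  (\int[mu]_x (h x * avg f k x)%:E = \int[mu]_x (h x * f x)%:E)%E.
Proof.
move=> fi hk h0; have [mf f0 _] := fi.
have mh : measurable_fun [set: T] (h : T -> R) := ball_fun_measurable hk.
rewrite !(@integral_cells k); last 4 first.
- by apply/measurable_EFinP/measurable_funM.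
- by move=> x; rewrite lee_fin mulr_ge0.
- by apply/measurable_EFinP/measurable_funM => //; exact: measurable_avg.
- by move=> x; rewrite lee_fin mulr_ge0// avg_ge0.
apply: eq_eseriesr => i _.
have mB : measurable (B k (rat_center i) : set T) := measurable_Qball k (rat_center i).
have [->|->] := cellP k i; first by rewrite !integral_set0.
transitivity (\int[mu]_(x in B k (rat_center i)) (h (rat_center i) * avg f k (rat_center i))%:E)%E.
  apply: eq_integral => x /set_mem ix.
  by rewrite (hk _ _ ix) (avg_ball_fun f ix).
rewrite integral_cst// mu_ball.
transitivity (\int[mu]_(x in B k (rat_center i)) ((h (rat_center i))%:E * (f x)%:E))%E; last first.
  by apply: eq_integral => x /set_mem ix; rewrite (hk _ _ ix) EFinM.
rewrite ge0_integralZl//.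
- by rewrite avgE// -!EFinM; congr EFin; ring.
- by apply/measurable_funTS/measurable_EFinP.
- by move=> x _; rewrite lee_fin.
- by rewrite lee_fin.
Qed.

End Averages.

#[local] Opaque avg vol.

(** * Doob's inequality and the maximal function *)

Section MaximalFunction.
Context (R : realType) (p n : nat) (p_prime : prime p).
Variable mu : {measure set (Qpn R p n) -> \bar R}.
Hypothesis mu_haar : is_haar mu.
Local Notation V := 'rV[Qp p]_n.
Local Notation T := (Qpn R p n).
Local Notation ball_fun k := (@ball_fun R p n k _).
Local Notation avg := (avg mu).
Local Notation ball_integrable := (ball_integrable mu).
Implicit Types (f g h : V -> R) (k : int) (x y : V) (s : R).

Definition maxfun f x : \bar R := ereal_sup (range (fun k : int => (avg f k x)%:E)).

(** The partial maxima of the martingale of averages, at the radii p^N, ...,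
    p^(N - m) in decreasing order. *)
Fixpoint pmax f (N m : nat) x : R := if m is j.+1
  then Num.max (pmax f N j x) (avg f (N%:Z - m%:Z) x) else avg f N%:Z x.

Lemma pmax_ball_fun f N m : ball_fun (N%:Z - m%:Z) (pmax f N m).
Proof.
elim: m => [|m IH] x y xy /=; first by apply: avg_ball_fun; rewrite subr0 in xy.
rewrite (@avg_ball_fun _ _ _ _ _ _ x y)//; congr Num.max; apply: IH.
by apply: Qball_le xy => //; lia.
Qed.

Lemma measurable_pmax f N m : measurable_fun [set: T] (pmax f N m : T -> R).
Proof. by apply: ball_fun_measurable; exact: pmax_ball_fun. Qed.

Lemma pmax_ge0 f N m x : (forall y, 0 <= f y) -> 0 <= pmax f N m x.
Proof.
by move=> f0; case: m => [|m] /=; rewrite ?le_max ?avg_ge0 ?orbT.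
Qed.

Lemma pmax_ge f N m j x : (j <= m)%N -> avg f (N%:Z - j%:Z) x <= pmax f N m x.
Proof.
elim: m => [|m IH]; first by rewrite leqn0 => /eqP ->; rewrite subr0.
rewrite leq_eqVlt => /predU1P[-> /=|]; first by rewrite le_max lexx orbT.
by rewrite ltnS => /IH H /=; rewrite le_max H.
Qed.

Lemma pmax_succ_le f N m x : pmax f N m x <= pmax f N m.+1 x.
Proof. by rewrite /= le_max lexx. Qed.

Lemma pmax0 f N x : pmax f N 0 x = avg f N%:Z x. Proof. by []. Qed.

Lemma pmax0_ball_fun f (N : nat) : ball_fun N%:Z (pmax f N 0).
Proof. exact: avg_ball_fun. Qed.

Lemma pmaxS f N m x :
  pmax f N m.+1 x = Num.max (pmax f N m x) (avg f (N%:Z - m.+1%:Z) x).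
Proof. by []. Qed.

(** A summation by parts from increments to totals, arranged so that no infinite
    quantity is subtracted. *)
Lemma abel_ereal (I J : nat -> \bar R) (c : R) : 1 <= c ->
  (forall m, (0 <= J m)%E) -> (I 0%N <= J 0%N)%E ->
  (forall m, (J m <= J m.+1)%E) ->
  (forall m, (I m.+1 + c%:E * J m <= I m + c%:E * J m.+1)%E) ->
  forall m, (I m <= c%:E * J m)%E.
Proof.
move=> c1 J0 IJ0 JS IS; elim=> [|m IH].
  by apply: le_trans IJ0 _; rewrite -[leLHS]mul1e lee_pmul// lee_fin.
have [Joo|Joo] := eqVneq (J m.+1) +oo%E.
  by rewrite Joo gt0_muley ?leey// lte_fin; exact: lt_le_trans c1.
have Jfin : J m.+1 \is a fin_num by rewrite ge0_fin_numE// lt_neqAle Joo leey.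
have Jmfin : (c%:E * J m)%E \is a fin_num.
  by rewrite fin_numM// ge0_fin_numE// (le_lt_trans (JS m))// ltey_eq Jfin.
rewrite -(leeD2lE _ _ Jmfin) [leLHS]addeC; apply: le_trans (IS m) _.
by rewrite leeD2r.
Qed.

#[local] Opaque powR integral pmax.

(** When the running maximum u is exceeded by the next average a, u^s grows at
    most by s/(s-1) times a (a^(s-1) - u^(s-1)), which is Young's inequality
    again. *)
Lemma doob_step (u a s : R) : 1 < s -> 0 <= u -> 0 <= a ->
  Num.max u a `^ s + s / (s - 1) * (u `^ (s - 1) * a) <=
  u `^ s + s / (s - 1) * (Num.max u a `^ (s - 1) * a).
Proof.
move=> s1 u0 a0; have [au|ua] := leP a u; first by [].
have Y := young_powR u0 a0 s1.
rewrite [a `^ (s - 1) * a]mulrC -(powR_succ a0 s1).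
have s10 : 0 < s - 1 by lra.
rewrite -(ler_pM2l s10).
have -> : (s - 1) * (a `^ s + s / (s - 1) * (u `^ (s - 1) * a)) =
  (s - 1) * a `^ s + s * (a * u `^ (s - 1)) by field; lra.
have -> : (s - 1) * (u `^ s + s / (s - 1) * a `^ s) =
  (s - 1) * u `^ s + s * a `^ s by field; lra.
lra.
Qed.

Section Doob.
Variables (f : V -> R) (s : R) (N : nat).
Hypotheses (s1 : 1 < s) (fi : ball_integrable f).
Let f0 : forall x, 0 <= f x. Proof. by case: fi. Qed.
Let mf : measurable_fun [set: T] (f : T -> R). Proof. by case: fi. Qed.
Let c := s / (s - 1).
Let c1 : 1 <= c. Proof. by rewrite /c ler_pdivlMr ?subr_gt0// mul1r gerBl. Qed.
Let c0 : 0 <= c. Proof. exact: le_trans c1. Qed.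
Local Notation A m := (pmax f N m).

Let I m := (\int[mu]_x (A m x `^ s)%:E)%E.
Let J m := (\int[mu]_x (A m x `^ (s - 1) * f x)%:E)%E.

Let mAp m t : measurable_fun [set: T] (fun x : T => A m x `^ t).
Proof. by apply: measurable_fun_powR; exact: measurable_pmax. Qed.

Let I_ge0 m : (0 <= I m)%E.
Proof. by apply: integral_ge0 => x _; rewrite lee_fin powR_ge0. Qed.

Let J_ge0 m : (0 <= J m)%E.
Proof. by apply: integral_ge0 => x _; rewrite lee_fin mulr_ge0// powR_ge0. Qed.

Let cJ m k : k <= N%:Z - m%:Z ->
  (\int[mu]_x (c * (A m x `^ (s - 1) * avg f k x))%:E = c%:E * J m)%E.
Proof.
move=> km; rewrite ge0_integralZl_real.
- congr (_ * _)%E; apply: avg_selfadj => //; last by move=> x; exact: powR_ge0.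
  by apply: ball_fun_le km _ => // x y xy; rewrite (pmax_ball_fun f xy).
- exact: c0.
- by move=> x; apply: mulr_ge0; [exact: powR_ge0|exact: avg_ge0].
- by apply: measurable_funM; [exact: mAp|exact: measurable_avg].
Qed.

Let mAavg m k : measurable_fun [set: T]
  (fun x : T => c * (A m x `^ (s - 1) * avg f k x)).
Proof.
apply: measurable_funM; first exact: measurable_cst.
by apply: measurable_funM; [exact: mAp|exact: measurable_avg].
Qed.

Let Aavg_ge0 m k x : 0 <= c * (A m x `^ (s - 1) * avg f k x).
Proof.
apply: mulr_ge0; first exact: c0.
by apply: mulr_ge0; [exact: powR_ge0|exact: avg_ge0].
Qed.

Let I_succ m : (I m.+1 + c%:E * J m <= I m + c%:E * J m.+1)%E.
Proof.
have km : N%:Z - m.+1%:Z <= N%:Z - m%:Z by lia.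
rewrite -(cJ km) -(@cJ m.+1 _ (lexx _)); apply: le_integral_add.
- by split=> x; [exact: powR_ge0|exact: Aavg_ge0|exact: powR_ge0|exact: Aavg_ge0].
- by split; [exact: mAp|exact: mAavg|exact: mAp|exact: mAavg].
- by move=> x; apply: doob_step; [exact: s1|exact: pmax_ge0|exact: avg_ge0].
Qed.

Let J_succ m : (J m <= J m.+1)%E.
Proof.
apply: ge0_le_integral_all => x _; first by rewrite lee_fin mulr_ge0// powR_ge0.
rewrite lee_fin ler_wpM2r//; apply: powR_mono; [exact: pmax_ge0|exact: pmax_succ_le|by rewrite subr_ge0 ltW].
Qed.

Let I_le_J m : (I m <= c%:E * J m)%E.
Proof.
apply: (@abel_ereal I J c); [exact: c1|exact: J_ge0| |exact: J_succ|exact: I_succ].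
rewrite le_eqVlt; apply/orP; left; apply/eqP.
have AN : ball_fun N (fun x => A 0 x `^ (s - 1)).
  by move=> x y xy; have := @pmax0_ball_fun f N x y xy; cbv beta => ->.
have A0 x : 0 <= A 0 x `^ (s - 1) by exact: powR_ge0.
have E := avg_selfadj p_prime mu_haar fi AN A0.
apply: etrans E; apply: eq_integral => x _.
rewrite mulrC (powR_succ _ s1)//; exact: pmax_ge0.
Qed.

Hypothesis fs : (\int[mu]_x (f x `^ s)%:E < +oo)%E.

Lemma ball_integrable_powR : ball_integrable (fun x => f x `^ s).
Proof.
split=> [|x|k x]; last 2 first.
- exact: powR_ge0.
- apply: le_lt_trans fs; apply: ge0_subset_integral.
  + exact: measurable_Qball.
  + exact: measurableT.
  + by apply/measurable_EFinP/measurable_fun_powR.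
  + by move=> y _; rewrite lee_fin powR_ge0.
  + by [].
exact: measurable_fun_powR.
Qed.

Let avg_s_int k : (\int[mu]_x (avg f k x `^ s)%:E <= \int[mu]_x (f x `^ s)%:E)%E.
Proof.
have fsi := ball_integrable_powR.
have -> : (\int[mu]_x (f x `^ s)%:E =
           \int[mu]_x (1 * avg (fun x => f x `^ s) k x)%:E)%E.
  rewrite (@avg_selfadj _ _ _ p_prime _ mu_haar _ (fun=> 1) k fsi)//.
  by apply: eq_integral => x _; rewrite mul1r.
apply: ge0_le_integral_all => x _; rewrite lee_fin ?powR_ge0// mul1r.
by apply: avg_jensen => //; exact: ltW.
Qed.

Let I_fin m : (I m < +oo)%E.
Proof.
elim: m => [|m IH]; first exact: le_lt_trans (avg_s_int N) fs.
have -> : +oo%E = (+oo + +oo)%E :> \bar R by [].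
apply: (@le_lt_trans _ _ (I m + \int[mu]_x (avg f (N%:Z - m.+1%:Z) x `^ s)%:E)%E).
  rewrite -ge0_integralD_real.
  - apply: le_integral_real => x; first exact: powR_ge0.
    rewrite pmaxS; case: (leP (pmax f N m x)) => _; first by rewrite lerDr powR_ge0.
    by rewrite lerDl powR_ge0.
  - by move=> x; exact: powR_ge0.
  - by move=> x; exact: powR_ge0.
  - exact: mAp.
  - by apply: measurable_fun_powR; exact: measurable_avg.
by apply: lte_add_pinfty; [exact: IH|exact: le_lt_trans (avg_s_int _) fs].
Qed.

(** Doob's L^s inequality. The increments of (pmax f N m)^s are bounded by
    averages of f times increments of (pmax f N m)^(s-1). The latter are
    constant on small balls, so that averages may be replaced by f under the
    integral (avg_selfadj). Summation by parts bounds the integral of (pmax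
    f N m)^s by that of f (pmax f N m)^(s-1), and part of it is absorbed, as
    the integral is finite. *)
Lemma doob m : (\int[mu]_x (pmax f N m x `^ s)%:E <=
  (2 * (2 * c) `^ s)%:E * \int[mu]_x (f x `^ s)%:E)%E.
Proof.
set F := (\int[mu]_x (f x `^ s)%:E)%E.
have mfs : measurable_fun [set: T] (fun x : T => f x `^ s).
  exact: measurable_fun_powR.
have H : (c%:E * J m <= ((2 * c) `^ s)%:E * F + 2^-1%:E * I m)%E.
  rewrite -!ge0_integralZl_real.
  - rewrite -ge0_integralD_real.
    + apply: le_integral_real => x.
        by rewrite mulr_ge0// mulr_ge0// powR_ge0.
      have := absorb_powR c0 (pmax_ge0 N m x f0) (f0 x) s1.
      by rewrite -mulrA [f x * _]mulrC.
    + by move=> x; rewrite mulr_ge0// powR_ge0.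
    + by move=> x; rewrite mulr_ge0// ?powR_ge0// invr_ge0.
    + by apply: measurable_funM => //; exact: measurable_cst.
    + by apply: measurable_funM => //; exact: measurable_cst.
  - by rewrite invr_ge0.
  - by move=> x; rewrite powR_ge0.
  - exact: mAp.
  - exact: powR_ge0.
  - by move=> x; exact: powR_ge0.
  - exact: mfs.
  - exact: c0.
  - by move=> x; rewrite mulr_ge0// powR_ge0.
  - by apply: measurable_funM.
(* The factor 1/2 lets the finite quantity I m be moved to the left. *)
have := le_trans (I_le_J m) H.
have F0 : (0 <= F)%E by apply: integral_ge0 => x _; rewrite lee_fin powR_ge0.
have Ff : F \is a fin_num by rewrite ge0_fin_numE.
have If : I m \is a fin_num by rewrite ge0_fin_numE; [exact: I_fin|exact: I_ge0].
rewrite -[I m]/(\int[mu]_x (A m x `^ s)%:E)%E in If *.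
move: If Ff; case: (integral _ _ _) => // i _; case: F F0 fs {H} => // t _ _ _.
by rewrite -!EFinM -EFinD !lee_fin; lra.
Qed.

End Doob.

Lemma pmax_le_pmax f N N' x : (N <= N')%N ->
  pmax f N (N + N) x <= pmax f N' (N' + N') x.
Proof.
move=> NN.
have H m : (m <= N + N)%N -> pmax f N m x <= pmax f N' (N' + N') x.
  elim: m => [_|m IH mN].
    rewrite pmax0 (_ : N%:Z = N'%:Z - (N' - N)%N%:Z); last by lia.
    by apply: pmax_ge; lia.
  rewrite pmaxS ge_max IH ?(ltnW mN)//.
  rewrite (_ : N%:Z - m.+1%:Z = N'%:Z - (N' - N + m.+1)%N%:Z); last by lia.
  by apply: pmax_ge; lia.
exact: H.
Qed.

(** Taking roots of the bounds turns them into a bound for the supremum. *)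
Lemma sup_poweR_le (u : int -> R) (s : R) (L : \bar R) : 0 < s ->
  (0 <= L)%E -> (forall i, 0 <= u i) -> (forall i, ((u i `^ s)%:E <= L)%E) ->
  (ereal_sup (range (fun i => (u i)%:E)) `^ s <= L)%E.
Proof.
move=> s0 L0 u0 uL; case: L L0 uL => [l| |]; [|by move=> *; exact: leey|by []].
rewrite lee_fin => l0 ul.
have sup_le : (ereal_sup (range (fun i => (u i)%:E)) <= (l `^ s^-1)%:E)%E.
  apply: ge_ereal_sup => _ [i _ <-]; rewrite lee_fin.
  rewrite -[u i]powRr1// -(divff (lt0r_neq0 s0)) powRrM.
  apply: powR_mono; [exact: powR_ge0| by rewrite -lee_fin; exact: ul|].
  by rewrite invr_ge0 ltW.
have sup0 : (0 <= ereal_sup (range (fun i => (u i)%:E)))%E.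
  apply: (@le_trans _ _ (u 0)%:E); first by rewrite lee_fin.
  by apply: ereal_sup_ubound; exists 0.
have -> : l%:E = ((l `^ s^-1)%:E `^ s)%E.
  by rewrite poweR_EFin -powRrM mulVf ?gt_eqF// powRr1.
by apply: gt0_ler_poweR => //; rewrite ?in_itv/= ?sup0 ?leey ?lee_fin ?powR_ge0// ltW.
Qed.

Lemma maxfun_ge0 f x : (forall y, 0 <= f y) -> (0 <= maxfun f x)%E.
Proof.
move=> f0; apply: (@le_trans _ _ (avg f 0 x)%:E); first by rewrite lee_fin avg_ge0.
by apply: ereal_sup_ubound; exists 0.
Qed.

Lemma avg_le_maxfun f k x : ((avg f k x)%:E <= maxfun f x)%E.
Proof. by apply: ereal_sup_ubound; exists k. Qed.

(** The maximum over the radii between p^N and p^(-N) increases to the maximal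
    function, and its bound is independent of N. *)
Theorem maximal_bound f s : 1 < s -> ball_integrable f ->
  (\int[mu]_x (f x `^ s)%:E < +oo)%E ->
  (\int[mu]_x (maxfun f x `^ s)%E <=
   (2 * (2 * (s / (s - 1))) `^ s)%:E * \int[mu]_x (f x `^ s)%:E)%E.
Proof.
move=> s1 fi fs; have [mf f0 _] := fi.
set C := (_ * integral _ _ _)%E.
have s0 : 0 < s by rewrite (lt_trans _ s1).
pose g N x := (pmax f N (N + N) x `^ s)%:E.
have g0 N x : (0 <= g N x)%E by rewrite lee_fin powR_ge0.
have gnd x : nondecreasing_seq (g ^~ x).
  move=> N N' NN; rewrite lee_fin; apply: powR_mono; last exact: ltW.
    exact: pmax_ge0.
  exact: pmax_le_pmax.
have mg N : measurable_fun [set: T] (g N : T -> \bar R).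
  apply/measurable_EFinP/measurable_fun_powR; exact: measurable_pmax.
have limg_ge x N : (g N x <= limn (g ^~ x))%E.
  rewrite (cvg_lim _ (ereal_nondecreasing_cvgn (gnd x)))//.
  by apply: ereal_sup_ubound; exists N.
apply: (@le_trans _ _ (\int[mu]_x limn (g ^~ x))%E).
  apply: ge0_le_integral_all => x _; first exact: poweR_ge0.
  have lim0 : (0 <= limn (g ^~ x))%E by exact: le_trans (limg_ge x 0%N).
  apply: sup_poweR_le => // [k|k]; first exact: avg_ge0.
  apply: le_trans (limg_ge x `|k|%N); rewrite lee_fin.
  apply: powR_mono; [exact: avg_ge0| |exact: ltW].
  pose j := absz ((absz k)%:Z - k).
  have -> : avg f k x = avg f ((absz k)%:Z - j%:Z) x by congr (avg f _ x); lia.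
  by apply: pmax_ge; lia.
rewrite monotone_convergence//.
apply: lime_le; last by apply: nearW => N; exact: doob.
apply: ereal_nondecreasing_is_cvgn => N N' NN.
by apply: ge0_le_integral_all => x _; [exact: g0|exact: gnd].
Qed.

End MaximalFunction.

(** * The fractional maximal function and variable exponents *)

Section VariableMaximal.
Context (R : realType) (p n : nat) (p_prime : prime p).
Variable mu : {measure set (Qpn R p n) -> \bar R}.
Hypothesis mu_haar : is_haar mu.
Local Notation V := 'rV[Qp p]_n.
Local Notation B := (@Qpn_ball R p n).
Local Notation T := (Qpn R p n).
Local Notation norm := (@Qpn_norm R p n).
Local Notation vol := (vol R p n).
Local Notation avg := (avg mu).
Local Notation maxfun := (maxfun mu).
Local Notation ball_integrable := (ball_integrable mu).
Implicit Types (f g : V -> R) (k : int) (x y : V) (s t u : R).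

Lemma vol_natX k : vol k = p%:R `^ (n%:R * k%:~R).
Proof.
rewrite mulrC powRrM powR_intmul ?(ltW (p_gt0 R p_prime))//.
by rewrite powR_mulrn ?(pX_ge0 _ p_prime).
Qed.

Lemma vol_ge1 k : 0 <= k -> 1 <= vol k.
Proof.
by move=> k0; rewrite exprn_ege1// -(expr0z p%:R) ler_pX.
Qed.

Lemma vol_le1 k : k <= 0 -> vol k <= 1.
Proof.
move=> k0; rewrite exprn_ile1 ?(pX_ge0 _ p_prime)//.
by rewrite -(expr0z p%:R) ler_pX.
Qed.

Lemma ball_integrable_modular f (r : V -> R) : measurable_fun [set: T] (f : T -> R) ->
  measurable_fun [set: T] (r : T -> R) -> (forall x, 0 <= f x) -> (forall x, 1 <= r x) ->
  (\int[mu]_x (f x `^ r x)%:E < +oo)%E -> ball_integrable f.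
Proof.
move=> mf mr f0 r1 fr.
have mfr : measurable_fun [set: T] (fun x : T => f x `^ r x).
  by apply: measurable_fun_powR2 => // x; rewrite gt_eqF// (lt_le_trans _ (r1 x)).
have fri : ball_integrable (fun x => f x `^ r x).
  split=> [|x|k x]; [exact: mfr|exact: powR_ge0|].
  apply: le_lt_trans fr; apply: ge0_subset_integral.
  - exact: measurable_Qball.
  - exact: measurableT.
  - exact/measurable_EFinP.
  - by move=> y _; rewrite lee_fin powR_ge0.
  - by [].
apply: (ball_integrable_le mf) (ball_integrable_affine p_prime mu_haar ler01 ler01 fri).
move=> x; rewrite f0 mul1r/=.
have [f1|/ltW f1] := leP 1 (f x); last by rewrite (le_trans f1)// lerDr powR_ge0.
by rewrite (le_trans (le1r_powR f1 (r1 x)))// lerDl.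
Qed.

Lemma avg_le_vol f k x (I : R) : ball_integrable f -> (\int[mu]_x (f x)%:E <= I%:E)%E ->
  vol k * avg f k x <= I.
Proof.
move=> fi fI; rewrite -lee_fin -avgE//; apply: le_trans fI.
have [mf f0 _] := fi; apply: ge0_subset_integral.
- exact: measurable_Qball.
- exact: measurableT.
- exact/measurable_EFinP.
- by move=> y _; rewrite lee_fin.
- by [].
Qed.

Lemma vol_avg_powR f k x s (I : R) : 1 <= s -> ball_integrable f ->
  measurable_fun [set: T] (f : T -> R) ->
  (\int[mu]_x (f x `^ s)%:E <= I%:E)%E -> vol k * avg f k x `^ s <= I.
Proof.
move=> s1 fi mf fI.
have fsi : ball_integrable (fun y => f y `^ s).
  by apply: ball_integrable_powR => //; apply: le_lt_trans fI _; exact: ltry.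
apply: le_trans (avg_le_vol k x fsi fI).
by rewrite ler_wpM2l ?vol_ge0// avg_jensen.
Qed.

(** A supremum of functions which are constant on the balls of a fixed radius is
    lower semicontinuous. *)
Lemma measurable_maxfun_poweR f s : 0 < s -> (forall x, 0 <= f x) ->
  measurable_fun [set: T] (fun x : T => maxfun f x `^ s)%E.
Proof.
move=> s0 f0.
apply: (measurability _ (ErealGenOInfty.measurableE R)) => _ [_ [c ->] <-].
rewrite setTI; apply: sub_sigma_algebra => x /=; rewrite in_itv/= andbT => cx.
have [k ck] : exists k, c < avg f k x `^ s.
  apply: contrapT => /forallNP H; move: cx; rewrite ltNge => /negP; apply.
  have {}H k : avg f k x `^ s <= c by rewrite leNgt; apply/negP/H.
  apply: sup_poweR_le => // [|k]; last exact: avg_ge0.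
  by rewrite lee_fin (le_trans _ (H 0))// powR_ge0.
exists k => y xy; rewrite /preimage/= in_itv/= andbT.
rewrite -(avg_ball_fun mu f xy) in ck.
apply: (@lt_le_trans _ _ ((avg f k y)%:E `^ s)%E); first by rewrite poweR_EFin lte_fin.
apply: gt0_ler_poweR; first exact: ltW.
- by rewrite in_itv/= leey andbT lee_fin avg_ge0.
- by rewrite in_itv/= leey andbT maxfun_ge0.
- exact: avg_le_maxfun.
Qed.

(** The maximal function of this indicator is of size (1 + |x|)^(-n), and its
    square is integrable by the maximal theorem, which replaces a summation
    over shells. *)
Definition unit_ind x : R := \1_(B 0 0) x.

Lemma unit_ind_ge0 x : 0 <= unit_ind x.
Proof. by rewrite /unit_ind indicE. Qed.

Lemma measurable_unit_ind : measurable_fun [set: T] (unit_ind : T -> R).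
Proof. by apply: measurable_indic; exact: measurable_Qball. Qed.

Lemma integral_unit_ind s : 0 < s -> (\int[mu]_x (unit_ind x `^ s)%:E = 1)%E.
Proof.
move=> s0; transitivity (\int[mu]_x (\1_(B 0 0) x)%:E)%E.
  apply: eq_integral => x _; rewrite /unit_ind indicE.
  by case: (_ \in _); rewrite ?powR1// powR0// gt_eqF.
rewrite integral_indic; [|exact: measurableT|exact: measurable_Qball].
by rewrite setIT mu_haar.2.
Qed.

Lemma ball_integrable_unit_ind : ball_integrable unit_ind.
Proof.
apply: (@ball_integrable_modular _ (fun=> 1)).
- exact: measurable_unit_ind.
- exact: measurable_cst.
- exact: unit_ind_ge0.
- by [].
- by rewrite integral_unit_ind// ltry.
Qed.

(** The smallest centred ball of radius at least 1 that contains 0 and x has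
    radius comparable to p + |x|, and the average of the unit ball over it
    is the inverse of its measure. *)
Lemma decay_weight x :
  (((p%:R + norm x) `^ (- (n%:R * 2)))%:E <=
   (p%:R `^ (n%:R * 2))%:E * (maxfun unit_ind x `^ 2)%E)%E.
Proof.
have p1 := p_gt1 R p_prime; have p0 := p_gt0 R p_prime.
have nx0 := Qpn_norm_ge0 R x.
have [k [k0 xk kx]] : exists k : int, [/\ 0 <= k, norm x <= p%:R ^ k &
    p%:R ^ k <= p%:R * (p%:R + norm x)].
  have [->|xn0] := eqVneq x 0.
    exists 0; split; rewrite ?Qpn_norm0 ?expr0z ?addr0 ?ler01//; nra.
  have [g /andP[gx xg]] := Qpn_norm_bracket R p_prime xn0.
  have [g0|/ltW g0] := leP 0 g.
    exists g; split => //.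
    have -> : p%:R ^ g = p%:R * p%:R ^ (g - 1) :> R.
      by rewrite -{2}(expr1z p%:R) -expfzDr ?gt_eqF// addrC subrK.
    by rewrite ler_wpM2l ?ltW// ltr_wpDl// ltW.
  exists 0; split=> //; first by rewrite (le_trans xg)// ler_pX.
  by rewrite expr0z; nra.
have Ax : avg unit_ind k x = (vol k)^-1.
  have E : B k x = B k 0.
    by apply: Qball_eq; rewrite QballE subr0.
  have E2 : (\int[mu]_(y in B k x) (unit_ind y)%:E = mu (B 0 0 `&` B k 0))%E.
    by rewrite E; apply: integral_indic; exact: measurable_Qball.
  move: (avgE p_prime k x ball_integrable_unit_ind); rewrite E2.
  rewrite setIidl; last exact: Qball_le.
  rewrite mu_haar.2 => -[].
  have aux (v a : R) : 0 < v -> 1 = v * a -> a = v^-1.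
    by move=> v0 va; rewrite -[RHS]mulr1 va mulKf ?gt_eqF.
  by apply: aux; exact: vol_gt0.
have vk : vol k <= (p%:R * (p%:R + norm x)) `^ n%:R.
  rewrite powR_mulrn; last by rewrite mulr_ge0 ?addr_ge0// ltW.
  by rewrite lerXn2r ?nnegrE ?(pX_ge0 _ p_prime)// mulr_ge0 ?addr_ge0// ltW.
apply: (@le_trans _ _ ((p%:R `^ (n%:R * 2))%:E * ((avg unit_ind k x)%:E `^ 2))%E); last first.
  rewrite lee_wpmul2l ?lee_fin ?powR_ge0//.
  apply: gt0_ler_poweR => //.
  - by rewrite in_itv/= leey lee_fin andbT Ax invr_ge0 vol_ge0.
  - rewrite in_itv/= leey andbT; by apply: (maxfun_ge0 p_prime); exact: unit_ind_ge0.
  - exact: avg_le_maxfun.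
rewrite poweR_EFin -EFinM lee_fin Ax.
have pn0 : 0 < p%:R + norm x by rewrite ltr_wpDr.
have v0 : 0 < vol k := vol_gt0 R n p_prime k.
rewrite powRN (@powR_mulrn _ _ 2) ?invr_ge0 ?(ltW v0)// exprVn.
set X := p%:R `^ _; set Y := _ `^ _.
have X0 : 0 < X by rewrite powR_gt0.
have Y0 : 0 < Y by rewrite powR_gt0.
have vXY : vol k ^+ 2 <= X * Y.
  rewrite -powRM ?(ltW p0) ?(ltW pn0)// powRrM (@powR_mulrn _ _ 2) ?powR_ge0//.
  by rewrite lerXn2r ?nnegrE ?powR_ge0 ?(ltW v0).
have -> : Y^-1 = X / (X * Y) by field; rewrite (gt_eqF X0) (gt_eqF Y0).
rewrite ler_pM2l// lef_pV2 ?posrE; [exact: vXY|exact: mulr_gt0|exact: exprn_gt0].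
Qed.

Definition frac_max a (f : V -> R) x : \bar R :=
  ereal_sup (range (fun k : int => (vol k `^ a * avg f k x)%:E)).

Lemma frac_max_ge0 a (f : V -> R) x : (forall y, 0 <= f y) ->
  (0 <= frac_max a f x)%E.
Proof.
move=> f0; apply: (@le_trans _ _ (vol 0 `^ a * avg f 0 x)%:E).
  by rewrite lee_fin mulr_ge0 ?powR_ge0 ?avg_ge0.
by apply: ereal_sup_ubound; exists 0.
Qed.

(** What the maximal theorem uses about an exponent: ri is its limit at
    infinity, approached at the rate 1/ln |x|; for almost every x and every
    k < 0, r(x) exceeds an almost everywhere lower bound lo of r on the ball
    B_k(x) by at most D / |k|. *)
Definition log_regular (r : V -> R) (rm rp ri D : R) : Prop :=
  [/\ measurable_fun [set: T] (r : T -> R), 1 < rm /\ rm <= ri <= rp,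
      forall x, rm <= r x <= rp,
      {ae mu, forall x, `|r x - ri| * ln (p%:R + norm x) <= D}
    & {ae mu, forall x k, k < 0 -> exists lo, [/\ rm <= lo,
         (- k)%:~R * (r x - lo) <= D & {ae mu, forall y, B k x y -> lo <= r y}]}].

Section FractionalMaximal.
Variables (r : V -> R) (rm rp ri D alpha : R).
Hypotheses (r_reg : log_regular r rm rp ri D) (al0 : 0 <= alpha)
  (alrp : alpha * rp < 1).
Local Notation sob t := (t / (1 - alpha * t)).

Let mr : measurable_fun [set: T] (r : T -> R). Proof. by case: r_reg. Qed.
Let rm1 : 1 < rm. Proof. by case: r_reg => _ []. Qed.
Let rm0 : 0 < rm. Proof. exact: lt_trans rm1. Qed.
Let rmi : rm <= ri. Proof. by case: r_reg => _ [_ /andP[]]. Qed.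
Let rip : ri <= rp. Proof. by case: r_reg => _ [_ /andP[]]. Qed.
Let rmx x : rm <= r x. Proof. by case: r_reg => _ _ /(_ x)/andP[]. Qed.
Let rxp x : r x <= rp. Proof. by case: r_reg => _ _ /(_ x)/andP[]. Qed.
Let rx0 x : 0 < r x. Proof. exact: lt_le_trans (rmx x). Qed.
Let alr t : t <= rp -> alpha * t < 1.
Proof. by move=> tp; apply: le_lt_trans alrp; rewrite ler_wpM2l. Qed.
Let rmp : rm <= rp. Proof. exact: le_trans rmi rip. Qed.
Let al1 : alpha <= 1.
Proof.
apply: le_trans (ltW alrp); rewrite -{1}[alpha]mulr1 ler_wpM2l//.
by apply: le_trans rmp; exact: ltW.
Qed.
Let sob_ge t : 0 < t -> t <= rp -> t <= sob t.
Proof.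
move=> t0 tp; have alt := alr tp.
rewrite ler_pdivlMr; last by rewrite subr_gt0.
by rewrite -[leRHS]mulr1 ler_wpM2l ?(ltW t0)// gerBl mulr_ge0// ltW.
Qed.
Let sob_mono t u : 0 < t -> t <= u -> u <= rp -> sob t <= sob u.
Proof. by move=> t0 tu up; apply: sobolev_exponent_mono => //; exact: alr. Qed.

(** A bound for v^(- (r(x) - lo)), where v is the measure of a small ball on
    which r is at least lo. *)
Definition oscillation_const : R := p%:R `^ (n%:R * Num.max D 0).

Let oc1 : 1 <= oscillation_const.
Proof. by rewrite powR_ge1 ?mulr_ge0 ?le_max ?lexx ?orbT// ltW// p_gt1. Qed.

Let oc0 : 0 <= oscillation_const. Proof. exact: le_trans oc1. Qed.

Section LargePart.
Variable g : V -> R.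
Hypotheses (mg : measurable_fun [set: T] (g : T -> R)) (gi : ball_integrable g).
Hypothesis g01 : forall x, g x = 0 \/ 1 <= g x.
Hypothesis g_mod : (\int[mu]_x (g x `^ r x)%:E <= 1)%E.

Let g0 x : 0 <= g x. Proof. by case: gi. Qed.

Let g_powR s t x : 0 < s -> s <= t -> g x `^ s <= g x `^ t.
Proof.
move=> s0 st; case: (g01 x) => [->|g1].
  by rewrite !powR0// gt_eqF// (lt_le_trans s0).
by apply: ler_powR.
Qed.

Let g_int s : 0 < s -> s <= rm -> (\int[mu]_x (g x `^ s)%:E <= 1)%E.
Proof.
move=> s0 sm; apply: le_trans g_mod; apply: le_integral_real => x.
  exact: powR_ge0.
by apply: g_powR => //; exact: le_trans (rmx x).
Qed.

Let vol_avg_g k x : vol k * avg g k x <= 1.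
Proof.
apply: avg_le_vol => //; apply: le_trans (g_int ltr01 (ltW rm1)).
by apply: le_integral_real => // x'; rewrite powRr1.
Qed.

(** Since g vanishes or is at least 1, its integral is at most its modular.
    Hence v^alpha times the average is at most 1, and the exponent of this
    quantity may be lowered to a constant one. *)
Lemma large_ball_bound k x : 0 <= k ->
  (vol k `^ alpha * avg g k x) `^ (sob (r x)) <= avg g k x `^ rm.
Proof.
move=> k0; have v1 := vol_ge1 k0; have a0 : 0 <= avg g k x by exact: avg_ge0.
have F1 : vol k `^ alpha * avg g k x <= 1.
  apply: le_trans (vol_avg_g k x); rewrite ler_wpM2r//.
  by rewrite -[leRHS]powRr1 ?(le_trans ler01 v1)//; exact: ler_powR.
have F0 : 0 <= vol k `^ alpha * avg g k x by rewrite mulr_ge0// powR_ge0.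
apply: (@le_trans _ _ ((vol k `^ alpha * avg g k x) `^ sob rm)).
  apply: powR_anti; [by rewrite F0| |exact: sob_mono].
  by apply: lt_le_trans (sob_ge rm0 rmp).
have -> : avg g k x `^ rm = 1 `^ (alpha * sob rm) * avg g k x `^ rm.
  by rewrite powR1 mul1r.
apply: hedberg_powR => //; [exact: vol_gt0|exact: alr|].
apply: (@vol_avg_powR _ _ _ _ 1) => //; [exact: ltW|exact: g_int].
Qed.

Let h x := g x `^ (r x / rm).

Let mh : measurable_fun [set: T] (h : T -> R).
Proof.
apply: measurable_fun_powR2 => [x|//|]; first by rewrite gt_eqF// divr_gt0.
by apply: measurable_funM => //; exact: measurable_cst.
Qed.

Let hE x : h x `^ rm = g x `^ r x.
Proof. by rewrite /h -powRrM divfK// gt_eqF. Qed.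

Let h_int : (\int[mu]_x (h x `^ rm)%:E <= 1)%E.
Proof. by under eq_integral do rewrite hE. Qed.

Let hi : ball_integrable h.
Proof.
apply: (@ball_integrable_modular _ (fun=> rm)) => //.
- by move=> x; exact: powR_ge0.
- by move=> x; exact: ltW.
- exact: le_lt_trans h_int (ltry _).
Qed.

(** Let A be the average of g on a ball of measure v < 1, with r >= lo there.
    Jensen's inequality bounds A^lo by an average of powers that stay below
    the modular, and A^(r - lo) is bounded, since A <= 1/v and r - lo =
    O(1/|k|). *)
Lemma small_ball_bound (K := oscillation_const) : {ae mu, forall x k, k < 0 ->
  (vol k `^ alpha * avg g k x) `^ (sob (r x)) <=
  K `^ (alpha * sob rp) * K * avg h k x `^ rm}.
Proof.
have [_ _ _ _ L] := r_reg; apply: ae_imp L _ => x H k k0.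
have [lo [rmlo lox loy]] := H k k0.
set A := avg g k x; have A0 : 0 <= A by exact: avg_ge0.
set F := avg h k x; have F0 : 0 <= F by apply: avg_ge0 => // y; exact: powR_ge0.
have v0 := vol_gt0 R n p_prime k.
have AK : A `^ r x <= K * F `^ rm.
  have [A1|/ltW A1] := leP 1 A; last first.
    apply: (@le_trans _ _ (F `^ rm)); last by rewrite ler_peMl// powR_ge0.
    apply: (@le_trans _ _ (A `^ rm)); first by apply: powR_anti; rewrite ?A0.
    apply: powR_mono; [exact: A0| |exact: ltW].
    apply: avg_le => //; apply: aeW => y _.
    by rewrite -[leLHS]powRr1//; apply: g_powR => //; rewrite ler_pdivlMr// mul1r.
  have lorm : 1 <= lo / rm by rewrite ler_pdivlMr// mul1r.
  have lo0 : 0 < lo by exact: lt_le_trans rmlo.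
  have ghi : {ae mu, forall y, B k x y -> g y `^ (lo / rm) <= h y}.
    apply: ae_imp loy _ => y H2 /H2 lory; apply: g_powR; first by rewrite divr_gt0.
    by rewrite ler_pM2r ?invr_gt0.
  have AF : A `^ lo <= F `^ rm.
    rewrite -[lo](divfK (lt0r_neq0 rm0)) powRrM.
    apply: powR_mono; [exact: powR_ge0| |exact: ltW].
    exact: avg_jensen_ae.
  have AvK : A `^ (r x - lo) <= K.
    apply: (@le_trans _ _ (A `^ Num.max (r x - lo) 0)).
      by apply: ler_powR => //; rewrite le_max lexx.
    have Av : A <= (vol k)^-1.
      by rewrite -[leRHS]mulr1 ler_pdivlMl//; exact: vol_avg_g.
    apply: (@le_trans _ _ ((vol k)^-1 `^ Num.max (r x - lo) 0)).
      by apply: powR_mono => //; rewrite le_max lexx orbT.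
    rewrite vol_natX -powRN -powRrM; apply: ler_powR; first exact/ltW/p_gt1.
    rewrite -mulrN -mulrA ler_wpM2l// maxr_pMr; last first.
      by rewrite oppr_ge0 lerz0 ltW.
    by rewrite mulr0 ge_max !le_max lexx orbT andbT; move: lox; rewrite mulrNz => ->.
  have -> : r x = (r x - lo) + lo by rewrite subrK.
  rewrite powRD; last by rewrite subrK gt_eqF.
  by rewrite ler_pM ?powR_ge0.
have vAK : vol k * A `^ r x <= K.
  apply: (@le_trans _ _ (K * (vol k * F `^ rm))).
    by rewrite mulrCA ler_wpM2l ?(ltW v0).
  rewrite -[leRHS]mulr1 ler_wpM2l//.
  by apply: (@vol_avg_powR _ _ _ _ 1) => //; exact: ltW.
have := hedberg_powR v0 A0 (rx0 x) al0 (alr (rxp x)) vAK.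
move=> /le_trans; apply; rewrite -mulrA ler_pM ?powR_ge0//.
by apply: ler_powR => //; rewrite ler_wpM2l// sob_mono.
Qed.

End LargePart.

(** Functions g <= 1. Replacing r by ri costs an integrable weight (decay_powR),
    which gives the constant exponent modular; averages of g are then
    estimated with the constant exponent ri, and the same replacement leads
    back from the Sobolev exponent of ri to that of r. It requires values in
    [0, 1], whence the division by the bound K0. *)
Lemma decaying_part : exists I C3 C4 : R, [/\ 0 <= I, 0 <= C3, 0 <= C4 &
  forall g, ball_integrable g -> (forall x, g x <= 1) ->
    (\int[mu]_x (g x `^ r x)%:E <= 1)%E ->
    (\int[mu]_x (g x `^ ri)%:E <= I%:E)%E /\
    {ae mu, forall x k, (((vol k `^ alpha * avg g k x) `^ (sob (r x)))%:E <=
       C3%:E * (avg g k x `^ ri)%:E + C4%:E * maxfun unit_ind x `^ 2)%E}].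
Proof.
pose m : R := n%:R * 2; have m0 : 0 <= m by rewrite mulr_ge0.
pose I := expR (m * D) + p%:R `^ m * (2 * (2 * (2 / (2 - 1))) `^ 2).
have I0 : 0 <= I.
  by rewrite addr_ge0 ?expR_ge0// !mulr_ge0 ?powR_ge0.
pose K0 := 1 + I; have K01 : 1 <= K0 by rewrite lerDl.
have K00 : 0 < K0 by rewrite (lt_le_trans ltr01).
(* Dq is the constant D for the exponents r / (1 - alpha r), which are a Lipschitz
   function of r on the range of r. *)
pose Dq := D / (1 - alpha * rp) ^+ 2.
pose C3 := K0 `^ (sob rp) * (expR (m * Dq) * I `^ (alpha * sob ri)).
pose C4 := K0 `^ (sob rp) * p%:R `^ m.
have ri1 : 1 < ri by exact: lt_le_trans rmi.
have ri0 : 0 < ri by exact: lt_trans ri1.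
exists I, C3, C4; split.
- exact: I0.
- by rewrite !mulr_ge0 ?powR_ge0 ?expR_ge0.
- by rewrite mulr_ge0 ?powR_ge0.
move=> g gi g1 g_mod; have [mg g0 _] := gi.
have L1 x : 1 <= p%:R + norm x.
  by rewrite -[leLHS]addr0 lerD ?Qpn_norm_ge0// ler1n prime_gt0.
have [_ _ _ dec _] := r_reg.
have gI : (\int[mu]_x (g x `^ ri)%:E <= I%:E)%E.
  apply: (@le_trans _ _ (\int[mu]_x ((expR (m * D) * g x `^ r x)%:E +
      (p%:R `^ m)%:E * maxfun unit_ind x `^ 2)%E)%E).
    apply: ge0_le_integral_ae.
    - by move=> x _; rewrite lee_fin powR_ge0.
    - move=> x _; rewrite adde_ge0 ?mule_ge0 ?poweR_ge0 ?lee_fin ?powR_ge0//.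
      by rewrite mulr_ge0 ?expR_ge0 ?powR_ge0.
    - apply: ae_imp dec _ => x dx _.
      apply: le_trans (leeD (lexx _) (decay_weight x)).
      rewrite -EFinD lee_fin; apply: decay_powR => //; last exact: ltW.
      by rewrite g0 g1.
  have mgr : measurable_fun [set: T] (fun x : T => g x `^ r x).
    by apply: measurable_fun_powR2 => // x; rewrite gt_eqF.
  have mu2 : measurable_fun [set: T] (fun x : T => maxfun unit_ind x `^ 2)%E.
    by apply: measurable_maxfun_poweR => // x; exact: unit_ind_ge0.
  rewrite ge0_integralD//.
  - rewrite ge0_integralZl_real//; last by move=> x; exact: powR_ge0.
    rewrite ge0_integralZl//; last by move=> x _; exact: poweR_ge0.
    rewrite EFinD leeD//.
      by rewrite -[leRHS]mule1 lee_wpmul2l// lee_fin expR_ge0.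
    rewrite EFinM lee_wpmul2l ?lee_fin ?powR_ge0//.
    rewrite -[leRHS]mule1 -(@integral_unit_ind 2)//.
    apply: maximal_bound => //; first by rewrite ltr1n.
      exact: ball_integrable_unit_ind.
    by rewrite integral_unit_ind// ltry.
  - by move=> x _; rewrite lee_fin mulr_ge0 ?expR_ge0 ?powR_ge0.
  - by apply/measurable_EFinP/measurable_funM.
  - by move=> x _; rewrite mule_ge0 ?poweR_ge0 ?lee_fin ?powR_ge0.
  - exact: measurable_funeM.
split=> //; apply: ae_imp dec _ => x dx k.
set a := avg g k x; have a0 : 0 <= a by exact: avg_ge0.
have a1 : a <= 1.
  have -> : (1 : R) = avg (fun y => 0 * g y + 1) k x by rewrite avg_affine// mul0r add0r.
  apply: avg_le => //; first exact: ball_integrable_affine.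
  by apply: aeW => y _; rewrite mul0r add0r.
have va : vol k * a `^ ri <= I by apply: vol_avg_powR => //; exact: ltW.
have v0 := vol_gt0 R n p_prime k.
set F := vol k `^ alpha * a; have F0 : 0 <= F by rewrite mulr_ge0 ?powR_ge0.
have FK : F <= K0.
  have [k0|/ltW k0] := leP k 0.
    apply: le_trans K01; rewrite mulr_ile1 ?powR_ge0// powR_le1//.
    by rewrite (ltW v0) vol_le1.
  rewrite leNgt; apply/negP => KF.
  have : F `^ ri <= K0.
    apply: (@le_trans _ _ I); last by rewrite lerDr.
    apply: le_trans va; rewrite powRM ?powR_ge0// ler_wpM2r ?powR_ge0//.
    rewrite -powRrM -[leRHS]powRr1 ?(ltW v0)//; apply: ler_powR; first exact: vol_ge1.
    exact/ltW/alr.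
  apply/negP; rewrite -ltNge; apply: (@le_lt_trans _ _ (K0 `^ ri)).
    by apply: le1r_powR => //; exact: ltW.
  by apply: gt0_ltr_powR => //; rewrite nnegrE ltW.
have Q0 : 0 < sob ri by apply: lt_le_trans (sob_ge ri0 rip).
have dq : `|sob ri - sob (r x)| * ln (p%:R + norm x) <= Dq.
  rewrite distrC; apply: (@le_trans _ _ (`|r x - ri| / (1 - alpha * rp) ^+ 2 * ln (p%:R + norm x))).
    rewrite ler_wpM2r ?ln_ge0//; exact: sobolev_exponent_dist.
  by rewrite mulrAC ler_wpM2r// invr_ge0 exprn_ge0// subr_ge0 ltW.
have G01 : 0 <= F / K0 <= 1.
  by rewrite divr_ge0 ?(ltW K00)// ler_pdivrMr// mul1r.
have Q1 : 1 <= sob (r x).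
  by apply: le_trans (sob_ge (rx0 x) (rxp x)); apply: le_trans (rmx x); exact: ltW.
have H := decay_powR G01 Q0 Q1 m0 (L1 x) dq.
have FE : F `^ sob (r x) = K0 `^ sob (r x) * (F / K0) `^ sob (r x).
  rewrite -powRM ?(ltW K00)//; last by case/andP: G01.
  by rewrite mulrCA divff ?mulr1// gt_eqF.
have HF : F `^ sob (r x) <= C3 * a `^ ri + K0 `^ sob rp * (p%:R + norm x) `^ (- m).
  rewrite FE; apply: (@le_trans _ _ (K0 `^ sob rp * (F / K0) `^ sob (r x))).
    by rewrite ler_wpM2r ?powR_ge0//; apply: ler_powR => //; exact: sob_mono.
  have -> : C3 * a `^ ri = K0 `^ (sob rp) *
      (expR (m * Dq) * (I `^ (alpha * sob ri) * a `^ ri)).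
    by rewrite /C3 -[LHS]mulrA -[X in _ * X]mulrA.
  rewrite -mulrDr ler_wpM2l ?powR_ge0//; apply: le_trans H _.
  rewrite lerD2r ler_wpM2l ?expR_ge0//.
  apply: (@le_trans _ _ (F `^ sob ri)).
    apply: powR_mono; [by case/andP: G01| |exact: ltW].
    by rewrite ler_pdivrMr// ler_peMr.
  by apply: hedberg_powR => //; exact: alr.
rewrite -lee_fin in HF; apply: le_trans HF _.
rewrite EFinD EFinM leeD2l// EFinM [C4%:E]EFinM -muleA lee_wpmul2l ?lee_fin ?powR_ge0//.
exact: decay_weight.
Qed.

(** The function is cut at the value 1; the exponent inf r serves the large
    part, the exponent ri at infinity the small part, and the maximal
    theorem for constant exponents is applied to four functions. *)
Theorem fractional_maximal_modular : exists2 C : R, 0 < C & forall f : V -> R,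
  measurable_fun [set: T] (f : T -> R) -> (forall x, 0 <= f x) ->
  (\int[mu]_x (f x `^ r x)%:E <= 1)%E ->
  (\int[mu]_x (frac_max alpha f x `^ sob (r x)) <= C%:E)%E.
Proof.
have [I [C3 [C4 [I0 C30 C40 dec]]]] := decaying_part.
pose Ks := oscillation_const `^ (alpha * sob rp) * oscillation_const.
have Ks0 : 0 <= Ks by rewrite mulr_ge0 ?powR_ge0.
pose M s : R := 2 * (2 * (s / (s - 1))) `^ s.
have M0 s : 0 <= M s by rewrite mulr_ge0 ?powR_ge0.
have ri1 : 1 < ri by exact: lt_le_trans rmi.
have ri0 : 0 < ri by exact: lt_trans ri1.
(* The constant c comes from (u + v)^q <= 2^q (u^q + v^q). *)
pose c : R := 2 `^ sob rp; have c0 : 0 <= c by exact: powR_ge0.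
exists (c * (M rm + Ks * M rm + (C3 * (M ri * I) + C4 * M 2)) + 1).
  apply: ltr_wpDl => //; apply: mulr_ge0 => //.
  apply: addr_ge0; apply: addr_ge0; rewrite ?M0//; apply: mulr_ge0; rewrite ?M0//.
  by apply: mulr_ge0; rewrite ?M0.
move=> f mf f0 f_mod.
have fi : ball_integrable f.
  apply: (ball_integrable_modular mf mr f0) => [x|].
    by apply: le_trans (rmx x); exact: ltW.
  exact: le_lt_trans f_mod (ltry _).
pose f1 x := if 1 <= f x then f x else 0.
pose f2 x := if 1 <= f x then 0 else f x.
have mlarge : measurable_fun [set: T] (fun x : T => 1 <= f x) by exact: measurable_fun_ler.
have mf1 : measurable_fun [set: T] (f1 : T -> R) by exact: measurable_fun_ifT.
have mf2 : measurable_fun [set: T] (f2 : T -> R) by exact: measurable_fun_ifT.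
have f1f x : 0 <= f1 x <= f x by rewrite /f1; case: ifP => _; rewrite lexx ?f0.
have f2f x : 0 <= f2 x <= f x by rewrite /f2; case: ifP => _; rewrite lexx ?f0.
have f1i := ball_integrable_le mf1 f1f fi.
have f2i := ball_integrable_le mf2 f2f fi.
have le_mod g : (forall x, 0 <= g x <= f x) -> (\int[mu]_x (g x `^ r x)%:E <= 1)%E.
  move=> gf; apply: le_trans f_mod; apply: le_integral_real => x; first exact: powR_ge0.
  by have /andP[g0 gfx] := gf x; apply: powR_mono => //; exact: ltW.
have f1_mod := le_mod f1 f1f; have f2_mod := le_mod f2 f2f.
have f1_01 x : f1 x = 0 \/ 1 <= f1 x by rewrite /f1; case: (leP 1 (f x)) => ?; [right|left].
have f2_1 x : f2 x <= 1 by rewrite /f2; case: (leP 1 (f x)) => [_|/ltW].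
have [f2I f2b] := dec f2 f2i f2_1 f2_mod.
(* The function h is f1 rescaled to the constant exponent rm: h^rm = f1^r. *)
pose h x := f1 x `^ (r x / rm).
have mh : measurable_fun [set: T] (h : T -> R).
  apply: measurable_fun_powR2 => [x|//|]; first by rewrite gt_eqF// divr_gt0.
  by apply: measurable_funM => //; exact: measurable_cst.
have h0 x : 0 <= h x by exact: powR_ge0.
have hE x : h x `^ rm = f1 x `^ r x by rewrite /h -powRrM divfK// gt_eqF.
have h_int : (\int[mu]_x (h x `^ rm)%:E <= 1)%E by under eq_integral do rewrite hE.
have hi : ball_integrable h.
  apply: (@ball_integrable_modular _ (fun=> rm)) => //; first by move=> x; exact: ltW.
  exact: le_lt_trans h_int (ltry _).
have f1_int : (\int[mu]_x (f1 x `^ rm)%:E <= 1)%E.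
  apply: le_trans f1_mod; apply: le_integral_real => x; first exact: powR_ge0.
  case: (f1_01 x) => [->|H]; first by rewrite !powR0// gt_eqF.
  exact: ler_powR.
have small := small_ball_bound mf1 f1i f1_01 f1_mod.
have uind0 := @unit_ind_ge0.
pose Y x := (c%:E * ((maxfun f1 x `^ rm + Ks%:E * maxfun h x `^ rm) +
  (C3%:E * maxfun f2 x `^ ri + C4%:E * maxfun unit_ind x `^ 2)))%E.
have f1_0 x : 0 <= f1 x by have /andP[] := f1f x.
have f2_0 x : 0 <= f2 x by have /andP[] := f2f x.
have avg_max g k x s : (forall y, 0 <= g y) -> 0 < s ->
    ((avg g k x `^ s)%:E <= maxfun g x `^ s)%E.
  move=> g0 s0; rewrite -poweR_EFin; apply: gt0_ler_poweR; first exact: ltW.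
  - by rewrite in_itv/= leey andbT lee_fin avg_ge0.
  - by rewrite in_itv/= leey andbT maxfun_ge0.
  - exact: avg_le_maxfun.
apply: (@le_trans _ _ (\int[mu]_x Y x)%E).
  apply: ge0_le_integral_ae => [x _|x _|]; first exact: poweR_ge0.
    by rewrite mule_ge0 ?adde_ge0 ?mule_ge0 ?poweR_ge0 ?lee_fin.
  apply: (ae_imp2 small f2b) => x Hs H2 _.
  have Q0 : 0 < sob (r x).
    by apply: lt_le_trans (sob_ge (rx0 x) (rxp x)).
  have Y0 : (0 <= Y x)%E.
    by rewrite mule_ge0 ?adde_ge0 ?mule_ge0 ?poweR_ge0 ?lee_fin.
  apply: sup_poweR_le => // k.
    by rewrite mulr_ge0 ?powR_ge0 ?avg_ge0.
  have -> : avg f k x = avg f1 k x + avg f2 k x.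
    rewrite -avg_add//; congr (avg _ k x); apply/funext => y.
    by rewrite /f1 /f2; case: ifP; rewrite ?addr0 ?add0r.
  rewrite mulrDr.
  have F10 : 0 <= vol k `^ alpha * avg f1 k x by rewrite mulr_ge0 ?powR_ge0 ?avg_ge0.
  have F20 : 0 <= vol k `^ alpha * avg f2 k x by rewrite mulr_ge0 ?powR_ge0 ?avg_ge0.
  have := powR_addl F10 F20 (ltW Q0); rewrite -lee_fin => /le_trans; apply.
  rewrite EFinM EFinD; apply: lee_pmul.
  - by rewrite lee_fin powR_ge0.
  - by rewrite -EFinD lee_fin addr_ge0 ?powR_ge0.
  - by rewrite lee_fin ler_powR ?ler1n// sob_mono.
  apply: leeD.
    have [k0|k0] := leP 0 k.
      have := large_ball_bound mf1 f1i f1_01 f1_mod x k0; rewrite -lee_fin.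
      move=> /le_trans; apply; apply: (le_trans (avg_max _ k x _ f1_0 rm0)).
      by rewrite leeDl// mule_ge0 ?poweR_ge0 ?lee_fin.
    have := Hs k k0; rewrite -lee_fin => /le_trans; apply.
    rewrite EFinM; apply: (@le_trans _ _ (Ks%:E * maxfun h x `^ rm)%E).
      by rewrite lee_wpmul2l ?lee_fin// avg_max.
    by rewrite leeDr// poweR_ge0.
  apply: le_trans (H2 k) _; rewrite leeD2r// lee_wpmul2l ?lee_fin//.
  exact: avg_max.
have mM g s : 0 < s -> (forall x, 0 <= g x) ->
   measurable_fun [set: T] (fun x : T => maxfun g x `^ s)%E.
  by move=> s0 g0; exact: measurable_maxfun_poweR.
have mCM (a : R) g s : 0 < s -> (forall x, 0 <= g x) ->
   measurable_fun [set: T] (fun x : T => a%:E * maxfun g x `^ s)%E.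
  by move=> s0 g0; apply: measurable_funeM; exact: mM.
have CM0 (a : R) g s x : 0 <= a -> (0 <= a%:E * maxfun g x `^ s)%E.
  by move=> a0; rewrite mule_ge0 ?poweR_ge0 ?lee_fin.
have bnd (a J : R) g s : 0 <= a -> 1 < s -> ball_integrable g ->
    (\int[mu]_x (g x `^ s)%:E <= J%:E)%E ->
    (\int[mu]_x (a%:E * maxfun g x `^ s) <= (a * (M s * J))%:E)%E.
  move=> a0 s1 gi gJ; have [_ g0 _] := gi.
  rewrite ge0_integralZl//.
  - rewrite EFinM lee_wpmul2l ?lee_fin//.
    apply: le_trans (maximal_bound p_prime mu_haar s1 gi _) _.
      exact: le_lt_trans gJ (ltry _).
    by rewrite [leRHS]EFinM lee_wpmul2l ?lee_fin ?M0.
  - by apply: mM => //; exact: lt_trans s1.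
  - by move=> x _; exact: poweR_ge0.
have Y1 : (\int[mu]_x (maxfun f1 x `^ rm + Ks%:E * maxfun h x `^ rm) <=
    (M rm + Ks * M rm)%:E)%E.
  rewrite ge0_integralD//.
  - rewrite EFinD leeD//.
      have := bnd 1 1 f1 rm ler01 rm1 f1i f1_int; rewrite mul1r mulr1.
      by under eq_integral do rewrite mul1e.
    by have := bnd Ks 1 h rm Ks0 rm1 hi h_int; rewrite mulr1.
  - by move=> x _; exact: poweR_ge0.
  - exact: mM.
  - by move=> x _; exact: CM0.
  - exact: mCM.
have Y2 : (\int[mu]_x (C3%:E * maxfun f2 x `^ ri + C4%:E * maxfun unit_ind x `^ 2) <=
    (C3 * (M ri * I) + C4 * M 2)%:E)%E.
  rewrite ge0_integralD//.
  - rewrite EFinD leeD//; first exact: bnd.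
    have := @bnd C4 1 unit_ind 2 C40 _ ball_integrable_unit_ind.
    by rewrite mulr1 integral_unit_ind// lexx ltr1n; apply.
  - by move=> x _; exact: CM0.
  - exact: mCM.
  - by move=> x _; exact: CM0.
  - exact: mCM.
rewrite /Y ge0_integralZl//.
- apply: (@le_trans _ _ (c * (M rm + Ks * M rm + (C3 * (M ri * I) + C4 * M 2)))%:E); last first.
    by rewrite lee_fin lerDl.
  rewrite [leRHS]EFinM; apply: lee_wpmul2l; first by rewrite lee_fin.
  rewrite ge0_integralD//.
  - by rewrite [leRHS]EFinD leeD.
  - by move=> x _; rewrite adde_ge0 ?poweR_ge0// CM0.
  - by apply: emeasurable_funD; [exact: mM|exact: mCM].
  - by move=> x _; rewrite adde_ge0 ?CM0.
  - by apply: emeasurable_funD; exact: mCM.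
- by apply: emeasurable_funD; apply: emeasurable_funD; [exact: mM|exact: mCM..].
- by move=> x _; rewrite !adde_ge0 ?poweR_ge0 ?CM0.
Qed.

End FractionalMaximal.

End VariableMaximal.

(** * Log-Hoelder exponents *)

Lemma dist_overlap (R : realType) (a b e f : R) : 0 <= e -> 0 <= f ->
  `|a - b| <= e \/ `|b - a| <= f -> a - e <= b + f.
Proof. by move=> e0 f0 []; rewrite ler_norml => /andP[h1 h2]; lra. Qed.

(** Truncation to an interval does not move a number away from the points of the
    interval. *)
Lemma clamp_dist (R : realType) (a e s lo hi : R) : lo <= a <= hi -> 0 <= e ->
  a - e <= s <= a + e -> `|a - Num.max lo (Num.min hi s)| <= e.
Proof.
move=> /andP[h1 h2] e0 /andP[s1 s2]; rewrite ler_distl.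
have [hs|hs] := leP hi s; first by rewrite max_r; [apply/andP; split; lra|lra].
by have [ls|ls] := leP lo s; apply/andP; split; lra.
Qed.

Section LogExponents.
Context (R : realType) (p n : nat) (p_prime : prime p).
Variable mu : {measure set (Qpn R p n) -> \bar R}.
Hypothesis mu_haar : is_haar mu.
Local Notation V := 'rV[Qp p]_n.
Local Notation B := (@Qpn_ball R p n).
Local Notation T := (Qpn R p n).
Local Notation norm := (@Qpn_norm R p n).
Implicit Types (q r : V -> R) (k : int) (x y : V).

Lemma haar_setT_gt0 : (0 < mu [set: T])%E.
Proof.
apply: (@lt_le_trans _ _ (mu (B 0 0))); first by rewrite mu_haar.2 lte_fin.
apply: le_measure; rewrite ?inE; [exact: measurable_Qball|exact: measurableT|].
by [].
Qed.

(** Balls have positive measure. *)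
Lemma ae_ball_ex k x (P : V -> Prop) : {ae mu, forall y, B k x y -> P y} ->
  exists y, B k x y /\ P y.
Proof.
move=> [N [mN N0 PN]]; apply: contrapT => /forallNP H.
have : (mu (B k x) <= mu N)%E.
  apply: le_measure; rewrite ?inE//; first exact: measurable_Qball.
  move=> y xy; apply: PN => /= Py; apply: (H y); split=> //; exact: Py.
by rewrite N0 leNgt haar_ball_gt0.
Qed.

Lemma exponent_bounds q : exponent mu q -> exists rm rp : R,
  [/\ 1 < rm, ess_inf mu (EFin \o q) = rm%:E, ess_sup mu (EFin \o q) = rp%:E &
      forall x, rm <= q x <= rp].
Proof.
move=> [_ i1 qx s1]; have [_ /andP[iq qs]] := qx 0.
have ifin : ess_inf mu (EFin \o q) \is a fin_num.
  by rewrite fin_numElt (lt_trans _ i1) ?ltNyr// (le_lt_trans iq)// ltry.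
have sfin : ess_sup mu (EFin \o q) \is a fin_num.
  by rewrite fin_numElt s1 (lt_le_trans _ qs)// ltNyr.
exists (fine (ess_inf mu (EFin \o q))), (fine (ess_sup mu (EFin \o q))).
split; rewrite ?fineK//; first by rewrite -lte_fin fineK.
by move=> x; have [_] := qx x; rewrite -!lee_fin !fineK.
Qed.

(** The essential bounds need not be attained, and they are relaxed by 1/|k|,
    which costs a bounded amount after multiplication by |k|. *)
Lemma log_exponent_local q rm rp C k x : (forall y, rm <= q y <= rp) -> k < 0 ->
  ((k%:~R)%:E * (ess_inf_on mu (B k x) q - ess_sup_on mu (B k x) q) <= C%:E)%E ->
  exists lo hi, [/\ rm <= lo, (- k)%:~R * (hi - lo) <= C + 2 &
    {ae mu, forall y, B k x y -> lo <= q y <= hi}].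
Proof.
move=> qb k0; set I := ess_inf_on _ _ _; set S := ess_sup_on _ _ _ => H.
have Iub (y : \bar R) : [set y | {ae mu, forall x0, B k x x0 -> (y <= (q x0)%:E)%E}] y ->
    (y <= rp%:E)%E.
  move=> /ae_ball_ex[z [_ yz]]; apply: le_trans yz _.
  by rewrite lee_fin; have /andP[] := qb z.
have Slb (y : \bar R) : [set y | {ae mu, forall x0, B k x x0 -> ((q x0)%:E <= y)%E}] y ->
    (rm%:E <= y)%E.
  move=> /ae_ball_ex[z [_ yz]]; apply: le_trans yz.
  by rewrite lee_fin; have /andP[] := qb z.
have Irp : (I <= rp%:E)%E by apply: ge_ereal_sup => y /Iub.
have Irm : (rm%:E <= I)%E.
  apply: ereal_sup_ubound; apply: aeW => y _.
  by rewrite lee_fin; have /andP[] := qb y.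
have Srm : (rm%:E <= S)%E by apply: le_ereal_inf_tmp => y /Slb.
have Srp : (S <= rp%:E)%E.
  apply: ereal_inf_lbound; apply: aeW => y _.
  by rewrite lee_fin; have /andP[] := qb y.
have Ifin : I \is a fin_num.
  by rewrite fin_numElt (lt_le_trans _ Irm) ?ltNyr// (le_lt_trans Irp)// ltry.
have Sfin : S \is a fin_num.
  by rewrite fin_numElt (lt_le_trans _ Srm) ?ltNyr// (le_lt_trans Srp)// ltry.
pose e : R := ((- k)%:~R)^-1; have k0' : 0 < (- k)%:~R :> R by rewrite ltr0z oppr_gt0.
have e0 : 0 < e by rewrite invr_gt0.
exists (Num.max rm (fine I - e)), (fine S + e); split.
- by rewrite le_max lexx.
- move: H; rewrite -(fineK Ifin) -(fineK Sfin) -EFinB -EFinM lee_fin => H.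
  apply: (@le_trans _ _ ((- k)%:~R * (fine S + e - (fine I - e)))).
    by rewrite ler_wpM2l ?(ltW k0')// lerD2l lerN2 le_max lexx orbT.
  have -> : (- k)%:~R * (fine S + e - (fine I - e)) =
    (k%:~R * (fine I - fine S)) + 2 * ((- k)%:~R * e) by rewrite mulrNz; ring.
  by rewrite divff ?gt_eqF// mulr1 lerD2r.
have [y1 Hy1 ltI] : exists2 y1, {ae mu, forall x0, B k x x0 -> (y1 <= (q x0)%:E)%E} &
    ((fine I - e)%:E < y1)%E.
  have : ((fine I - e)%:E < I)%E by rewrite -{2}(fineK Ifin) lte_fin gtrBl.
  by move=> /ereal_sup_gt[y ? ?]; exists y.
have [y2 Hy2 ltS] : exists2 y2, {ae mu, forall x0, B k x x0 -> ((q x0)%:E <= y2)%E} &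
    (y2 < (fine S + e)%:E)%E.
  have : (S < (fine S + e)%:E)%E by rewrite -{1}(fineK Sfin) lte_fin ltrDl.
  by move=> /ereal_inf_lt[y ? ?]; exists y.
apply: (ae_imp2 Hy1 Hy2) => y H1 H2 xy; apply/andP; split.
  rewrite ge_max; have /andP[-> _] := qb y; rewrite /= -lee_fin.
  exact: le_trans (ltW ltI) (H1 xy).
by rewrite -lee_fin; apply: le_trans (H2 xy) (ltW ltS).
Qed.

(** The Borel representative is truncated to the essential range. Its limit at
    infinity is found as a common point of the intervals [q x - E x, q x + E
    x], with E the decay bound: by the decay condition any two of them meet.
    The local condition is imposed on countably many balls, among which
    every ball of negative level occurs; this turns it into an almost
    everywhere statement. *)
Lemma log_exponent_regular q : log_exponent mu q ->
  exists q0 rm rp ri D, [/\ log_regular mu q0 rm rp ri D,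
    {ae mu, forall x, q x = q0 x}, forall x, rm <= q x <= rp &
    ess_sup mu (EFin \o q) = rp%:E].
Proof.
move=> [eq_ [C [C0 loc dec]]]; have [rm [rp [rm1 infE supE qb]]] := exponent_bounds eq_.
have [[g mg qg] _ _ _] := eq_.
have rmp : rm <= rp by have /andP[/le_trans] := qb 0; apply.
pose q0 x := Num.max rm (Num.min rp (g x)).
have qq0 : {ae mu, forall x, q x = q0 x}.
  apply: ae_imp qg _ => x qgx; rewrite /q0 -qgx.
  by have /andP[h1 h2] := qb x; rewrite (min_r h2) (max_r h1).
have q0b x : rm <= q0 x <= rp.
  by rewrite le_max lexx/= ge_max rmp ge_min lexx.
have lnp0 : 0 < ln (p%:R : R) by rewrite ln_gt0// p_gt1.
pose E x := C * ln p%:R / ln (p%:R + norm x).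
have lnL x : 0 < ln (p%:R + norm x).
  rewrite ln_gt0// (lt_le_trans (p_gt1 R p_prime))// lerDl; exact: Qpn_norm_ge0.
have E0 x : 0 <= E x by rewrite !mulr_ge0 ?invr_ge0 ?ltW.
have qE x y : norm x <= norm y -> `|q x - q y| <= E x.
  move=> xy; apply: le_trans (dec x y) _; rewrite (min_l xy) /E.
  by rewrite invf_div mulrA.
have qEE x y : q x - E x <= q y + E y.
  apply: dist_overlap; [exact: E0|exact: E0|].
  by have [xy|/ltW yx] := leP (norm x) (norm y); [left|right]; exact: qE.
pose A := [set q x - E x | x in [set: V]].
have A0 : A !=set0 by exists (q 0 - E 0); exists 0.
have Aub y : ubound A (q y + E y) by move=> _ [x _ <-].
pose ri := Num.max rm (Num.min rp (sup A)).
have qri x : `|q x - ri| <= E x.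
  have s1 : sup A <= q x + E x by exact: ge_sup (Aub x).
  have s2 : q x - E x <= sup A.
    by apply: ub_le_sup; [exists (q x + E x); exact: Aub|exists x].
  by apply: clamp_dist => //; rewrite s1 s2.
(* Every ball of radius p^k is one of the countably many balls B k (rat_center i). *)
have [lo [hi loc']] : exists lo hi : int * nat -> R, forall ki : int * nat, ki.1 < 0 ->
   [/\ rm <= lo ki, (- ki.1)%:~R * (hi ki - lo ki) <= C + 2 &
    {ae mu, forall y, B ki.1 (rat_center p n ki.2) y -> lo ki <= q y <= hi ki}].
  have H (ki : int * nat) : exists lh : R * R, ki.1 < 0 ->
     [/\ rm <= lh.1, (- ki.1)%:~R * (lh.2 - lh.1) <= C + 2 &
      {ae mu, forall y, B ki.1 (rat_center p n ki.2) y -> lh.1 <= q y <= lh.2}].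
    have [k0|k0] := ltP ki.1 0; last by exists (0, 0).
    have [lo [hi ?]] := log_exponent_local qb k0 (loc ki.1 (rat_center p n ki.2)).
    by exists (lo, hi).
  exists (fun ki => (projT1 (cid (H ki))).1), (fun ki => (projT1 (cid (H ki))).2).
  by move=> ki; case: cid.
exists q0, rm, rp, ri, (C * ln p%:R + (C + 2)).
split; [|exact: qq0|exact: qb|exact: supE].
split; [| |exact: q0b| |].
- apply: measurable_maxr; first exact: measurable_cst.
  by apply: measurable_minr => //; exact: measurable_cst.
- split=> //; apply/andP; split; first by rewrite /ri le_max lexx.
  by rewrite /ri ge_max rmp ge_min lexx.
- apply: ae_imp qq0 _ => x <-.
  apply: (@le_trans _ _ (E x * ln (p%:R + norm x))); first by rewrite ler_wpM2r// ltW.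
  rewrite /E divfK ?gt_eqF// lerDl; lra.
have Hloc : {ae mu, forall x, forall ki : int * nat, ki.1 < 0 ->
    B ki.1 (rat_center p n ki.2) x -> lo ki <= q x <= hi ki}.
  apply: ae_countable => ki; have [k0|k0] := ltP ki.1 0; last exact: aeW.
  by have [_ _ H] := loc' ki k0; apply: ae_imp H _.
apply: (ae_imp2 Hloc qq0) => x Hx qx k k0.
have [i _ ix] : (\bigcup_i B k (rat_center p n i)) x by rewrite rat_center_cover.
have [rmlo hilo H] := loc' (k, i) k0.
exists (lo (k, i)); split; first exact: rmlo.
- apply: (@le_trans _ _ (C + 2)).
    apply: le_trans hilo; apply: ler_wpM2l; first by rewrite ler0z oppr_ge0 ltW.
    by rewrite lerD2r -qx; have /andP[] := Hx (k, i) k0 ix.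
  by rewrite lerDr mulr_ge0// ltW.
- have E1 : B k x = B k (rat_center p n i) by exact: Qball_eq.
  rewrite E1; apply: (ae_imp2 H qq0) => y Hy <- iy.
  by have /andP[] := Hy iy.
Qed.

End LogExponents.

(** * Norms with variable exponents *)

Section VariableNorms.
Context (R : realType) (p n : nat) (p_prime : prime p).
Variable mu : {measure set (Qpn R p n) -> \bar R}.
Hypothesis mu_haar : is_haar mu.
Local Notation V := 'rV[Qp p]_n.
Local Notation B := (@Qpn_ball R p n).
Local Notation T := (Qpn R p n).
Local Notation vol := (vol R p n).
Local Notation avg := (avg mu).
Local Notation frac_max := (frac_max mu).
Local Notation ball_integrable := (ball_integrable mu).
Local Notation modular := (modular mu).
Local Notation var_norm := (var_norm mu).
Implicit Types (q r : V -> R) (k : int) (x y : V) (f g : V -> \bar R) (c eta : R).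

Lemma modular_ge0 q f eta : (0 <= modular q f eta)%E.
Proof. by apply: integral_ge0 => x _; exact: poweR_ge0. Qed.

Lemma le_poweR (u v : \bar R) c : 0 <= c -> (0 <= u)%E -> (u <= v)%E ->
  (u `^ c <= v `^ c)%E.
Proof.
move=> c0 u0 uv; apply: gt0_ler_poweR => //.
  by rewrite in_itv/= leey andbT.
by rewrite in_itv/= leey andbT (le_trans u0).
Qed.

Lemma modular_le q f g c eta : 0 < c -> 0 < eta -> (forall x, 0 <= q x) ->
  {ae mu, forall x, (`|f x| <= c%:E * `|g x|)%E} ->
  (modular q f (c * eta)%R <= modular q g eta)%E.
Proof.
move=> c0 e0 q0 fg; apply: ge0_le_integral_ae => [x _|x _|].
- exact: poweR_ge0.
- exact: poweR_ge0.
apply: ae_imp fg _ => x fgx _; apply: le_poweR; first exact: q0.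
  by rewrite mule_ge0// lee_fin invr_ge0 mulr_ge0// ltW.
apply: (@le_trans _ _ (c%:E * `|g x| * ((c * eta)^-1)%:E)%E).
  by rewrite lee_wpmul2r// lee_fin invr_ge0 mulr_ge0// ltW.
rewrite [(c%:E * _)%E]muleC -muleA -EFinM invfM mulrA divff ?gt_eqF// mul1r.
exact: lexx.
Qed.

(** Since q >= 1 and 1/c <= 1, the factor (1/c)^q is at most 1/c. *)
Lemma modular_scale q f c eta : 1 <= c -> 0 < eta -> (forall x, 1 <= q x) ->
  (modular q f (c * eta)%R <= (c^-1)%:E * modular q f eta)%E.
Proof.
move=> c1 e0 q1; have c0 : 0 < c by exact: lt_le_trans c1.
have ci0 : 0 <= c^-1 by rewrite invr_ge0 ltW.
have ei0 : 0 <= eta^-1 by rewrite invr_ge0 ltW.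
have ci : 0 < c^-1 by rewrite invr_gt0.
have F0 x : (0 <= (`|f x| * (eta^-1)%:E) `^ q x)%E by exact: poweR_ge0.
apply: le_trans (ge0_integralZl_le mu ci F0).
apply: ge0_le_integral_all => x _; first exact: poweR_ge0.
have -> : (`|f x| * ((c * eta)^-1)%:E = (c^-1)%:E * (`|f x| * (eta^-1)%:E))%E.
  by rewrite invfM EFinM muleCA.
rewrite poweRM ?mule_ge0 ?lee_fin//; apply: lee_wpmul2r; first exact: poweR_ge0.
rewrite poweR_EFin lee_fin.
rewrite -[leRHS]powRr1//; apply: powR_anti => //.
by rewrite ci0 invf_le1.
Qed.

Lemma modular_le1 q f c eta : 0 < eta -> (forall x, 1 <= q x) -> 1 <= c ->
  (modular q f eta <= c%:E)%E -> (modular q f (c * eta)%R <= 1)%E.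
Proof.
move=> e0 q1 c1 H; have c0 : 0 < c by exact: lt_le_trans c1.
apply: le_trans (modular_scale _ c1 e0 q1) _.
by rewrite lee_pdivrMl// mule1.
Qed.

Lemma var_norm_le q f eta : 0 < eta -> (modular q f eta <= 1)%E ->
  (var_norm q f <= eta%:E)%E.
Proof. by move=> e0 H; apply: ereal_inf_lbound; exists eta. Qed.

Lemma var_norm_ge0 q f : (0 <= var_norm q f)%E.
Proof. by apply: le_ereal_inf_tmp => _ [e [e0 _] <-]; rewrite lee_fin ltW. Qed.

(** All comparisons of norms go through this criterion on the unit balls of the
    modulars. *)
Lemma var_norm_transfer q r f g c : 0 < c ->
  (forall eta, 0 < eta -> (modular r g eta <= 1)%E ->
     (modular q f (c * eta)%R <= 1)%E) ->
  (var_norm q f <= c%:E * var_norm r g)%E.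
Proof.
move=> c0 H; rewrite -lee_pdivrMl//; apply: le_ereal_inf_tmp => _ [e [e0 He] <-].
rewrite lee_pdivrMl// -EFinM; apply: var_norm_le; first exact: mulr_gt0.
exact: H.
Qed.

Lemma var_norm_ae_le q f g c : 0 < c -> (forall x, 0 <= q x) ->
  {ae mu, forall x, (`|f x| <= c%:E * `|g x|)%E} ->
  (var_norm q f <= c%:E * var_norm q g)%E.
Proof.
move=> c0 q0 fg; apply: var_norm_transfer => // e e0.
by apply: le_trans; exact: modular_le.
Qed.

Definition chi k x y : \bar R := (\1_(B k x) y)%:E.

Lemma chiE k x y : chi k x y = ((y \in B k x)%:R)%:E.
Proof. by rewrite /chi indicE. Qed.

Lemma chi_le1 k x y : (0 <= chi k x y <= 1)%E.
Proof. by rewrite chiE lee_fin ler0n /= lee_fin; case: (_ \in _). Qed.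

Lemma integral_chi k x : (\int[mu]_y chi k x y = (vol k)%:E)%E.
Proof.
rewrite integral_indic; [|exact: measurableT|exact: measurable_Qball].
by rewrite setIT (mu_ball p_prime mu_haar).
Qed.

Lemma var_norm_chi_ub q k x : (forall y, 1 <= q y) ->
  (var_norm q (chi k x) <= (Num.max 1 (vol k))%:E)%E.
Proof.
move=> q1; set M := Num.max 1 (vol k).
have M1 : 1 <= M by rewrite le_max lexx.
have Mv : vol k <= M by rewrite le_max lexx orbT.
have M0 : 0 < M by exact: lt_le_trans M1.
apply: var_norm_le => //.
rewrite -[M]mulr1; apply: modular_le1 => //.
apply: (@le_trans _ _ (vol k)%:E); last by rewrite lee_fin.
rewrite -(integral_chi k x); apply: ge0_le_integral_all => y _; first exact: poweR_ge0.
rewrite invr1 mule1 chiE; case: (_ \in _).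
  by rewrite abse1 poweR1r.
by rewrite abse0 poweR0r// gt_eqF// (lt_le_trans _ (q1 y)).
Qed.

Lemma var_norm_chi_lb q k x : (forall y, 1 <= q y) ->
  ((Num.min 1 (vol k))%:E <= var_norm q (chi k x))%E.
Proof.
move=> q1; apply: le_ereal_inf_tmp => _ [e [e0 He] <-]; rewrite lee_fin ge_min.
have [//|e1] := leP 1 e; rewrite /=.
have ei0 : 0 < e^-1 by rewrite invr_gt0.
have : ((e^-1)%:E * (vol k)%:E <= 1)%E.
  apply: le_trans He; rewrite -(integral_chi k x).
  have chi0 y : (0 <= chi k x y)%E by have /andP[] := chi_le1 k x y.
  rewrite -ge0_integralZl//; last 2 first.
  - by apply/measurable_EFinP/measurable_indic; exact: measurable_Qball.
  - by rewrite lee_fin ltW.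
  apply: ge0_le_integral_all => y _.
    by rewrite mule_ge0 ?lee_fin ?(ltW ei0).
  rewrite chiE; case: (_ \in _); last by rewrite mule0 poweR_ge0.
  rewrite mule1 abse1 mul1e poweR_EFin lee_fin.
  by apply: le1r_powR => //; rewrite invf_ge1// ltW.
by rewrite lee_pdivrMl// mule1 lee_fin.
Qed.

Lemma var_norm_chi_real q k x : (forall y, 1 <= q y) ->
  exists2 nu : R, 0 < nu & var_norm q (chi k x) = nu%:E.
Proof.
move=> q1; have ub := var_norm_chi_ub k x q1; have lb := var_norm_chi_lb k x q1.
have m0 : 0 < Num.min 1 (vol k) by rewrite lt_min ltr01 vol_gt0.
have vfin : var_norm q (chi k x) \is a fin_num.
  rewrite fin_numElt (lt_le_trans _ lb) ?ltNyr//=.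
  by rewrite (le_lt_trans ub)// ltry.
exists (fine (var_norm q (chi k x))); last by rewrite fineK.
by rewrite -lte_fin fineK//; apply: lt_le_trans lb; rewrite lte_fin.
Qed.

(** Young's inequality with exponents t / s and 1 / (alpha s), which are
    conjugate because 1/s = 1/t + alpha. *)
Lemma young_sobolev (a b s t alpha : R) : 0 <= a -> 0 < b -> 0 < s -> 0 < t -> 0 < alpha ->
  t^-1 = s^-1 - alpha -> (a * (b `^ alpha)) `^ s <= a `^ t + b.
Proof.
move=> a0 b0 s0 t0 al0 ts.
have st : s <= t by rewrite -lef_pV2 ?posrE// ts gerBl ltW.
have tE : t^-1 + alpha = s^-1 by rewrite ts subrK.
have c0 : 0 < t / s by rewrite divr_gt0.
have d0 : 0 < (alpha * s)^-1 by rewrite invr_gt0 mulr_gt0.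
have cd : (t / s)^-1 + (alpha * s)^-1^-1 = 1.
  rewrite invrK invf_div -[X in _ + X]mulrC -mulrDr tE divff//.
  by rewrite gt_eqF.
have := conjugate_powR (powR_ge0 a s) (powR_ge0 (b `^ alpha) s) c0 d0 cd.
rewrite -powRM ?powR_ge0// => /le_trans; apply.
have E1 : (a `^ s) `^ (t / s) = a `^ t.
  by rewrite -powRrM mulrCA divff ?mulr1// gt_eqF.
have E2 : ((b `^ alpha) `^ s) `^ (alpha * s)^-1 = b.
  rewrite -[(b `^ alpha) `^ s]powRrM -powRrM divff ?powRr1 ?(ltW b0)//.
  by rewrite gt_eqF// mulr_gt0.
rewrite E1 E2; apply: lerD.
  rewrite invf_div; apply: ler_piMr; first exact: powR_ge0.
  by rewrite ler_pdivrMr// mul1r.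
rewrite invrK; apply: ler_piMr; first exact: ltW.
rewrite -(ler_pM2r (_ : 0 < s^-1)) ?invr_gt0// mulfK ?gt_eqF// mul1r -tE lerDr.
by rewrite invr_ge0 ltW.
Qed.

(** Let e be a value at which the modular of chi for q is at most 1. Young's
    inequality with the exponents r(y) and q(y), at each point y of the ball
    of measure v, bounds (e v^alpha)^(- r) by e^(- q) + 1/v, whose integral
    over the ball is at most 2. *)
Lemma var_norm_chi_sobolev r q k x alpha : haar_measurable mu q -> 0 < alpha ->
  (forall y, 1 <= r y) -> (forall y, 1 <= q y) ->
  (forall y, (q y)^-1 = (r y)^-1 - alpha) ->
  (var_norm r (chi k x) <= (2 * vol k `^ alpha)%:E * var_norm q (chi k x))%E.
Proof.
move=> [q0 mq0 qq0] al0 r1 q1 qr.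
have v0 := vol_gt0 R n p_prime k; have va0 : 0 < vol k `^ alpha by rewrite powR_gt0.
apply: var_norm_transfer; first by rewrite mulr_gt0.
move=> e e0 He; rewrite -mulrA; apply: modular_le1 => //; first by rewrite mulr_gt0.
  by rewrite ler1n.
pose q1' y := Num.max 1 (q0 y).
have mq1 : measurable_fun [set: T] (q1' : T -> R).
  by apply: measurable_maxr => //; exact: measurable_cst.
have qq1 : {ae mu, forall y, q y = q1' y}.
  by apply: ae_imp qq0 _ => y qy; rewrite /q1' -qy max_r.
pose i y : R := (y \in B k x)%:R.
have mi : measurable_fun [set: T] (i : T -> R).
  rewrite (_ : i = \1_(B k x)); last by apply/funext => y; rewrite indicE.
  by apply: measurable_indic; exact: measurable_Qball.
have i0 y : 0 <= i y by rewrite /i ler0n.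
have ei0 : 0 <= e^-1 by rewrite invr_ge0 ltW.
have chi_abs y : `|chi k x y|%E = (i y)%:E by rewrite chiE -/(i y) gee0_abs ?lee_fin.
have q_gt0 y : 0 < q y by exact: lt_le_trans (q1 y).
have r_gt0 y : 0 < r y by exact: lt_le_trans (r1 y).
have vi : (vol k `^ alpha)^-1 = (vol k)^-1 `^ alpha.
  by rewrite -powR_inv1 ?powR_ge0// -powRrM mulrC powRrM powR_inv1 ?(ltW v0).
apply: (@le_trans _ _ (\int[mu]_y ((i y / e) `^ q1' y + (vol k)^-1 * i y)%:E)%E).
  apply: ge0_le_integral_ae => [y _|y _|]; first exact: poweR_ge0.
    by rewrite lee_fin addr_ge0 ?powR_ge0// mulr_ge0// invr_ge0 ltW.
  apply: ae_imp qq1 _ => y qy _; rewrite chi_abs.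
  rewrite -EFinM poweR_EFin lee_fin -qy /i; case: (_ \in _); last first.
    by rewrite !mul0r mulr0 addr0 !powR0// gt_eqF// ?q_gt0 ?r_gt0.
  rewrite !mul1r mulr1 invfM vi [X in X `^ _]mulrC; apply: young_sobolev => //.
  by rewrite invr_gt0.
rewrite ge0_integralD_real//.
- rewrite ge0_integralZl_real//; last by rewrite invr_ge0 ltW.
  rewrite (_ : 2%:E = 1 + 1)%E//; apply: leeD.
    apply: le_trans He; apply: ge0_le_integral_ae => [y _|y _|].
    + by rewrite lee_fin powR_ge0.
    + exact: poweR_ge0.
    + apply: ae_imp qq1 _ => y qy _.
      by rewrite chi_abs -EFinM poweR_EFin qy.
  rewrite lee_pdivrMl// mule1 -(integral_chi k x).
  by apply: ge0_le_integral_all => y _; rewrite ?chiE lee_fin.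
- by move=> y; exact: powR_ge0.
- by move=> y; rewrite mulr_ge0// invr_ge0 ltW.
- apply: measurable_fun_powR2 => //.
  + by move=> y; rewrite gt_eqF// /q1' lt_max ltr01.
  + by apply: measurable_funM => //; exact: measurable_cst.
- by apply: measurable_funM => //; exact: measurable_cst.
Qed.

Lemma modular_EFin r (f : V -> R) eta : 0 < eta -> (forall x, 0 <= f x) ->
  (modular r (EFin \o f) eta = \int[mu]_x ((eta^-1 * f x) `^ r x)%:E)%E.
Proof.
move=> e0 f0; apply: eq_integral => x _.
by rewrite [(EFin \o f) x]/= gee0_abs ?lee_fin// -EFinM poweR_EFin mulrC.
Qed.

(** Homogeneity: the modular estimate is applied to f / eta, and its constant is
    absorbed in the scaling factor since q >= 1. *)
Theorem fractional_maximal_norm r q alpha : log_exponent mu r -> 0 <= alpha ->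
  (forall rp, ess_sup mu (EFin \o r) = rp%:E -> alpha * rp < 1) ->
  (forall x, q x = r x / (1 - alpha * r x)) ->
  exists2 K : R, 1 <= K & forall (f : V -> R) eta,
    measurable_fun [set: T] (f : T -> R) -> (forall x, 0 <= f x) -> 0 < eta ->
    (modular r (EFin \o f) eta <= 1)%E ->
    ball_integrable f /\ (modular q (frac_max alpha f) (K * eta)%R <= 1)%E.
Proof.
move=> lr al0 alr qE.
have [r0 [rm [rp [ri [D [reg rr0 rb supE]]]]]] := log_exponent_regular p_prime mu_haar lr.
have alrp := alr _ supE.
have [C C0 HC] := fractional_maximal_modular p_prime mu_haar reg al0 alrp.
have [mr0 [rm1 _] r0b _ _] := reg.
have q1 x : 1 <= q x.
  have /andP[h1 h2] := rb x; rewrite qE.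
  have h3 : alpha * r x <= alpha * rp by rewrite ler_wpM2l.
  have h4 : 0 < r x by lra.
  have h5 : 0 <= alpha * r x by rewrite mulr_ge0// ltW.
  by rewrite ler_pdivlMr; lra.
exists (1 + C); first by rewrite lerDl ltW.
move=> f eta mf f0 e0 f_mod.
have ei0 : 0 <= eta^-1 by rewrite invr_ge0 ltW.
pose g x := eta^-1 * f x.
have g0 x : 0 <= g x by rewrite mulr_ge0.
have mg : measurable_fun [set: T] (g : T -> R).
  by apply: measurable_funM => //; exact: measurable_cst.
have g_mod : (\int[mu]_x (g x `^ r0 x)%:E <= 1)%E.
  apply: le_trans f_mod; rewrite modular_EFin//.
  apply: ge0_le_integral_ae => [x _|x _|]; rewrite ?lee_fin ?powR_ge0//.
  by apply: ae_imp rr0 _ => x rx _; rewrite rx.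
have r01 x : 1 <= r0 x by have /andP[h _] := r0b x; apply: le_trans h; exact: ltW.
have gi : ball_integrable g.
  by apply: (ball_integrable_modular p_prime mu_haar mg mr0 g0 r01); exact: le_lt_trans g_mod (ltry _).
have fE : f = (fun x => eta * g x + 0).
  by apply/funext => x; rewrite addr0 /g mulrA divff ?mul1r// gt_eqF.
have fi : ball_integrable f.
  by rewrite fE; apply: ball_integrable_affine => //; exact: ltW.
split=> //; apply: modular_le1 => //; first by rewrite lerDl ltW.
apply: (@le_trans _ _ C%:E); last by rewrite lee_fin lerDr.
apply: le_trans (HC g mg g0 g_mod).
apply: ge0_le_integral_ae => [x _|x _|]; [exact: poweR_ge0|exact: poweR_ge0|].
apply: ae_imp rr0 _ => x rx _; rewrite qE rx; apply: le_poweR.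
- have := q1 x; rewrite qE rx; apply: le_trans; exact: ler01.
- by rewrite mule_ge0.
rewrite gee0_abs ?frac_max_ge0// lee_pdivrMr//.
apply: ge_ereal_sup => _ [k _ <-].
apply: (@le_trans _ _ ((vol k `^ alpha * avg g k x)%:E * eta%:E)%E).
  rewrite -EFinM lee_fin {1}fE avg_affine ?addr0//; last exact: ltW.
  by rewrite mulrCA mulrC.
apply: lee_wpmul2r; first by rewrite lee_fin ltW.
by apply: ereal_sup_ubound; exists k.
Qed.

End VariableNorms.

(** * Lipschitz symbols *)

Lemma ler_mul_addr (R : realType) (u v c f : R) : 0 <= f -> u <= v + c ->
  u * f <= v * f + (c * f + 0).
Proof. by move=> f0 uv; rewrite addr0 -mulrDl ler_wpM2r. Qed.

Lemma ler_dist_shift (R : realType) (u v w c : R) : `|u - v| <= c ->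
  `|u - w| <= `|v - w| + c.
Proof.
move=> uv; apply: le_trans (ler_distD v _ _) _.
by rewrite addrC lerD2l.
Qed.

Lemma gap_close (R : realType) (A A' t L F r : R) : 0 <= L -> 0 <= F -> t < A ->
  A <= A' + L * r * F -> r <= (A - t) / (L * F + 1) -> t < A'.
Proof.
move=> L0 F0 tA AA rle; have LF0 : 0 <= L * F by exact: mulr_ge0.
have d0 : 0 < L * F + 1 by rewrite ltr_wpDl.
have At : 0 < A - t by rewrite subr_gt0.
have h1 : L * F * r <= L * F * ((A - t) / (L * F + 1)) by rewrite ler_wpM2l.
have h2 : L * F * ((A - t) / (L * F + 1)) < A - t.
  by rewrite mulrA ltr_pdivrMr// mulrC ltr_pM2l// ltrDl.
rewrite mulrAC in AA; lra.
Qed.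

Section LipschitzCommutator.
Context (R : realType) (p n : nat) (p_prime : prime p) (n_ge1 : (1 <= n)%N).
Variable mu : {measure set (Qpn R p n) -> \bar R}.
Hypothesis mu_haar : is_haar mu.
Variables (beta : R) (beta_gt0 : 0 < beta).
Local Notation V := 'rV[Qp p]_n.
Local Notation B := (@Qpn_ball R p n).
Local Notation T := (Qpn R p n).
Local Notation norm := (@Qpn_norm R p n).
Local Notation vol := (vol R p n).
Local Notation avg := (avg mu).
Local Notation ball_integrable := (ball_integrable mu).
Local Notation var_norm := (var_norm mu).
Local Notation chi := (@chi R p n).
Local Notation alpha := (beta / n%:R).
Implicit Types (q r : V -> R) (k : int) (x y : V) (c eta : R).

Definition radpow k : R := (p%:R ^ k) `^ beta.

Lemma radpow_gt0 k : 0 < radpow k. Proof. by rewrite powR_gt0// pX_gt0. Qed.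

Lemma radpow_ge0 k : 0 <= radpow k. Proof. exact/ltW/radpow_gt0. Qed.

Lemma radpow_mono k l : k <= l -> radpow k <= radpow l.
Proof.
by move=> kl; apply: powR_mono; rewrite ?(pX_ge0 R p_prime) ?(ler_pX R p_prime)// ltW.
Qed.

Lemma radpowD k l : radpow (k + l) = radpow k * radpow l.
Proof.
by rewrite /radpow expfzDr ?gt_eqF ?p_gt0// powRM// pX_ge0.
Qed.

Let n0 : n%:R != 0 :> R. Proof. by rewrite pnatr_eq0 -lt0n. Qed.

Lemma alpha_gt0 : 0 < alpha. Proof. by rewrite divr_gt0// ltr0n. Qed.

Lemma vol_alpha k : vol k `^ alpha = radpow k.
Proof.
rewrite vol_natX// -powRrM (_ : _ * alpha = k%:~R * beta); last by field.
by rewrite powRrM powR_intmul// ltW// p_gt0.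
Qed.

Lemma radpow_small e : 0 < e -> exists2 k : int, k <= 0 & radpow k <= e.
Proof.
move=> e0; have [j ej] := pX_archi p_prime ((e^-1) `^ (beta^-1)).
exists (- j%:Z); first by rewrite oppr_le0.
rewrite /radpow -invr_expz -[leRHS]invrK.
have -> : (p%:R ^ j%:Z)^-1 `^ beta = ((p%:R ^ j%:Z) `^ beta)^-1 :> R.
  by rewrite -powR_inv1 ?pX_ge0// -powRrM mulN1r powRN.
rewrite lef_pV2 ?posrE ?invr_gt0 ?powR_gt0 ?pX_gt0//.
have -> : e^-1 = ((e^-1) `^ (beta^-1)) `^ beta.
  by rewrite -powRrM mulVf ?gt_eqF// powRr1// invr_ge0 ltW.
by apply: powR_mono => //; [exact: powR_ge0|exact: ltW].
Qed.

Definition hoelder_bound (L : R) (h : V -> R) :=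
  forall x y, `|h x - h y| <= L * norm (x - y) `^ beta.

Lemma lipschitz_ball L h k x y : 0 <= L -> hoelder_bound L h -> B k x y ->
  `|h x - h y| <= L * radpow k.
Proof.
move=> L0 hL; rewrite QballE Qpn_normB => xy; apply: le_trans (hL x y) _.
by apply: ler_wpM2l => //; apply: powR_mono => //; [exact: Qpn_norm_ge0|exact: ltW].
Qed.

Lemma lip_space_lipschitz h : lip_space mu beta h ->
  exists2 L : R, 0 < L & hoelder_bound L h.
Proof.
move=> [_ lip]; set N := lip_norm beta h in lip.
exists (`|fine N| + 1); first by rewrite ltr_wpDl.
move=> x y; have [->|xy] := eqVneq x y.
  by rewrite !subrr normr0 mulr_ge0 ?powR_ge0// addr_ge0.
have nxy : 0 < norm (x - y).
  rewrite lt_neqAle Qpn_norm_ge0 andbT eq_sym.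
  apply: contra_neq xy => /Qpn_norm_eq0 /eqP; rewrite subr_eq0 => /eqP.
  exact.
rewrite -ler_pdivrMr ?powR_gt0//.
set t := _ / _.
have tN : (t%:E <= N)%E by apply: ereal_sup_ubound; exists x, y.
have Nfin : N \is a fin_num.
  by rewrite fin_numElt lip andbT; apply: lt_le_trans tN; exact: ltNyr.
rewrite -(fineK Nfin) lee_fin in tN.
by apply: (le_trans tN); apply: (le_trans (ler_norm _)); rewrite lerDl.
Qed.

(** The strict superlevel sets are open. *)
Lemma lipschitz_measurable L h : 0 <= L -> hoelder_bound L h ->
  measurable_fun [set: T] (h : T -> R).
Proof.
move=> L0 hL.
apply: (measurability _ (RGenOInfty.measurableE R)) => _ [_ [a ->] <-].
rewrite setTI; apply: sub_sigma_algebra => x /=; rewrite in_itv/= andbT => ax.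
have d0 : 0 < (h x - a) / (L + 1) by rewrite divr_gt0 ?subr_gt0// ltr_wpDl.
have [k _ kd] := radpow_small d0; exists k => y xy.
rewrite /preimage/= in_itv/= andbT.
have := lipschitz_ball L0 hL xy; rewrite ler_norml => /andP[_ hxy].
have : L * radpow k < h x - a.
  apply: (@lt_le_trans _ _ ((L + 1) * radpow k)); first by rewrite ltr_pM2r ?radpow_gt0// ltrDl.
  by rewrite mulrC -ler_pdivlMr// ltr_wpDl.
by move=> h2; rewrite -subr_gt0; lra.
Qed.

Lemma lipschitz_lip_space L h : 0 <= L -> hoelder_bound L h -> lip_space mu beta h.
Proof.
move=> L0 hL; split.
  by exists h; [exact: lipschitz_measurable hL|exact: aeW].
apply: (@le_lt_trans _ _ L%:E); last exact: ltry.
apply: ge_ereal_sup => _ [x [y [xy ->]]]; rewrite lee_fin.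
have [->|d0] := eqVneq (norm (x - y) `^ beta) 0; first by rewrite invr0 mulr0.
by rewrite ler_pdivrMr// lt_neqAle eq_sym d0 powR_ge0.
Qed.

Section Symbol.
Variables (b b0 : V -> R).
Hypotheses (mb0 : measurable_fun [set: T] (b0 : T -> R))
  (bb0 : {ae mu, forall x, b x = b0 x})
  (b0i : ball_integrable (fun x => `|b0 x|)).

Lemma ball_integrable_dist c : ball_integrable (fun y => `|c - b0 y|).
Proof.
have H := ball_integrable_affine p_prime mu_haar ler01 (normr_ge0 c) b0i.
apply: ball_integrable_le H => [|y].
  apply: measurableT_comp; first exact: normr_measurable.
  by apply: measurable_funB => //; exact: measurable_cst.
by rewrite normr_ge0 mul1r [leRHS]addrC ler_normB.
Qed.

(** The triangle inequality for the integral of c - b, expressed with the Borel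
    representative b0. *)
Lemma ball_avg_dist c k x :
  `|c - ball_avg mu b k x| <= avg (fun y => `|c - b0 y|) k x.
Proof.
have mB : measurable (B k x : set T) := measurable_Qball k x.
have E1 : (\int[mu]_(y in B k x) b y)%R = (\int[mu]_(y in B k x) b0 y)%R.
  rewrite /Rintegral integralE [in RHS]integralE; congr (fine (_ - _)%E).
    apply: ge0_eq_integral_ae => //; apply: ae_imp bb0 _ => y bby _.
    by rewrite !funeposE bby.
  apply: ge0_eq_integral_ae => //; apply: ae_imp bb0 _ => y bby _.
  by rewrite !funenegE bby.
have ib0 : mu.-integrable (B k x) (EFin \o b0).
  apply/integrableP; split; first by apply/measurable_funTS/measurable_EFinP.
  by have [_ _ /(_ k x)] := b0i.
have ic : mu.-integrable (B k x) (EFin \o (fun=> c)).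
  apply/integrableP; split; first exact: measurable_cst.
  by rewrite integral_cst// (mu_ball p_prime mu_haar) -EFinM ltry.
have v0 := vol_gt0 R n p_prime k.
have fB : fine (mu (B k x)) = vol k by rewrite (mu_ball p_prime mu_haar).
have cE : c = (vol k)^-1 * (\int[mu]_(y in B k x) c)%R.
  by rewrite Rintegral_cst// fB mulrCA mulVf ?mulr1// gt_eqF.
rewrite /ball_avg fB E1 {1}cE -mulrBr -RintegralB// normrM ger0_norm ?invr_ge0 ?(ltW v0)//.
have icb : mu.-integrable (B k x) (EFin \o (fun y => c - b0 y)).
  have := integrableB mB ic ib0; apply: eq_integrable => // y _.
rewrite -ler_pdivlMl ?invr_gt0// invrK.
apply: le_trans (le_normr_Rintegral mB icb) _.
rewrite /Rintegral (avgE p_prime k x (ball_integrable_dist c)).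
by [].
Qed.

End Symbol.

Lemma avg_le_const f k x c : ball_integrable f -> 0 <= c ->
  (forall y, B k x y -> f y <= c) -> avg f k x <= c.
Proof.
move=> fi c0 fc; have [_ f0 _] := fi.
have -> : c = avg (fun y => 0 * f y + c) k x by rewrite avg_affine// mul0r add0r.
apply: avg_le => //; first exact: ball_integrable_affine.
by apply: aeW => y xy; rewrite mul0r add0r fc.
Qed.

Lemma loc_integrable_ae (b b0 : V -> R) : loc_integrable mu b ->
  measurable_fun [set: T] (b0 : T -> R) -> {ae mu, forall x, b x = b0 x} ->
  ball_integrable (fun x => `|b0 x|).
Proof.
move=> [_ bi] mb0 bb0; split=> [|x|k x].
- by apply: measurableT_comp; first exact: normr_measurable.
- exact: normr_ge0.
- apply: le_lt_trans (bi k x); apply: ge0_le_integral_ae => //.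
  by apply: ae_imp bb0 _ => y ->.
Qed.

(** The function whose norm enters the oscillation of b on B_k(x). *)
Definition deviation (b : V -> R) k x y : \bar R :=
  ((b y - ball_avg mu b k x) * \1_(B k x) y)%:E.

Lemma osc_termE (b q : V -> R) k x : (forall y, 1 <= q y) -> exists2 nu : R, 0 < nu &
  var_norm q (chi k x) = nu%:E /\
  ((mu (B k x) `^ alpha)^-1 *
    (var_norm q (fun y => ((b y - ball_avg mu b k x) * \1_(B k x) y)%:E) /
     var_norm q (fun y => (\1_(B k x) y)%:E)) =
  ((radpow k)^-1)%:E * (var_norm q (deviation b k x) * (nu^-1)%:E))%E.
Proof.
move=> q1; have [nu nu0 nuE] := var_norm_chi_real p_prime mu_haar k x q1.
exists nu => //; split=> //.
rewrite (mu_ball p_prime mu_haar) poweR_EFin vol_alpha.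
rewrite -/(chi k x) nuE !inver !gt_eqF//; exact: radpow_gt0.
Qed.

Lemma osc_sup_lty (b q : V -> R) S : (forall y, 1 <= q y) ->
  (forall k x, (var_norm q (deviation b k x) <= (S * radpow k)%:E * var_norm q (chi k x))%E) ->
  (osc_sup mu beta b q < +oo)%E.
Proof.
move=> q1 H; apply: (@le_lt_trans _ _ S%:E); last exact: ltry.
apply: ge_ereal_sup => _ [[k x] _ <-] /=.
have [nu nu0 [nuE ->]] := osc_termE b k x q1.
rewrite lee_pdivrMl ?radpow_gt0// lee_pdivrMr//; apply: le_trans (H k x) _.
by rewrite nuE -!EFinM lee_fin [_ * S]mulrC.
Qed.

Lemma osc_sup_bound (b q : V -> R) : (forall y, 1 <= q y) ->
  (osc_sup mu beta b q < +oo)%E -> exists2 S : R, 0 < S & forall k x,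
  (var_norm q (deviation b k x) <= (S * radpow k)%:E * var_norm q (chi k x))%E.
Proof.
move=> q1 fin; set O := osc_sup mu beta b q in fin.
have H k x : (((radpow k)^-1)%:E * (var_norm q (deviation b k x) *
    ((fine (var_norm q (chi k x)))^-1)%:E) <= O)%E.
  have [nu nu0 [nuE E]] := osc_termE b k x q1.
  by rewrite nuE -E; apply: ereal_sup_ubound; exists (k, x).
have O0 : (0 <= O)%E.
  apply: le_trans (H 0 0); rewrite mule_ge0 ?lee_fin ?invr_ge0 ?radpow_ge0//.
  by rewrite mule_ge0 ?var_norm_ge0// lee_fin invr_ge0 fine_ge0// var_norm_ge0.
have Ofin : O \is a fin_num by rewrite ge0_fin_numE.
exists (fine O + 1); first by rewrite ltr_wpDl// fine_ge0.
move=> k x; have [nu nu0 nuE] := var_norm_chi_real p_prime mu_haar k x q1.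
have := H k x; rewrite nuE/= lee_pdivrMl ?radpow_gt0// lee_pdivrMr// -(fineK Ofin).
move=> /le_trans; apply; rewrite -!EFinM lee_fin [radpow k * _]mulrC.
by rewrite ler_pM2r// ler_pM2r ?radpow_gt0// lerDl.
Qed.

Lemma chi_abs k x y : `|chi k x y|%E = chi k x y.
Proof. by rewrite gee0_abs//; have /andP[] := chi_le1 R k x y. Qed.

Lemma deviation_abs (b : V -> R) k x y :
  (`|deviation b k x y| = `|b y - ball_avg mu b k x|%:E * chi k x y)%E.
Proof. by rewrite /deviation EFinM abseM -/(chi k x y) chi_abs. Qed.

Lemma lipschitz_deviation (b b' q : V -> R) L k x : loc_integrable mu b -> 0 < L ->
  hoelder_bound L b' -> {ae mu, forall x, b x = b' x} -> (forall y, 1 <= q y) ->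
  (var_norm q (deviation b k x) <= (L * radpow k)%:E * var_norm q (chi k x))%E.
Proof.
move=> bl L0 lipb bb' q1; have mb' := lipschitz_measurable (ltW L0) lipb.
have b'i := loc_integrable_ae bl mb' bb'.
apply: var_norm_ae_le; [by rewrite mulr_gt0 ?radpow_gt0|by move=> y; apply: le_trans (q1 y)|].
apply: (ae_imp bb') => y by'; rewrite deviation_abs chi_abs.
rewrite chiE; have [xy|_] := boolP (y \in B k x); last by rewrite !mule0.
rewrite !mule1 lee_fin; apply: le_trans (ball_avg_dist mb' bb' b'i _ _ _) _.
apply: avg_le_const; first exact: ball_integrable_dist.
  by rewrite mulr_ge0 ?radpow_ge0// ltW.
move=> z xz; rewrite by'; apply: (lipschitz_ball (ltW L0) lipb).
by rewrite (Qball_eq (set_mem xy)); exact: xz.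
Qed.

Section CommutatorBound.
Variables (b' f0 : V -> R) (L : R).
Hypotheses (L0 : 0 < L) (lipb : hoelder_bound L b') (f0i : ball_integrable f0).
Let f0_ge0 x : 0 <= f0 x. Proof. by case: f0i. Qed.
Let mf0 : measurable_fun [set: T] (f0 : T -> R). Proof. by case: f0i. Qed.
Let mb' := lipschitz_measurable (ltW L0) lipb.

Lemma ball_integrable_commutator c : ball_integrable (fun y => `|c - b' y| * f0 y).
Proof.
split=> [|y|k x].
- apply: measurable_funM => //; apply: measurableT_comp; first exact: normr_measurable.
  by apply: measurable_funB => //; exact: measurable_cst.
- by rewrite mulr_ge0.
pose C := `|c - b' x| + L * radpow k.
have C0 : 0 <= C by rewrite addr_ge0// mulr_ge0 ?radpow_ge0// ltW.
have [_ _ H] := ball_integrable_affine p_prime mu_haar C0 (lexx 0) f0i.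
apply: le_lt_trans (H k x); apply: ge0_le_integral_all => y xy; rewrite lee_fin.
  by rewrite mulr_ge0.
rewrite addr0 ler_wpM2r//; apply: le_trans (ler_distD (b' x) _ _) _.
by rewrite lerD2l; exact: (lipschitz_ball (ltW L0) lipb xy).
Qed.

(** For a Lipschitz symbol the integrals in the commutator are finite, so that
    it is a supremum of real averages. *)
Lemma commutatorE x : max_commutator mu b' f0 x =
  ereal_sup (range (fun k : int => (avg (fun y => `|b' x - b' y| * f0 y) k x)%:E)).
Proof.
apply: (congr1 (fun F : int -> \bar R => ereal_sup (range F))); apply/funext => k.
have -> : (\int[mu]_(y in B k x) (`|b' x - b' y| * `|f0 y|)%:E =
    \int[mu]_(y in B k x) (`|b' x - b' y| * f0 y)%:E)%E.
  by apply: eq_integral => y _; rewrite (ger0_norm (f0_ge0 y)).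
rewrite (avgE p_prime k x (ball_integrable_commutator (b' x))).
rewrite (mu_ball p_prime mu_haar) inver gt_eqF ?vol_gt0// -EFinM mulKf//.
by rewrite gt_eqF// vol_gt0.
Qed.

Lemma commutator_ge0 x : (0 <= max_commutator mu b' f0 x)%E.
Proof.
rewrite commutatorE; apply: (@le_trans _ _ (avg (fun y => `|b' x - b' y| * f0 y) 0 x)%:E).
  by rewrite lee_fin avg_ge0// => y; rewrite mulr_ge0.
by apply: ereal_sup_ubound; exists 0.
Qed.

Lemma commutator_le x :
  (max_commutator mu b' f0 x <= L%:E * frac_max mu alpha f0 x)%E.
Proof.
rewrite commutatorE; apply: ge_ereal_sup => _ [k _ <-].
apply: (@le_trans _ _ (L%:E * (vol k `^ alpha * avg f0 k x)%:E)%E).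
  have c0 : 0 <= L * radpow k by rewrite mulr_ge0 ?radpow_ge0// ltW.
  rewrite -EFinM lee_fin vol_alpha mulrA.
  have -> : L * radpow k * avg f0 k x = avg (fun y => L * radpow k * f0 y + 0) k x.
    by rewrite avg_affine// addr0.
  apply: avg_le => //.
  - by move=> y; rewrite mulr_ge0.
  - exact: ball_integrable_affine.
  - apply: aeW => y xy; rewrite addr0 ler_wpM2r//.
    exact: (lipschitz_ball (ltW L0) lipb xy).
apply: lee_wpmul2l; first by rewrite lee_fin ltW.
by apply: ereal_sup_ubound; exists k.
Qed.

(** The commutator is lower semicontinuous: if the average at x over B_k exceeds
    t, then at a point y so near that B_k(y) = B_k(x) only the value of the
    symbol changes, by an amount that is small compared with the average of
    f0. *)
Lemma measurable_commutator :
  measurable_fun [set: T] (max_commutator mu b' f0 : T -> \bar R).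
Proof.
apply: (measurability _ (ErealGenOInfty.measurableE R)) => _ [_ [t ->] <-].
rewrite setTI; apply: sub_sigma_algebra => x /=; rewrite in_itv/= andbT commutatorE.
move=> /ereal_sup_gt[_ [k _ <-]]; rewrite lte_fin => tk.
set A := avg (fun y => `|b' x - b' y| * f0 y) k x in tk.
set F := avg f0 k x; have F0 : 0 <= F by exact: avg_ge0.
have d0 : 0 < L * F + 1 by rewrite ltr_wpDl// mulr_ge0// ltW.
have At : 0 < A - t by rewrite subr_gt0.
have [j _ jd] := radpow_small (divr_gt0 At d0).
pose l := Num.min j k; have lk : l <= k by rewrite ge_min lexx orbT.
have lj : l <= j by rewrite ge_min lexx.
have c0 : 0 <= L * radpow l by apply: mulr_ge0; [exact: ltW|exact: radpow_ge0].
have f0l := ball_integrable_affine p_prime mu_haar c0 (lexx 0) f0i.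
exists l => y xy; rewrite /preimage/= in_itv/= andbT commutatorE.
have xyk : B k x y := Qball_le p_prime lk xy.
have bxy : `|b' x - b' y| <= L * radpow l := lipschitz_ball (ltW L0) lipb xy.
apply: (@lt_le_trans _ _ (avg (fun z => `|b' y - b' z| * f0 z) k y)%:E); last first.
  by apply: ereal_sup_ubound; exists k.
rewrite lte_fin; set A' := avg _ _ _.
have A'x : avg (fun z => `|b' y - b' z| * f0 z) k x = A'.
  exact: esym (avg_ball_fun mu _ xyk).
clear xy xyk.
have AA : A <= A' + L * radpow l * F.
  have -> : A' + L * radpow l * F =
      avg (fun z => `|b' y - b' z| * f0 z + (L * radpow l * f0 z + 0)) k x.
    rewrite (avg_add p_prime k x (ball_integrable_commutator (b' y)) f0l).
    by rewrite (avg_affine p_prime mu_haar k x c0 (lexx 0) f0i) addr0 A'x.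
  apply: (avg_le p_prime) => [z| |].
  - by rewrite mulr_ge0.
  - exact: (ball_integrable_add p_prime (ball_integrable_commutator (b' y)) f0l).
  - apply: aeW => z _; apply: ler_mul_addr; first exact: f0_ge0.
    by apply: ler_dist_shift; exact: bxy.
apply: (gap_close (ltW L0) F0 tk AA).
by apply: le_trans jd; exact: radpow_mono.
Qed.

End CommutatorBound.

End LipschitzCommutator.

(** * The equivalent conditions *)

Lemma mul_le_of_le_div (R : realType) (c r e : R) : 0 <= c -> 0 < e ->
  r <= e / (c + 1) -> c * r <= e.
Proof.
move=> c0 e0 rle; have c1 : 0 < c + 1 by rewrite ltr_wpDl.
apply: (@le_trans _ _ (c * (e / (c + 1)))); first by rewrite ler_wpM2l.
by rewrite mulrCA ler_piMr ?(ltW e0)// ler_pdivrMr// mul1r lerDl.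
Qed.

Section Equivalences.
Context (R : realType) (p n : nat) (p_prime : prime p) (n_ge1 : (1 <= n)%N).
Variable mu : {measure set (Qpn R p n) -> \bar R}.
Hypothesis mu_haar : is_haar mu.
Variables (beta : R) (beta_gt0 : 0 < beta).
Local Notation V := 'rV[Qp p]_n.
Local Notation B := (@Qpn_ball R p n).
Local Notation T := (Qpn R p n).
Local Notation vol := (vol R p n).
Local Notation avg := (avg mu).
Local Notation ball_integrable := (ball_integrable mu).
Local Notation modular := (modular mu).
Local Notation var_norm := (var_norm mu).
Local Notation chi := (@chi R p n).
Local Notation alpha := (beta / n%:R).
Local Notation radpow := (@radpow R p beta).
Local Notation hoelder_bound := (@hoelder_bound R p n beta).
Implicit Types (q r : V -> R) (k : int) (x y : V) (c eta : R).

Lemma exponent_gt1 q x : exponent mu q -> 1 < q x.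
Proof. by move=> [_ _ /(_ x) []]. Qed.

Lemma admissible_sobolev r q x : admissible mu beta r q ->
  q x = r x / (1 - alpha * r x).
Proof.
move=> [[er _] [eq_ _] _ _ qr]; have r0 : 0 < r x by apply: lt_trans (exponent_gt1 x er).
rewrite -[LHS]invrK qr.
have -> : (r x)^-1 - alpha = (1 - alpha * r x) / r x.
  by rewrite mulrBl div1r mulfK// gt_eqF.
by rewrite invf_div.
Qed.

Lemma admissible_range r q rp : admissible mu beta r q ->
  ess_sup mu (EFin \o r) = rp%:E -> alpha * rp < 1.
Proof.
move=> [_ _ _ rlt _] E; move: rlt; rewrite E lte_fin => rlt.
have n0 : 0 < n%:R :> R by rewrite ltr0n.
by rewrite mulrC -ltr_pdivlMr ?divr_gt0// invf_div mul1r.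
Qed.

(** The operator ignores changes of b and f on null sets, up to a null set of
    points x, so that M_alpha and the Lipschitz representative apply. *)
Lemma lipschitz_bounded (b b' : V -> R) L r q : 0 < L -> hoelder_bound L b' ->
  {ae mu, forall x, b x = b' x} -> admissible mu beta r q ->
  bounded_operator mu (max_commutator mu b) r q.
Proof.
move=> L0 lipb bb' adm; have [[er _] [eq_ _] _ _ _] := adm.
have r1 x : 1 <= r x by apply/ltW/exponent_gt1.
have q1 x : 1 <= q x by apply/ltW/exponent_gt1.
have al0 : 0 <= alpha by apply/ltW; exact: alpha_gt0.
have [K K1 HK] := fractional_maximal_norm p_prime mu_haar (let: And5 lr _ _ _ _ := adm in lr) al0
  (fun rp => admissible_range adm) (fun x => admissible_sobolev x adm).
have K0 : 0 < K by exact: lt_le_trans K1.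
have LK0 : 0 < L * K by rewrite mulr_gt0.
exists (L * K) => f [[g mg fg] [eta0 e00 f_mod]].
pose f0 x : R := `|fine (g x)|.
have mf0 : measurable_fun [set: T] (f0 : T -> R).
  by apply: measurableT_comp; [exact: normr_measurable|exact: measurableT_comp].
have f0_ge0 x : 0 <= f0 x by exact: normr_ge0.
have ff0 : {ae mu, forall x, `|f x| = f0 x}.
  by apply: (ae_imp fg) => x /= fgx; rewrite /f0 -fgx.
have mod0 eta : 0 < eta -> (modular r (EFin \o f0) eta <= modular r (EFin \o f) eta)%E.
  move=> e0; rewrite -{1}[eta]mul1r; apply: modular_le => //.
    by move=> x; apply: le_trans (r1 x).
  apply: (ae_imp ff0) => x ffx; rewrite mul1e /= lee_fin -ffx.
  by rewrite normr_id.
have comm_eq x : b x = b' x -> max_commutator mu b f x = max_commutator mu b' f0 x.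
  move=> bx; apply: (congr1 (fun F : int -> \bar R => ereal_sup (range F))).
  apply/funext => k; congr (_ * _)%E; apply: ge0_eq_integral_ae => [y _|y _|].
  - by rewrite lee_fin mulr_ge0.
  - by rewrite lee_fin mulr_ge0.
  - apply: (ae_imp2 bb' ff0) => y bby ffy _.
    by rewrite bx bby ffy (ger0_norm (f0_ge0 y)).
have key eta : 0 < eta -> (modular r (EFin \o f) eta <= 1)%E ->
    ball_integrable f0 /\ (modular q (max_commutator mu b f) (L * K * eta)%R <= 1)%E.
  move=> e0 H; have [f0i H2] := HK f0 eta mf0 f0_ge0 e0 (le_trans (mod0 _ e0) H).
  split=> //; rewrite -mulrA; apply: le_trans H2.
  apply: modular_le => //; first by rewrite mulr_gt0.
    by move=> x; apply: le_trans (q1 x).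
  apply: (ae_imp bb') => x bx.
  rewrite (comm_eq x bx) (gee0_abs (commutator_ge0 p_prime mu_haar beta_gt0 L0 lipb f0i x)).
  rewrite gee0_abs ?frac_max_ge0//.
  exact: (commutator_le p_prime n_ge1 mu_haar beta_gt0 L0 lipb f0i x).
split; last first.
  by apply: var_norm_transfer => // eta e0 /(key _ e0)[].
(* A finite modular becomes at most 1 after division by a large constant. *)
pose M : R := Num.max 1 (fine (modular r (EFin \o f) eta0)).
have M1 : 1 <= M by rewrite le_max lexx.
have Me0 : 0 < M * eta0 by rewrite mulr_gt0// (lt_le_trans ltr01).
have f_le1 : (modular r (EFin \o f) (M * eta0)%R <= 1)%E.
  apply: modular_le1 => //.
  rewrite -[leLHS]fineK; first by rewrite lee_fin le_max lexx orbT.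
  by rewrite ge0_fin_numE// modular_ge0.
have [f0i Hq] := key _ Me0 f_le1.
split; last first.
  by exists (L * K * (M * eta0)); [rewrite mulr_gt0|apply: le_lt_trans Hq (ltry _)].
exists (max_commutator mu b' f0).
  exact: (measurable_commutator p_prime mu_haar beta_gt0 L0 lipb f0i).
by apply: (ae_imp bb') => x bx; exact: comm_eq.
Qed.

(** The term of the supremum at radius p^k averages |b y - b| over the ball,
    which is at least the distance from b y to the average of b. *)
Lemma commutator_chi_ge (b b0 : V -> R) k x y : measurable_fun [set: T] (b0 : T -> R) ->
  {ae mu, forall z, b z = b0 z} -> ball_integrable (fun z => `|b0 z|) ->
  (`|deviation mu b k x y| <= 1%:E * `|max_commutator mu b (\1_(B k x)) y|)%E.
Proof.
move=> mb0 bb0 b0i; rewrite mul1e deviation_abs chiE.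
have [/set_mem xy|_] := boolP (y \in B k x); last by rewrite mule0 abse_ge0.
rewrite mule1; have Exy : B k y = B k x by exact: Qball_eq.
have dist_i := ball_integrable_dist p_prime mu_haar mb0 b0i (b y).
have E : ((mu (B k y))^-1 *
    \int[mu]_(z in B k y) (`|b y - b z| * `|\1_(B k x) z|)%:E =
    (avg (fun z => `|b y - b0 z|) k x)%:E)%E.
  rewrite {}Exy; clear xy; rewrite (mu_ball p_prime mu_haar) inver gt_eqF ?vol_gt0//.
  have -> : (\int[mu]_(z in B k x) (`|b y - b z| * `|\1_(B k x) z|)%:E =
      \int[mu]_(z in B k x) (`|b y - b0 z|)%:E)%E.
    apply: ge0_eq_integral_ae => [z _|z _|]; rewrite ?lee_fin ?mulr_ge0//.
    apply: (ae_imp bb0) => z bz xz.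
    by rewrite indicE mem_set// normr1 mulr1 bz.
  rewrite (avgE p_prime k x dist_i) -EFinM mulKf//.
  by rewrite gt_eqF// vol_gt0.
apply: (@le_trans _ _ (avg (fun z => `|b y - b0 z|) k x)%:E).
  by rewrite lee_fin; exact: ball_avg_dist.
rewrite -E; apply: le_trans (lee_abs _).
by apply: ereal_sup_ubound; exists k.
Qed.

Lemma bounded_osc (b : V -> R) r q : loc_integrable mu b -> admissible mu beta r q ->
  bounded_operator mu (max_commutator mu b) r q -> (osc_sup mu beta b q < +oo)%E.
Proof.
move=> bl adm [C HC]; have [[er _] [eq_ _] _ _ qr] := adm.
have r1 x : 1 <= r x by apply/ltW/exponent_gt1.
have q1 x : 1 <= q x by apply/ltW/exponent_gt1.
have [hq _ _ _] := eq_.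
have [[b0 mb0 bb0] _] := bl.
have b0i := loc_integrable_ae bl mb0 bb0.
apply: (@osc_sup_lty _ _ _ p_prime n_ge1 mu mu_haar beta b q (`|C| * 2)) => // k x.
have [nr nr0 nrE] := var_norm_chi_real p_prime mu_haar k x r1.
have Lchi : var_Lebesgue mu r (EFin \o (\1_(B k x) : V -> R)).
  split.
    exists (chi k x); last exact: aeW.
    by apply/measurable_EFinP/measurable_indic; exact: measurable_Qball.
  have : (var_norm r (chi k x) < +oo)%E by rewrite nrE ltry.
  move=> /ereal_inf_lt[_ [e [e0 He] <-] _]; exists e => //.
  exact: le_lt_trans He (ltry _).
have [_ H] := HC _ Lchi.
have chiE' : var_norm r (EFin \o (\1_(B k x) : V -> R)) = var_norm r (chi k x) by [].
rewrite chiE' in H.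
have q0 y : 0 <= q y by apply: le_trans (q1 y).
apply: le_trans (var_norm_ae_le ltr01 q0
  (aeW mu (fun y => commutator_chi_ge k x y mb0 bb0 b0i))) _.
rewrite mul1e; apply: le_trans H _.
apply: (@le_trans _ _ (`|C|%:E * var_norm r (chi k x))%E).
  by rewrite lee_wpmul2r ?var_norm_ge0// lee_fin ler_norm.
have := var_norm_chi_sobolev p_prime mu_haar k x hq (alpha_gt0 n_ge1 beta_gt0) r1 q1 qr.
rewrite vol_alpha; [move=> Hs|exact: p_prime|exact: n_ge1].
have -> : (`|C| * 2 * radpow k)%:E = (`|C|%:E * (2 * radpow k)%:E)%E.
  by rewrite -EFinM mulrA.
rewrite -muleA; by apply: lee_wpmul2l Hs; rewrite lee_fin.
Qed.

Lemma log_exponent_cst c : 1 < c -> log_exponent mu (fun _ : V => c).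
Proof.
move=> c1; have T0 := haar_setT_gt0 mu_haar.
have infE : ess_inf mu (EFin \o (fun _ : T => c)) = c%:E by exact: ess_inf_cstr.
have supE : ess_sup mu (EFin \o (fun _ : T => c)) = c%:E by exact: ess_sup_cstr.
split.
  split; rewrite ?infE ?supE ?lte_fin ?ltry//.
    by exists (fun _ => c); [exact: measurable_cst|exact: aeW].
  by move=> _; split=> //; rewrite lexx.
exists 1; split; [exact: ltr01|move=> k x|move=> x y].
  have -> : ess_inf_on mu (B k x) (fun=> c) = c%:E.
    apply/eqP; rewrite eq_le; apply/andP; split.
      by apply: ge_ereal_sup => y /= /(ae_ball_ex p_prime mu_haar)[z []].
    by apply: ereal_sup_ubound; apply: aeW.
  have -> : ess_sup_on mu (B k x) (fun=> c) = c%:E.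
    apply/eqP; rewrite eq_le; apply/andP; split.
      by apply: ereal_inf_lbound; apply: aeW.
    by apply: le_ereal_inf_tmp => y /= /(ae_ball_ex p_prime mu_haar)[z []].
  by rewrite -EFinB subrr mule0 lee_fin.
rewrite subrr normr0 divr_ge0// divr_ge0// ln_ge0//.
  apply: (le_trans (ltW (p_gt1 R p_prime))); rewrite lerDl le_min.
  by rewrite !Qpn_norm_ge0.
by rewrite ltW// p_gt1.
Qed.

(** Constant exponents. The midpoint of 1 and n / beta is an admissible r,
    because beta < 1 <= n makes this interval nonempty. *)
Lemma admissible_ex : beta < 1 -> exists r q : V -> R, admissible mu beta r q.
Proof.
move=> b1; have n0 : 0 < n%:R :> R by rewrite ltr0n.
have n1 : 1 <= n%:R :> R by rewrite ler1n.
pose u : R := n%:R / beta; have u1 : 1 < u.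
  by rewrite /u ltr_pdivlMr// mul1r (lt_le_trans b1).
pose rho := (1 + u) / 2; have rho1 : 1 < rho by rewrite /rho; lra.
have rhou : rho < u by rewrite /rho; lra.
have rho0 : 0 < rho by exact: lt_trans rho1.
have u0 : 0 < u by exact: lt_trans u1.
pose kap := (rho^-1 - alpha)^-1.
have auE : alpha = u^-1 by rewrite /u invf_div.
have k0 : 0 < rho^-1 - alpha by rewrite subr_gt0 auE ltf_pV2.
have kap1 : 1 < kap.
  rewrite /kap invf_gt1//; apply: (@lt_trans _ _ rho^-1); last by rewrite invf_lt1.
  by rewrite gtrBl auE invr_gt0.
exists (fun=> rho), (fun=> kap).
have lr := log_exponent_cst rho1; have lk := log_exponent_cst kap1.
split=> //; first by case: lr.
  have -> : ess_sup mu (EFin \o (fun _ : T => rho)) = rho%:E.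
    by apply: ess_sup_cstr; exact: haar_setT_gt0.
  by rewrite lte_fin.
by move=> x; rewrite /kap invrK.
Qed.

Section Campanato.
Variables (b b0 : V -> R).
Hypotheses (mb0 : measurable_fun [set: T] (b0 : T -> R))
  (bb0 : {ae mu, forall x, b x = b0 x})
  (b0i : ball_integrable (fun x => `|b0 x|)).
Local Notation m k x := (ball_avg mu b k x).

Let dist_i c := ball_integrable_dist p_prime mu_haar mb0 b0i c.

(** Let c be the mean oscillation on a ball B. Then c chi_B is at most the
    maximal function of |b - b_B| chi_B on B, and the boundedness of the
    maximal function on L^q(.) bounds c |chi_B|_q by the norm of the
    deviation, hence by a multiple of |chi_B|_q. *)
Lemma mean_oscillation q : log_exponent mu q -> (osc_sup mu beta b q < +oo)%E ->
  exists2 A : R, 0 < A & forall k x,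
    avg (fun y => `|m k x - b0 y|) k x <= A * radpow k.
Proof.
move=> lq fin; have [eq_ _] := lq.
have q1 x : 1 <= q x by apply/ltW/exponent_gt1.
have q0 x : 0 <= q x by apply: le_trans (q1 x).
have [S S0 HS] := osc_sup_bound p_prime n_ge1 mu_haar q1 fin.
have [K K1 HK] : exists2 K : R, 1 <= K & forall (f : V -> R) eta,
    measurable_fun [set: T] (f : T -> R) -> (forall x, 0 <= f x) -> 0 < eta ->
    (modular q (EFin \o f) eta <= 1)%E ->
    ball_integrable f /\ (modular q (frac_max mu 0 f) (K * eta)%R <= 1)%E.
  apply: (fractional_maximal_norm p_prime mu_haar lq (lexx 0)) => [rp _|x].
    by rewrite mul0r.
  by rewrite mul0r subr0 divr1.
have K0 : 0 < K by exact: lt_le_trans K1.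
exists (K * S); first by rewrite mulr_gt0.
move=> k x; set c := avg _ k x.
have c_ge0 : 0 <= c by exact: avg_ge0.
have [c0|c0] := ltP 0 c; last first.
  apply: (le_trans c0); rewrite mulr_ge0//; last exact: radpow_ge0.
  by rewrite mulr_ge0// ltW.
pose f0 y := `|m k x - b0 y| * \1_(B k x) y.
have f0_ge0 y : 0 <= f0 y by rewrite mulr_ge0// indicE.
have mi : measurable_fun [set: T] (\1_(B k x) : T -> R).
  by apply: measurable_indic; exact: measurable_Qball.
have mf0 : measurable_fun [set: T] (f0 : T -> R).
  by apply: measurable_funM => //; case: (dist_i (m k x)).
have [nu nu0 nuE] := var_norm_chi_real p_prime mu_haar k x q1.
have key : (var_norm q (chi k x) <= (c^-1 * K)%:E * var_norm q (deviation mu b k x))%E.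
  apply: var_norm_transfer => [|eta e0 He]; first by rewrite mulr_gt0 ?invr_gt0.
  have f0_mod : (modular q (EFin \o f0) eta <= 1)%E.
    apply: le_trans He; rewrite -{1}[eta]mul1r; apply: modular_le => //.
    apply: (ae_imp bb0) => y by0.
    rewrite deviation_abs /= mul1e ger0_norm// /f0 EFinM by0 distrC.
    by rewrite /chi.
  have [f0i H] := HK f0 eta mf0 f0_ge0 e0 f0_mod.
  rewrite -mulrA; apply: le_trans H; apply: modular_le => //.
  - by rewrite invr_gt0.
  - by rewrite mulr_gt0.
  apply: aeW => y; rewrite chi_abs chiE.
  have [/set_mem xy|_] := boolP (y \in B k x); last first.
    by rewrite mule_ge0 ?abse_ge0// lee_fin invr_ge0.
  rewrite gee0_abs ?frac_max_ge0// -[leLHS]mule1 -lee_pdivrMl ?invr_gt0// invrK mul1e mule1.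
  apply: (@le_trans _ _ (vol k `^ 0 * avg f0 k y)%:E); last first.
    by apply: ereal_sup_ubound; exists k.
  rewrite lee_fin powRr0 mul1r (avg_ball_fun mu f0 xy).
  apply: (avg_le p_prime) => //; apply: aeW => z xz.
  by rewrite /f0 indicE mem_set// mulr1.
have cK0 : (0 <= (c^-1 * K)%:E)%E by rewrite lee_fin mulr_ge0 ?invr_ge0// ltW.
have := le_trans key (lee_wpmul2l cK0 (HS k x)).
rewrite nuE -!EFinM lee_fin -[leLHS]mul1r !mulrA ler_pM2r// => H.
by rewrite -[leLHS]mulr1 -ler_pdivlMl// !mulrA.
Qed.

Section MeanOscillation.
Variable A : R.
Hypotheses (A0 : 0 < A)
  (Aosc : forall k x, avg (fun y => `|m k x - b0 y|) k x <= A * radpow k).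

Lemma ball_avg_ball_fun k x y : B k x y -> m k y = m k x.
Proof. by move=> xy; rewrite /ball_avg (Qball_eq xy). Qed.

Lemma avg_pred f k x : ball_integrable f -> avg f (k - 1) x <= p%:R ^+ n * avg f k x.
Proof.
move=> fi; have [mf f0 _] := fi; have v0 := vol_gt0 R n p_prime (k - 1).
rewrite -(ler_pM2l v0).
have -> : vol (k - 1) * (p%:R ^+ n * avg f k x) = vol k * avg f k x.
  by rewrite (vol_pred R n p_prime k) [RHS]mulrAC [RHS]mulrC.
rewrite -lee_fin -!avgE//; apply: ge0_subset_integral.
- exact: measurable_Qball.
- exact: measurable_Qball.
- by apply/measurable_funTS/measurable_EFinP.
- by move=> y _; rewrite lee_fin.
- by apply: Qball_le => //; rewrite gerBl.
Qed.

Let rho := radpow (- 1).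
Let rho0 : 0 < rho. Proof. exact: radpow_gt0. Qed.
Let rho1 : rho < 1.
Proof.
rewrite /rho /radpow -invr_expz expr1z.
have p1 := p_gt1 R p_prime; have p0 := p_gt0 R p_prime.
have E1 : 1 `^ beta = 1 :> R by rewrite powR1.
rewrite -[ltRHS]E1; apply: gt0_ltr_powR => //; rewrite ?nnegrE ?invr_ge0 ?(ltW p0)//.
by rewrite invf_lt1.
Qed.
Let radpow_pred k : radpow (k - 1) = rho * radpow k.
Proof. by rewrite radpowD// mulrC. Qed.
Let radpow_split k : radpow k = radpow 1 * radpow (k - 1).
Proof. by rewrite -radpowD; [rewrite addrC subrK|exact: p_prime]. Qed.
Let A' := p%:R ^+ n * A / (1 - rho).
Let A'0 : 0 <= A'.
Proof.
apply: divr_ge0; last by rewrite subr_ge0 ltW.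
by apply: mulr_ge0; [rewrite exprn_ge0// ler0n|exact: ltW].
Qed.

Let m_step k x : `|m k x - m (k - 1) x| <= A' * (radpow k - radpow (k - 1)).
Proof.
have -> : A' * (radpow k - radpow (k - 1)) = p%:R ^+ n * (A * radpow k).
  have rho10 : 1 - rho != 0 by rewrite gt_eqF// subr_gt0.
  rewrite radpow_pred /A'; move: (radpow k) => z; move: rho10; clearbody rho.
  by move=> rho10; field.
apply: le_trans (ball_avg_dist p_prime mu_haar mb0 bb0 b0i _ _ _) _.
apply: le_trans (avg_pred k x (dist_i (m k x))) _.
by rewrite ler_wpM2l// exprn_ge0// ler0n.
Qed.

Let m_telescope k x (j : nat) :
  `|m k x - m (k - j%:Z) x| <= A' * (radpow k - radpow (k - j%:Z)).
Proof.
elim: j => [|j IH]; first by rewrite subr0 !subrr normr0 mulr0.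
have kj : k - j.+1%:Z = k - j%:Z - 1 by rewrite -addrA -opprD -PoszD addn1.
have := m_step (k - j%:Z) x; rewrite -kj => H.
apply: le_trans (ler_distD (m (k - j%:Z) x) _ _) _.
have -> : radpow k - radpow (k - j.+1%:Z) =
  (radpow k - radpow (k - j%:Z)) + (radpow (k - j%:Z) - radpow (k - j.+1%:Z)).
  by rewrite addrA subrK.
by rewrite mulrDr lerD.
Qed.

Let m_dist k l x : l <= k -> `|m k x - m l x| <= A' * radpow k.
Proof.
move=> lk; have E : l = k - (absz (k - l))%:Z.
  by rewrite gez0_abs ?subr_ge0// subKr.
rewrite E; apply: le_trans (m_telescope _ _ _) _.
by rewrite ler_wpM2l// gerBl radpow_ge0.
Qed.

(** The averages over the balls around x lie at distance at most A' p^(k beta)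
    from their limit. The supremum of the lower ends of these intervals is
    this limit. *)
Definition campanato_rep x : R := sup (range (fun k : int => m k x - A' * radpow k)).

Let rep_dist k x : `|campanato_rep x - m k x| <= A' * radpow k.
Proof.
have Ar l : 0 <= A' * radpow l by rewrite mulr_ge0// radpow_ge0.
have H l l' : m l x - A' * radpow l <= m l' x + A' * radpow l'.
  apply: dist_overlap; [exact: Ar|exact: Ar|].
  by have [ll|/ltW ll] := leP l' l; [left|right]; exact: m_dist.
rewrite ler_distl; apply/andP; split.
  apply: ub_le_sup; last by exists k.
  by exists (m k x + A' * radpow k) => _ [l _ <-].
apply: ge_sup; first by exists (m k x - A' * radpow k); exists k.
by move=> _ [l _ <-].
Qed.

Let L0 : 0 <= 2 * A' * radpow 1.
Proof.
by apply: mulr_ge0; [apply: mulr_ge0; [|exact: A'0]|exact: radpow_ge0].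
Qed.

(** If |x - y| = p^k, then B_k(x) = B_k(y): the values at x and y are both close
    to the same average. *)
Lemma campanato_hoelder : hoelder_bound (2 * A' * radpow 1) campanato_rep.
Proof.
move=> x y; have [->|xy] := eqVneq x y.
  by rewrite !subrr normr0 mulr_ge0 ?powR_ge0.
have xy0 : x - y != 0 by rewrite subr_eq0.
have [k /andP[k1 k2]] := Qpn_norm_bracket R p_prime xy0.
have Bxy : B k x y by rewrite QballE Qpn_normB.
have my := ball_avg_ball_fun Bxy; clear Bxy.
apply: (@le_trans _ _ (2 * A' * radpow k)).
  apply: le_trans (ler_distD (m k x) _ _) _.
  have h1 := rep_dist k x; have h2 := rep_dist k y.
  rewrite my distrC in h2.
  by rewrite -mulrA mulr_natl mulr2n lerD.
rewrite (radpow_split k).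
rewrite [leLHS]mulrA; apply: ler_wpM2l; first exact: L0.
by apply: powR_mono; [exact: pX_ge0|exact: ltW|exact: ltW].
Qed.

Lemma campanato_lip_space : lip_space mu beta campanato_rep.
Proof. exact: (lipschitz_lip_space p_prime mu beta_gt0 L0 campanato_hoelder). Qed.

Let mrep : measurable_fun [set: T] (campanato_rep : T -> R).
Proof.
exact: (lipschitz_measurable p_prime beta_gt0 L0 campanato_hoelder).
Qed.

Let D x := `|b0 x - campanato_rep x|.

Let mD : measurable_fun [set: T] (D : T -> R).
Proof.
by apply: measurableT_comp; [exact: normr_measurable|exact: measurable_funB].
Qed.

Let D_le k x y : B k x y -> D y <= 1 * `|m k x - b0 y| + A' * radpow k.
Proof.
move=> /ball_avg_ball_fun my; rewrite mul1r /D [`|m k x - _|]distrC.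
apply: le_trans (ler_distD (m k x) _ _) _; rewrite lerD2l distrC -my.
exact: rep_dist.
Qed.

Let affine_i k x := ball_integrable_affine p_prime mu_haar ler01
  (mulr_ge0 A'0 (radpow_ge0 p_prime beta k)) (dist_i (m k x)).

Let Di : ball_integrable D.
Proof.
split=> [|x|k x]; [exact: mD|exact: normr_ge0|].
have [_ _ H] := affine_i k x.
apply: le_lt_trans (H k x); apply: ge0_le_integral_all => y xy.
  by rewrite lee_fin normr_ge0.
by rewrite lee_fin; exact: D_le.
Qed.

Let avg_D k x : avg D k x <= (A + A') * radpow k.
Proof.
apply: (@le_trans _ _ (1 * avg (fun y => `|m k x - b0 y|) k x + A' * radpow k)).
  rewrite -(avg_affine p_prime mu_haar k x ler01
    (mulr_ge0 A'0 (radpow_ge0 p_prime beta k)) (dist_i (m k x))).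
  apply: (avg_le p_prime); [by move=> y; exact: normr_ge0|exact: affine_i|].
  by apply: aeW => y xy; exact: D_le.
by rewrite mul1r mulrDl lerD2r.
Qed.

(** On a ball B_K the integral of |b - b'|, where b' is the continuous
    representative, may be computed after averaging over balls of radius p^j
    with j <= K, and these averages are at most a constant times p^(j beta).
    Letting j decrease makes it 0. *)
Lemma campanato_ae : {ae mu, forall x, b x = campanato_rep x}.
Proof.
pose i (K : nat) x : R := \1_(B K%:Z 0) x.
have i0 K x : 0 <= i K x by rewrite /i indicE.
have mi K : measurable_fun [set: T] (i K : T -> R).
  by apply: measurable_indic; exact: measurable_Qball.
have ibf K j : j <= K%:Z -> @ball_fun R p n j _ (i K).
  move=> jK x y /(Qball_le p_prime jK) xy; rewrite /i !indicE.
  have -> : (y \in B K%:Z 0) = (x \in B K%:Z 0); last exact: erefl.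
  apply/idP/idP => /set_mem H; apply/mem_set.
    exact: (Qball_trans H (Qball_sym xy)).
  exact: (Qball_trans H xy).
have int_le K e : 0 < e -> (\int[mu]_x (i K x * D x)%:E <= e%:E)%E.
  move=> e0; have c0 : 0 < e / ((A + A') * vol K + 1).
    by rewrite divr_gt0// ltr_wpDl// mulr_ge0 ?vol_ge0// addr_ge0// ltW.
  have [j j0 je] := radpow_small p_prime beta_gt0 c0.
  have jK : j <= K%:Z by apply: le_trans j0 _.
  rewrite -(avg_selfadj p_prime mu_haar Di (ibf K j jK) (i0 K)).
  have AA0 : 0 <= A + A' by rewrite addr_ge0// ltW.
  apply: (@le_trans _ _ (\int[mu]_x ((A + A') * radpow j * i K x)%:E)%E).
    apply: le_integral_real => x; first by rewrite mulr_ge0// avg_ge0// => y; exact: normr_ge0.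
    by rewrite mulrC ler_wpM2r.
  rewrite ge0_integralZl_real//; last by rewrite mulr_ge0// radpow_ge0.
  rewrite (integral_chi p_prime mu_haar K%:Z 0) -EFinM lee_fin.
  rewrite mulrAC; apply: mul_le_of_le_div je; last exact: e0.
  by rewrite mulr_ge0 ?vol_ge0.
pose G K : T -> \bar R := fun x => (i K x * D x)%:E.
have mG K : measurable_fun [set: T] (G K).
  by apply/measurable_EFinP; apply: measurable_funM; [exact: mi|exact: mD].
have iD0 K : {ae mu, forall x, i K x * D x = 0}.
  have iD_ge0 x : 0 <= i K x * D x by apply: mulr_ge0; [exact: i0|exact: normr_ge0].
  have I0 : (\int[mu]_x `|G K x| = 0)%E.
    apply/eqP; rewrite eq_le integral_ge0// andbT.
    apply/lee_addgt0Pr => e e0; rewrite add0e.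
    apply: le_trans (int_le K e e0); apply: ge0_le_integral_all => x _.
      exact: abse_ge0.
    by rewrite /= lee_fin ger0_norm.
  have H := (ae_eq_integral_abs mu measurableT (mG K)).1 I0.
  by apply: (ae_imp H) => x /(_ I) [].
have all0 := ae_countable iD0.
apply: (ae_imp2 all0 bb0) => x Hx ->.
have [K xK] := Qball_cover R p_prime 0 x.
have := Hx K; rewrite /i indicE mem_set// mul1r => /normr0P.
by rewrite subr_eq0 => /eqP.
Qed.

End MeanOscillation.

End Campanato.

Lemma osc_lipschitz (b : V -> R) q : loc_integrable mu b -> log_exponent mu q ->
  (osc_sup mu beta b q < +oo)%E ->
  exists2 b' : V -> R, {ae mu, forall x, b x = b' x} & lip_space mu beta b'.
Proof.
move=> bl lq fin; have [[b0 mb0 bb0] _] := bl.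
have b0i := loc_integrable_ae bl mb0 bb0.
have [A A0 osc] := mean_oscillation mb0 bb0 b0i lq fin.
exists (campanato_rep b A); first exact: (campanato_ae mb0 bb0 b0i A0 osc).
exact: (campanato_lip_space mb0 bb0 b0i A0 osc).
Qed.

Lemma lipschitz_osc (b : V -> R) r q : loc_integrable mu b -> admissible mu beta r q ->
  (exists2 b' : V -> R, {ae mu, forall x, b x = b' x} & lip_space mu beta b') ->
  (osc_sup mu beta b q < +oo)%E.
Proof.
move=> bl [_ [eq_ _] _ _ _] [b' bb' /lip_space_lipschitz [L L0 lipb]].
have q1 x : 1 <= q x by apply/ltW/exponent_gt1.
apply: (osc_sup_lty p_prime n_ge1 mu_haar q1 (S := L)) => k x.
exact: (lipschitz_deviation p_prime mu_haar beta_gt0 k x bl L0 lipb bb' q1).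
Qed.

End Equivalences.

Theorem corollary1p4 (R : realType) (p n : nat) (p_prime : prime p)
  (n_ge1 : (1 <= n)%N) (mu : {measure set (Qpn R p n) -> \bar R})
  (mu_haar : is_haar mu) (beta : R) (beta_gt0 : 0 < beta) (beta_lt1 : beta < 1)
  (b : 'rV[Qp p]_n -> R) (b_loc : loc_integrable mu b) :
  let C1 := exists2 b' : 'rV[Qp p]_n -> R,
    {ae mu, forall x, b x = b' x} & lip_space mu beta b' in
  let C2 := forall r q : 'rV[Qp p]_n -> R, admissible mu beta r q ->
    bounded_operator mu (max_commutator mu b) r q in
  let C3 := exists r q : 'rV[Qp p]_n -> R, admissible mu beta r q /\
    bounded_operator mu (max_commutator mu b) r q in
  let C4 := exists r q : 'rV[Qp p]_n -> R, admissible mu beta r q /\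
    (osc_sup mu beta b q < +oo)%E in
  let C5 := forall r q : 'rV[Qp p]_n -> R, admissible mu beta r q ->
    (osc_sup mu beta b q < +oo)%E in
  [/\ C1 <-> C2, C1 <-> C3, C1 <-> C4 & C1 <-> C5].
Proof.
move=> C1 C2 C3 C4 C5.
have [r0 [q0 adm0]] := admissible_ex p_prime n_ge1 mu_haar beta_gt0 beta_lt1.
have C12 : C1 -> C2.
  move=> [b' bb' /lip_space_lipschitz [L L0 lipb]] r q adm.
  exact: (lipschitz_bounded p_prime n_ge1 mu_haar beta_gt0 L0 lipb bb' adm).
have C15 : C1 -> C5.
  by move=> c1 r q adm; exact: (lipschitz_osc p_prime n_ge1 mu_haar beta_gt0 b_loc adm c1).
have C23 : C2 -> C3 by move=> c2; exists r0, q0; exact: (conj adm0 (c2 r0 q0 adm0)).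
have C54 : C5 -> C4 by move=> c5; exists r0, q0; exact: (conj adm0 (c5 r0 q0 adm0)).
have C34 : C3 -> C4.
  move=> [r [q [adm bnd]]]; exists r, q; split; first exact: adm.
  exact: (bounded_osc p_prime n_ge1 mu_haar beta_gt0 b_loc adm bnd).
have C41 : C4 -> C1.
  move=> [r [q [[_ lq _ _ _] fin]]].
  exact: (osc_lipschitz p_prime n_ge1 mu_haar beta_gt0 b_loc lq fin).
by split; split; auto.
Qed.
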